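(* The \textsc{Paw-free Edge Editing} problem, parameterized by $k$, admits a kernel with $\mathcal{O}(k^6)$ vertices. That is, there is a polynomial-time algorithm that, given an instance $(G,k)$, outputs an instance $(G',k')$ of the same problem with $k'\le k$ such that $(G',k')$ is a yes-instance if and only if $(G,k)$ is a yes-instance, and $G'$ has $\mathcal{O}(k^6)$ vertices.
   Context: The paw is the graph on four vertices $x_1,x_2,x_3,x_4$ with edges $x_1x_2,x_2x_3,x_1x_3,x_3x_4$ (a triangle with one pendant edge). A graph is paw-free if it contains no induced subgraph isomorphic to the paw. For a graph $G$ and a set $A$ of unordered pairs of distinct vertices of $G$, $G\Delta A$ denotes the graph on $V(G)$ whose edge set is the symmetric difference of $E(G)$ and $A$. \textsc{Paw-free Edge Editing}: given a graph $G$ and an integer $k$, decide whether there is a set $A$ of at most $k$ unordered vertex pairs such that $G\Delta A$ is paw-free (i.e., at most $k$ edge additions/deletions). A kernel is a polynomial-time algorithm mapping an instance $(G,k)$ to an equivalent instance $(G',k')$ whose size is bounded by a function of $k$ only. *)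

(* Defs.v *)
From mathcomp Require Import all_boot.
Set Implicit Arguments. Unset Strict Implicit. Unset Printing Implicit Defensive.

Record graph := Graph {
  gn : nat;
  gadj : rel 'I_gn;
  gadj_sym : forall x y, gadj x y = gadj y x;
  gadj_irr : forall x, gadj x x = false }.

Definition pawfree (n : nat) (e : rel 'I_n) : Prop :=
  forall x1 x2 x3 x4 : 'I_n, uniq [:: x1; x2; x3; x4] ->
    ~~ [&& e x1 x2, e x2 x3, e x1 x3, e x3 x4, ~~ e x1 x4 & ~~ e x2 x4].

(* Unordered pairs {u,v} (u <> v) are represented by ordered pairs (u,v)
   with u < v.  G Δ A : symmetric difference of E(G) with A. *)
Definition gdelta (n : nat) (e : rel 'I_n) (A : {set 'I_n * 'I_n}) : rel 'I_n :=
  fun u v => xorb (e u v) (((u, v) \in A) || ((v, u) \in A)).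

Definition PFEE (G : graph) (k : nat) : Prop :=
  exists A : {set 'I_(gn G) * 'I_(gn G)},
    (forall p, p \in A -> p.1 < p.2) /\ #|A| <= k /\ pawfree (gdelta (@gadj G) A).

(* Symbols are naturals, 0 is the blank.  A machine has finitely many states
   (< tm_nstates) and tape symbols (< tm_nsyms); delta returning None = halt. *)
Inductive move := MoveL | MoveR | MoveS.

Record TM := mkTM {
  tm_nstates : nat;
  tm_nsyms : nat;
  tm_delta : nat -> nat -> option (nat * nat * move) }.

Definition TM_wf (M : TM) : Prop :=
  4 <= tm_nsyms M /\
  forall q a q' a' m, tm_delta M q a = Some (q', a', m) ->
    q' < tm_nstates M /\ a' < tm_nsyms M.

(* configuration: state, tape left of head (reversed), head symbol, tape right *)
Record config := Cfg { c_st : nat; c_left : seq nat; c_cur : nat; c_right : seq nat }.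

Definition step (M : TM) (c : config) : option config :=
  match tm_delta M (c_st c) (c_cur c) with
  | None => None
  | Some (q, a, m) =>
    Some (match m with
          | MoveS => Cfg q (c_left c) a (c_right c)
          | MoveL => match c_left c with
                     | [::] => Cfg q [::] 0 (a :: c_right c)
                     | b :: l => Cfg q l b (a :: c_right c)
                     end
          | MoveR => match c_right c with
                     | [::] => Cfg q (a :: c_left c) 0 [::]
                     | b :: r => Cfg q (a :: c_left c) b r
                     end
          end)
  end.

Fixpoint run (M : TM) (c : config) (t : nat) : option config :=
  match step M c with
  | None => Some c
  | Some c' => match t with 0 => None | t'.+1 => run M c' t' end
  end.

Definition init_config (w : seq nat) : config :=
  match w with
  | [::] => Cfg 0 [::] 0 [::]
  | a :: r => Cfg 0 [::] a r
  end.

Definition output (c : config) : seq nat :=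
  let s := c_cur c :: c_right c in take (find (pred1 0) s) s.

(* symbol 1 = bit 0, symbol 2 = bit 1 / unary digit, symbol 3 = separator *)
Definition encode (G : graph) (k : nat) : seq nat :=
  nseq (gn G) 2 ++ [:: 3] ++
  [seq (if gadj i j then 2 else 1) | i <- enum 'I_(gn G), j <- enum 'I_(gn G)] ++
  [:: 3] ++ nseq k 2.

(* Main.v *)
(**
Call a pair of vertices edited if a solution changes it. A solution of size k
edits at most 2k vertices, so among more than 2k vertices that look alike one is
untouched; with m = 4k + 4 this is the principle behind every reduction below.

Greedily add to S the vertices of a paw meeting S in at most one vertex. The
packed paws share no pair, so |S| > m means a no-instance; otherwise every paw
has two vertices in S. For s, t in S, greedily collect paws pairwise meeting in
{s, t} only; if they cover more than m vertices, the pair st must be edited,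
which is done at once, decreasing k. Otherwise the union H of these sets has at
most m^3 vertices and every paw has three vertices in S u H.

By Olariu, a component of a paw-free graph is triangle-free or complete
multipartite. Outside S this structure allows to drop triangle components not
adjacent to S, false twins beyond m + 1 and parts beyond m + 1. In the
remaining set X, the core A consists of S u H, of the vertices of triangles
avoiding S and of those of triangles meeting S u H once; |A| = O(m^4). A
vertex of X \ A is either in no triangle of X or only in triangles with two
vertices in A, one of them in S. The kernel consists of A and, for each a in A
(and again for each vertex marked in this way, and for each pair in S x A), of
the first m + 1 vertices of X \ A attached to it in a given way, O(m^6) in all.
A solution on the kernel minimizing first edits and then additions extends to
X: a vertex outside the kernel either sees no triangle component of the solution
or is a false twin of an untouched kernel vertex.

The polynomial-time Turing machine is compiled from a language with loops over
vertices, boolean matrices and counters, whose variables, arrays and counters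
are tracks of the adjacency matrix on the tape; the input is copied if n <= k.
*)
Require Import Defs.
From mathcomp Require Import all_boot.
From mathcomp Require Import zify.
From Stdlib Require Import FunctionalExtensionality Classical.
Set Implicit Arguments. Unset Strict Implicit. Unset Printing Implicit Defensive.

(** * Tape programs and Turing machines *)

(** The obstacle in lifting a solution from the kernel to [X] is a kept vertex [r], in no triangle
    of [X], that the solution pulls into a triangle component: a discarded neighbor of [r] would
    then hang on that component and form a paw. Minimality controls this: such an [r] keeps an
    original edge to a vertex of an original triangle ([kept_neighbor]), hence, if [r] is outside
    the core, to a core vertex; therefore marked vertices get a second round of marking. What is
    minimized is the sum of edits and additions, so it suffices to exclude exchanges that do not
    raise the edits and strictly lower the additions. The threshold [m = 4 * k + 4] serves three
    counts: a packing has at most [4 * k] vertices, the petals of an unedited pair at most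
    [4 * k + 2], and among more than [2 * k + 2] parts three are untouched and span a triangle. The
    case [n <= k] is set apart because the rounds are a loop over the [n] vertices: every unfinished
    round spends one unit of budget, so [n] rounds are enough when [k < n]. *)

Section TapePrograms.
Variable sym : Type.

Inductive lp :=
  | Nop
  | Do of (sym -> sym) & move
  | Sq of lp & lp
  | Br of pred sym & lp & lp
  | Wh of pred sym & lp.

Definition upd (t : nat -> sym) (h : nat) (s : sym) : nat -> sym :=
  fun i => if i == h then s else t i.

Lemma upd_id t h : upd t h (t h) = t.
Proof. by apply: functional_extensionality => i; rewrite /upd; case: eqP => [->|]. Qed.

Definition mv (m : move) (h : nat) : nat :=
  match m with MoveL => h.-1 | MoveR => h.+1 | MoveS => h end.

(** A left move at the left end of a machine tape creates a new blank cell there and shifts all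
    positions. Programs never do this, so cells keep fixed numbers from 0 on. *)
Definition mv_ok (m : move) (h : nat) : bool := if m is MoveL then 0 < h else true.

(** The counts are those of the compiled code: one step for each test, and one for the jump that
    ends the first branch of [Br] or the body of [Wh]. *)
Inductive exec : lp -> (nat -> sym) -> nat -> nat -> (nat -> sym) -> nat -> Prop :=
  | ExNop t h : exec Nop t h 0 t h
  | ExDo f m t h : mv_ok m h -> exec (Do f m) t h 1 (upd t h (f (t h))) (mv m h)
  | ExSq p q t h n1 t1 h1 n2 t2 h2 : exec p t h n1 t1 h1 -> exec q t1 h1 n2 t2 h2 ->
      exec (Sq p q) t h (n1 + n2) t2 h2
  | ExBrT (b : pred sym) p q t h n t1 h1 : b (t h) -> exec p t h n t1 h1 ->
      exec (Br b p q) t h n.+2 t1 h1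
  | ExBrF (b : pred sym) p q t h n t1 h1 : ~~ b (t h) -> exec q t h n t1 h1 ->
      exec (Br b p q) t h n.+1 t1 h1
  | ExWhF (b : pred sym) p t h : ~~ b (t h) -> exec (Wh b p) t h 1 t h
  | ExWhT (b : pred sym) p t h n1 t1 h1 n2 t2 h2 : b (t h) -> exec p t h n1 t1 h1 ->
      exec (Wh b p) t1 h1 n2 t2 h2 -> exec (Wh b p) t h (n1.+2 + n2) t2 h2.

Fixpoint sz (p : lp) : nat :=
  match p with
  | Nop => 0
  | Do _ _ => 1
  | Sq p q => sz p + sz q
  | Br _ p q => sz p + sz q + 2
  | Wh _ p => sz p + 2
  end.

(* Code of [p] on the states [base, base + sz p); [base + sz p] is its exit. *)
Fixpoint tr (p : lp) (base q : nat) (a : sym) : option (nat * sym * move) :=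
  match p with
  | Nop => None
  | Do f m => Some (base.+1, f a, m)
  | Sq p1 p2 => if q < base + sz p1 then tr p1 base q a else tr p2 (base + sz p1) q a
  | Br b p1 p2 =>
      if q == base then Some (if b a then base.+1 else base + sz p1 + 2, a, MoveS)
      else if q < base.+1 + sz p1 then tr p1 base.+1 q a
      else if q == base.+1 + sz p1 then Some (base + (sz p1 + sz p2 + 2), a, MoveS)
      else tr p2 (base + sz p1 + 2) q a
  | Wh b p =>
      if q == base then Some (if b a then base.+1 else base + (sz p + 2), a, MoveS)
      else if q < base.+1 + sz p then tr p base.+1 q a
      else Some (base, a, MoveS)
  end.

Lemma tr_bound p base q a q' s m :
  tr p base q a = Some (q', s, m) -> q' <= base + sz p.
Proof.
elim: p base => [|f mm|p1 IH1 p2 IH2|b p1 IH1 p2 IH2|b p IH] base //=.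
- by case=> <- _ _; lia.
- by case: ifP => _; [move/IH1|move/IH2]; lia.
- case: ifP => _; first by case=> <- _ _; case: ifP; lia.
  case: ifP => _; first by move/IH1; lia.
  by case: ifP => _; [case=> <- _ _|move/IH2]; lia.
case: ifP => _; first by case=> <- _ _; case: ifP; lia.
by case: ifP => _; [move/IH|case=> <- _ _]; lia.
Qed.

Variable D : nat -> sym -> option (nat * sym * move).

Inductive reach : nat -> nat -> (nat -> sym) -> nat -> nat -> (nat -> sym) -> nat -> Prop :=
  | Reach0 q t h : reach 0 q t h q t h
  | ReachS n q t h q1 s m q2 t2 h2 : D q (t h) = Some (q1, s, m) -> mv_ok m h ->
      reach n q1 (upd t h s) (mv m h) q2 t2 h2 -> reach n.+1 q t h q2 t2 h2.

Lemma reach_trans n1 n2 q t h q1 t1 h1 q2 t2 h2 :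
  reach n1 q t h q1 t1 h1 -> reach n2 q1 t1 h1 q2 t2 h2 ->
  reach (n1 + n2) q t h q2 t2 h2.
Proof.
elim=> // {n1 q t h q1 t1 h1} n q t h q1 s m q3 t3 h3 E ok _ IH /IH.
exact: ReachS.
Qed.

Lemma reach_jump q t h q1 : D q (t h) = Some (q1, t h, MoveS) -> reach 1 q t h q1 t h.
Proof. by move=> E; apply: (ReachS E) => //=; rewrite upd_id; apply: Reach0. Qed.

(** Agreement of [D] with the code is asked only on the interval of [p], which lets the induction
    descend to subprograms inside a larger table; the exit state is the entry of whatever
    follows. *)
Lemma exec_reach p t h n t' h' base : exec p t h n t' h' ->
  (forall q a, base <= q < base + sz p -> D q a = tr p base q a) ->
  reach n base t h (base + sz p) t' h'.
Proof.
move=> ex; elim: ex base => {p t h n t' h'}.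
- by move=> t h base _; rewrite addn0; apply: Reach0.
- move=> f m t h ok base E; apply: (ReachS (q1 := base.+1) (s := f (t h)) (m := m)) => //.
    by rewrite E //=; lia.
  by rewrite /= addn1; apply: Reach0.
- move=> p q t h n1 t1 h1 n2 t2 h2 _ IH1 _ IH2 base E.
  apply: reach_trans; first apply: (IH1 base).
    by move=> q' a b'; rewrite E /=; [rewrite ifT //; lia|lia].
  rewrite /= addnA; apply: IH2 => q' a b'; rewrite E /=; last lia.
  by rewrite ifF //; lia.
- move=> b p q t h n t1 h1 bt _ IH base E.
  have -> : n.+2 = 1 + n + 1 by lia.
  apply: (reach_trans (q1 := base.+1 + sz p)).
    apply: (reach_trans (q1 := base.+1)).
      by apply: reach_jump; rewrite E /= ?eqxx ?bt //; lia.
    apply: IH => q' a b'; rewrite E /=; last lia.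
    by rewrite ifF ?ifT //; lia.
  apply: reach_jump; rewrite E /=; last lia.
  by rewrite ifF; [rewrite ifF; [rewrite eqxx|lia]|lia].
- move=> b p q t h n t1 h1 /negbTE bt _ IH base E.
  rewrite -add1n; apply: (reach_trans (q1 := base + sz p + 2)).
    by apply: reach_jump; rewrite E /= ?eqxx ?bt //; lia.
  have -> : base + sz (Br b p q) = base + sz p + 2 + sz q by rewrite /=; lia.
  apply: IH => q' a b'; rewrite E /=; last lia.
  by rewrite !ifF //; lia.
- move=> b p t h /negbTE bt base E.
  by apply: reach_jump; rewrite E /= ?eqxx ?bt //; lia.
- move=> b p t h n1 t1 h1 n2 t2 h2 bt _ IH1 _ IH2 base E.
  apply: reach_trans (IH2 base E).
  have -> : n1.+2 = 1 + n1 + 1 by lia.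
  apply: (reach_trans (q1 := base.+1 + sz p)).
    apply: (reach_trans (q1 := base.+1)).
      by apply: reach_jump; rewrite E /= ?eqxx ?bt //; lia.
    apply: IH1 => q' a b'; rewrite E /=; last lia.
    by rewrite ifF ?ifT //; lia.
  apply: reach_jump; rewrite E /=; last lia.
  by rewrite !ifF //; lia.
Qed.

End TapePrograms.

Section Machine.
Variables (sym : Type) (enc : sym -> nat) (dec : nat -> sym) (ns : nat).
Hypothesis encK : cancel enc dec.
Hypothesis enc_lt : forall s, enc s < ns.
Hypothesis ns4 : 4 <= ns.

Definition tm_of (p : lp sym) : TM :=
  mkTM (sz p).+1 ns (fun q a =>
    if q < sz p then
      if tr p 0 q (dec a) is Some (q', s, m) then Some (q', enc s, m) else None
    else None).

Lemma tm_of_wf p : TM_wf (tm_of p).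
Proof.
split=> // q a q' a' m /=; case: ifP => // _.
case E: (tr p 0 q (dec a)) => [[[q1 s] m1]|] // [<- <- _]; split=> //.
by have := tr_bound E; rewrite add0n ltnS.
Qed.

Definition represents (c : config) (q : nat) (t : nat -> sym) (h : nat) : Prop :=
  [/\ c_st c = q, size (c_left c) = h
    & forall i, nth 0 (rev (c_left c) ++ c_cur c :: c_right c) i = enc (t i)].

Hypothesis dec0 : enc (dec 0) = 0.

(** [run] answers only once [step] fails. States from [sz p] on have no transition, so fuel [n] is
    exactly what [n] moves need. *)
Lemma run_reach p n q t h q' t' h' c :
  reach (fun q a => if q < sz p then tr p 0 q a else None) n q t h q' t' h' ->
  sz p <= q' -> represents c q t h ->
  exists2 c', run (tm_of p) c n = Some c' & represents c' q' t' h'.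
Proof.
move=> R le_q'; elim: R c le_q' => {n q t h q' t' h'} [q t h|n q t h q1 s m q2 t2 h2 E ok _ IH] c le_q' rc.
  exists c => //; rewrite /run /step /=; case: rc => -> _ _.
  by rewrite ltnNge le_q'.
have [cq cl ct] := rc.
have ccur : c_cur c = enc (t h).
  by rewrite -ct nth_cat size_rev cl ltnn subnn.
have Es : tm_delta (tm_of p) (c_st c) (c_cur c) = Some (q1, enc s, m).
  by rewrite /= cq ccur encK; move: E; case: ifP => // _ ->.
rewrite /= /step Es.
case: c {rc} cq cl ct ccur Es => st l a r /= cq cl ct ccur Es.
have leftP i : i < h -> nth 0 (rev l) i = enc (t i).
  by move=> lt_i; rewrite -ct nth_cat size_rev cl lt_i.
have rightP i : nth 0 r i = enc (t (h + i.+1)).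
  rewrite -ct nth_cat size_rev cl ltnNge leq_addr /= addKn //.
apply: IH => //; case: m ok {E Es} => /= ok.
- case: l cl ct leftP => [|b l] /= cl ct leftP; first by rewrite -cl in ok.
  split=> //=; first by rewrite -cl.
  move=> i; rewrite /upd; case: eqP => [->|ne].
    by rewrite nth_cat size_rev -cl /= ltnNge leqnSn /= subSnn.
  case: (ltnP i h) => [lt_i|ge_i].
    rewrite -leftP // rev_cons -cats1 -[in RHS](cats0 (_ ++ _)) !nth_cat size_cat size_rev /= addn1 cl lt_i.
    case: ltnP => // ge_i; have -> : i - size l = 0 by lia.
    by [].
  rewrite nth_cat size_rev ltnNge; have -> /= : size l <= i by lia.
  have -> : i - size l = (i - h.+1).+2 by lia.
  by rewrite /= rightP; congr (enc (t _)); lia.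
- case: r ct rightP => [|b r] /= ct rightP; split=> //=; rewrite ?cl // => i;
  rewrite rev_cons cat_rcons /upd; case: eqP => [->|ne];
    rewrite ?nth_cat ?size_rev ?cl ?ltnn ?subnn //=;
  (case: ltnP => ge_i; first by rewrite leftP);
      have -> : i - h = (i - h.+1).+1 by lia.
    rewrite /=; have := rightP (i - h.+1); have -> : h + (i - h.+1).+1 = i by lia.
    by rewrite nth_nil => <-; case: (_ - _) => [|[]].
  by rewrite /= -[LHS]/(nth 0 (b :: r) (i - h.+1)) rightP; congr (enc (t _)); lia.
split=> //= i; rewrite /upd; case: eqP => [->|ne].
  by rewrite nth_cat size_rev cl ltnn subnn.
rewrite -ct !nth_cat size_rev cl; case: ltnP => // ge_i.
by have -> : i - h = (i - h.+1).+1 by lia.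
Qed.

Lemma run_exec p w n t' h' :
  exec p (fun i => dec (nth 0 w i)) 0 n t' h' ->
  (forall a, a \in w -> enc (dec a) = a) ->
  exists2 c, run (tm_of p) (init_config w) n = Some c &
    represents c (sz p) t' h'.
Proof.
move=> ex ew.
apply: (run_reach (q := 0) (t := fun i => dec (nth 0 w i)) (h := 0)) => //.
  rewrite -[sz p]add0n; apply: exec_reach => // q a lt_q.
  by rewrite add0n in lt_q *; case/andP: lt_q => _ ->.
split; case: w ew {ex} => //= [|a w] ew i.
  by rewrite nth_nil dec0; case: i => //= i; rewrite nth_nil.
case: (ltnP i (size (a :: w))) => [lt_i|ge_i]; last by rewrite nth_default // dec0.
by rewrite ew // mem_nth.
Qed.

(** [output] reads up to the first 0. Hence [s] must avoid 0 and the tape behind it must be blank,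
    which the default value of [nth] past the end of [s] expresses. *)
Lemma output_represents c q t h (s : seq nat) :
  represents c q t h -> (forall i, enc (t (h + i)) = nth 0 s i) -> 0 \notin s ->
  output c = s.
Proof.
case=> _ cl ct ts s0.
have nthE i : nth 0 (c_cur c :: c_right c) i = nth 0 s i.
  by rewrite -ts -ct nth_cat size_rev cl ltnNge leq_addr /= addKn.
rewrite /output; set u := _ :: _ in nthE *.
have size_s : size s <= size u.
  rewrite leqNgt; apply/negP => lt_u; case/negP: s0.
  by have := nthE (size u); rewrite nth_default // => ->; rewrite mem_nth.
have fu : find (pred1 0) u = size s.
  apply/eqP; rewrite eqn_leq; apply/andP; split; rewrite leqNgt; apply/negP => lt_s.
    by have := before_find 0 lt_s; rewrite /= nthE nth_default.
  have /(nth_find 0) : has (pred1 0) u by rewrite has_find (leq_trans lt_s).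
  by rewrite /= nthE => /eqP E; case/negP: s0; rewrite -E mem_nth.
apply: (@eq_from_nth _ 0); first by rewrite fu size_takel.
by rewrite fu size_takel // => i lt_i; rewrite nth_take.
Qed.

End Machine.

(** * A loop language over the vertices of a graph *)

Section Runs.
Variable sym : Type.
Implicit Types (p q : lp sym) (b : pred sym) (t : nat -> sym) (h B : nat).

Definition runs p t h B t' h' := exists2 k, k <= B & exec p t h k t' h'.

Lemma runsW p t h B B' t' h' : runs p t h B t' h' -> B <= B' -> runs p t h B' t' h'.
Proof. by case=> k le_k ex le_B; exists k => //; apply: leq_trans le_B. Qed.

Lemma runs_Nop t h : runs (@Nop sym) t h 0 t h.
Proof. by exists 0 => //; apply: ExNop. Qed.

Lemma runs_Do f m t h : mv_ok m h -> runs (Do f m) t h 1 (upd t h (f (t h))) (mv m h).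
Proof. by exists 1 => //; apply: ExDo. Qed.

Lemma runs_DoS f t h : runs (Do f MoveS) t h 1 (upd t h (f (t h))) h.
Proof. exact: (@runs_Do f MoveS). Qed.

Lemma runs_Sq p q t h B1 t1 h1 B2 t2 h2 : runs p t h B1 t1 h1 -> runs q t1 h1 B2 t2 h2 ->
  runs (Sq p q) t h (B1 + B2) t2 h2.
Proof.
by case=> k1 le1 ex1 [k2 le2 ex2]; exists (k1 + k2); [apply: leq_add|apply: ExSq ex1 ex2].
Qed.

Lemma runs_Br b p q t h B t1 h1 :
  runs (if b (t h) then p else q) t h B t1 h1 -> runs (Br b p q) t h B.+2 t1 h1.
Proof.
case: ifPn => bt [k le_k ex]; [exists k.+2 => //|exists k.+1; [lia|]].
  exact: ExBrT.
exact: ExBrF.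
Qed.

Lemma runs_Wh b p (I : nat -> (nat -> sym) -> nat -> Prop) N B :
  (forall i t h, i < N -> I i t h ->
     b (t h) /\ exists t' h', runs p t h B t' h' /\ I i.+1 t' h') ->
  (forall t h, I N t h -> ~~ b (t h)) ->
  forall t h, I 0 t h ->
  exists t' h', runs (Wh b p) t h (N * (B + 2) + 1) t' h' /\ I N t' h'.
Proof.
move=> stepI endI.
suff gen j : j <= N -> forall t h, I (N - j) t h ->
    exists t' h', runs (Wh b p) t h (j * (B + 2) + 1) t' h' /\ I N t' h'.
  by move=> t h I0; apply: (gen N) => //; rewrite subnn.
elim: j => [|j IH] le_j t h It.
  rewrite subn0 in It; exists t, h; split=> //; exists 1 => //.
  by apply: ExWhF; apply: endI.
have lt_N : N - j.+1 < N by lia.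
have [bt [t1 [h1 [[k1 le1 ex1] I1]]]] := stepI _ _ _ lt_N It.
have E : (N - j.+1).+1 = N - j by lia.
rewrite E in I1; have [t2 [h2 [[k2 le2 ex2] I2]]] := IH (ltnW le_j) t1 h1 I1.
by exists t2, h2; split=> //; exists (k1.+2 + k2); [lia|apply: ExWhT ex1 ex2].
Qed.

Definition Goto b := Wh (fun s => ~~ b s) (Do id MoveR).

Lemma runs_Goto b t h d : (forall i, i < d -> ~~ b (t (h + i))) -> b (t (h + d)) ->
  runs (Goto b) t h (3 * d + 1) t (h + d).
Proof.
move=> nb bt.
have [|||t' [h' [R [Et Eh]]]] := @runs_Wh (fun s => ~~ b s) (Do id MoveR)
    (fun i t' h' => t' = t /\ h' = h + i) d 1 _ _ t h.
- move=> i _ _ lt_i [-> ->]; rewrite nb //; split=> //.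
  exists t, (h + i).+1; split; last by rewrite addnS.
  by rewrite -[t in X in runs _ _ _ _ X _](upd_id t (h + i)); apply: runs_Do.
- by move=> _ _ [-> ->]; rewrite bt.
- by rewrite addn0.
by move: R; rewrite Et Eh => /runsW; apply; lia.
Qed.

Definition GoBack b := Wh (fun s => ~~ b s) (Do id MoveL).

Lemma runs_GoBack b t h d : (forall i, i < d -> ~~ b (t (h + i.+1))) -> b (t h) ->
  runs (GoBack b) t (h + d) (3 * d + 1) t h.
Proof.
move=> nb bt.
have [|||t' [h' [R [Et Eh]]]] := @runs_Wh (fun s => ~~ b s) (Do id MoveL)
    (fun i t' h' => t' = t /\ h' = h + (d - i)) d 1 _ _ t (h + d).
- move=> i _ _ lt_i [-> ->].
  have -> : h + (d - i) = h + (d - i.+1).+1 by lia.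
  rewrite nb; last lia; split=> //.
  exists t, (h + (d - i.+1)); split=> //.
  set g := h + _.
  have -> : h + (d - i.+1) = mv MoveL g by rewrite /g /=; lia.
  rewrite -[t in X in runs _ _ _ _ X _](upd_id t g); apply: runs_Do.
  by rewrite /g /=; lia.
- by move=> _ _ [-> ->]; rewrite subnn addn0 bt.
- by rewrite subn0.
by move: R; rewrite Et Eh subnn addn0 => /runsW; apply; lia.
Qed.

End Runs.

Section Language.
Variables (V A F C : finType).

(* [ECnt (Some c) x e] compares the number of [x] satisfying [e] with the
   counter [c], [ECnt None x e] with [0]. *)
Inductive expr :=
  | EArr of A & V & V
  | EFlg of F
  | EPos of C
  | EEq of V & V
  | ELt of V & V
  | ENot of expr
  | EAnd of expr & expr
  | ECnt of option C & V & expr.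

Inductive cmd :=
  | Skip
  | Seq of cmd & cmd
  | If of expr & cmd & cmd
  | For of V & cmd
  | SetA of A & V & V & expr
  | SetF of F & expr
  | Take of F
  | Push of C
  | Pop of C
  | Out of 'I_3.

Record store := Store {
  arr : A -> nat -> nat -> bool;
  flg : F -> bool;
  cnt : C -> nat;
  kin : nat;
  outp : seq 'I_3 }.

Definition set_arr st a f :=
  Store (fun b => if b == a then f else arr st b) (flg st) (cnt st) (kin st) (outp st).
Definition set_flg st f v :=
  Store (arr st) (fun g => if g == f then v else flg st g) (cnt st) (kin st) (outp st).
Definition set_cnt st c v :=
  Store (arr st) (flg st) (fun d => if d == c then v else cnt st d) (kin st) (outp st).

Section Semantics.
Variable n : nat.

Definition upde (env : V -> 'I_n) x i : V -> 'I_n := fun y => if y == x then i else env y.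

Definition thr st (o : option C) := if o is Some c then cnt st c else 0.

Fixpoint beval (env : V -> 'I_n) (st : store) (e : expr) : bool :=
  match e with
  | EArr a x y => arr st a (env x) (env y)
  | EFlg f => flg st f
  | EPos c => 0 < cnt st c
  | EEq x y => env x == env y
  | ELt x y => env x < env y
  | ENot e => ~~ beval env st e
  | EAnd e1 e2 => beval env st e1 && beval env st e2
  | ECnt o x e => thr st o < #|[pred i | beval (upde env x i) st e]|
  end.

(** [Push] saturates at [n * n] because a counter is a unary track of the matrix with one digit per
    cell. [Take] consumes the input budget, which stays behind the matrix and may be longer. *)
Fixpoint eval (env : V -> 'I_n) (c : cmd) (st : store) : store :=
  match c with
  | Skip => st
  | Seq c1 c2 => eval env c2 (eval env c1 st)
  | If e c1 c2 => if beval env st e then eval env c1 st else eval env c2 st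
  | For x c => foldl (fun s i => eval (upde env x i) c s) st (enum 'I_n)
  | SetA a x y e =>
      let b := beval env st e in
      set_arr st a (fun i j => if (i == env x) && (j == env y) then b else arr st a i j)
  | SetF f e => set_flg st f (beval env st e)
  | Take f => let s := set_flg st f (0 < kin st) in
      Store (arr s) (flg s) (cnt s) (kin st).-1 (outp s)
  | Push c => set_cnt st c (minn (n * n) (cnt st c).+1)
  | Pop c => set_cnt st c (cnt st c).-1
  | Out s => Store (arr st) (flg st) (cnt st) (kin st) (rcons (outp st) s)
  end.

End Semantics.

(* Quantified variables must be fresh: each one owns a single pair of tracks. *)
Fixpoint wfE (bnd : seq V) (e : expr) : bool :=
  match e with
  | EArr _ x y | EEq x y | ELt x y => (x \in bnd) && (y \in bnd)
  | EFlg _ | EPos _ => true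
  | ENot e => wfE bnd e
  | EAnd e1 e2 => wfE bnd e1 && wfE bnd e2
  | ECnt _ x e => (x \notin bnd) && wfE (x :: bnd) e
  end.

Fixpoint wfC (bnd : seq V) (c : cmd) : bool :=
  match c with
  | Skip | Take _ | Push _ | Pop _ | Out _ => true
  | Seq c1 c2 => wfC bnd c1 && wfC bnd c2
  | If e c1 c2 => [&& wfE bnd e, wfC bnd c1 & wfC bnd c2]
  | For x c => (x \notin bnd) && wfC (x :: bnd) c
  | SetA _ x y e => [&& x \in bnd, y \in bnd & wfE bnd e]
  | SetF _ e => wfE bnd e
  end.

(* Tracks of a matrix cell: row and column marks of a variable, local and
   global unary counters, arrays, flags (in the first cell only), and
   0: first cell, 1: first cell of a row, 2 and 3: scratch, 4: result. *)
Definition trk : finType := ((V + V + V) + (A + F + C) + 'I_5)%type.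
Definition Row x : trk := inl (inl (inl (inl x))).
Definition Col x : trk := inl (inl (inl (inr x))).
Definition Lc x : trk := inl (inl (inr x)).
Definition Ar a : trk := inl (inr (inl (inl a))).
Definition Fg f : trk := inl (inr (inl (inr f))).
Definition Ct c : trk := inl (inr (inr c)).
Definition Aux i : trk := inr i.
Definition tFst := Aux (@Ordinal 5 0 isT).
Definition tRS := Aux (@Ordinal 5 1 isT).
Definition tTmp := Aux (@Ordinal 5 2 isT).
Definition tTmp2 := Aux (@Ordinal 5 3 isT).
Definition tRes := Aux (@Ordinal 5 4 isT).

Definition cell : finType := {ffun trk -> bool}.
(** The raw symbols are the blank, the three input symbols, which also serve as output symbols, two
    marks of the left end of the tape, a consumed budget digit and the separator in front of the
    output. *)
Definition sym : finType := ('I_8 + cell)%type.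

Definition raw (k : 'I_8) : sym := inl k.
Definition blank := raw (@Ordinal 8 0 isT).
Definition oraw (s : 'I_3) : sym := raw (inord s.+1).
Definition sOne := raw (@Ordinal 8 1 isT).
Definition sTwo := raw (@Ordinal 8 2 isT).
Definition sThree := raw (@Ordinal 8 3 isT).
Definition sDead := raw (@Ordinal 8 6 isT).
Definition sOut := raw (@Ordinal 8 7 isT).

Definition isCell (s : sym) : bool := if s is inr _ then true else false.
Definition get (u : trk) (s : sym) : bool := if s is inr c then c u else false.
Definition put (u : trk) (b : bool) (s : sym) : sym :=
  if s is inr c then inr [ffun v => if v == u then b else (c : cell) v] else s.

Lemma get_put u v b s : isCell s -> get u (put v b s) = if u == v then b else get u s.
Proof. by case: s => // c _; rewrite /= ffunE. Qed.

Lemma isCell_put v b s : isCell (put v b s) = isCell s.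
Proof. by case: s. Qed.

Lemma put_raw v b s : ~~ isCell s -> put v b s = s.
Proof. by case: s. Qed.

Definition GoHome := GoBack (get tFst).

(** A pass from left to right that carries one bit. Programs have no registers, so the bit is stored
    in track [tTmp] of the next cell; [co] is read before track [w] is overwritten. On the separator
    behind the matrix [put] has no effect. *)
Definition Sweep (w : trk) (phi co : pred sym) : lp sym :=
  Sq (Do (put tTmp false) MoveS)
 (Sq (Wh isCell
       (Br co (Sq (Do (fun s => put w (phi s) s) MoveR) (Do (put tTmp true) MoveS))
              (Sq (Do (fun s => put w (phi s) s) MoveR) (Do (put tTmp false) MoveS))))
     GoHome).

Definition initCol x := Sweep (Col x) (get tRS) (fun _ => false).
Definition initRow x :=
  let phi s := get tFst s || (get tTmp s && ~~ get tRS s) in Sweep (Row x) phi phi.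
Definition shiftCol x := Sweep (Col x) (fun s => get tTmp s && ~~ get tRS s) (get (Col x)).
(** The first pass marks in [tTmp2] the row start that follows a cell of the old row, the second
    spreads this mark to the end of its row. *)
Definition shiftRow x :=
  Sq (Sweep tTmp2 (fun s => get tRS s && get tTmp s) (get (Row x)))
     (let phi s := get tTmp2 s || (get tTmp s && ~~ get tRS s) in Sweep (Row x) phi phi).
Definition clearLc x := Sweep (Lc x) (fun _ => false) (fun _ => false).

Definition gotoRow x := Goto (fun s => get (Row x) s || ~~ isCell s).

(** The value of [x] is the marked row. Shifting past the last row leaves no mark; the search for
    the row then ends on the separator, where [isCell] fails. *)
Definition Loop (x : V) (body : lp sym) : lp sym :=
  Sq (initCol x) (Sq (initRow x) (Sq (gotoRow x)
 (Sq (Wh isCell (Sq GoHome (Sq body (Sq (shiftCol x) (Sq (shiftRow x) (gotoRow x))))))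
     GoHome))).

Definition Answer (b : pred sym) : lp sym :=
  Br b (Sq GoHome (Do (put tRes true) MoveS)) (Sq GoHome (Do (put tRes false) MoveS)).

(** The head starts and ends on the first cell, where the truth value is left in [tRes]. For [ELt]
    the first marked row met decides. For [ECnt] a unary count is built in [Lc x]; it exceeds the
    threshold exactly when some cell carries a digit of the count but none of the threshold. *)
Fixpoint cE (e : expr) : lp sym :=
  match e with
  | EArr a x y => Sq (Goto (fun s => get (Row x) s && get (Col y) s)) (Answer (get (Ar a)))
  | EFlg f => Answer (get (Fg f))
  | EPos c => Answer (get (Ct c))
  | EEq x y => Sq (Goto (get (Row x))) (Answer (get (Row y)))
  | ELt x y => Sq (Goto (fun s => get (Row x) s || get (Row y) s))
                  (Answer (fun s => ~~ get (Row y) s))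
  | ENot e => Sq (cE e) (Answer (fun s => ~~ get tRes s))
  | EAnd e1 e2 => Sq (cE e1) (Br (get tRes) (cE e2) (@Nop _))
  | ECnt o x e =>
      Sq (Loop x (Sq (cE e) (Br (get tRes)
           (Sq (Goto (fun s => ~~ get (Lc x) s)) (Sq (Do (put (Lc x) true) MoveS) GoHome))
           (@Nop _))))
     (Sq (Goto (fun s => ~~ isCell s ||
                  (get (Lc x) s && ~~ (if o is Some c then get (Ct c) s else false))))
     (Sq (Answer isCell) (clearLc x)))
  end.

Fixpoint cC (c : cmd) : lp sym :=
  match c with
  | Skip => @Nop _
  | Seq c1 c2 => Sq (cC c1) (cC c2)
  | If e c1 c2 => Sq (cE e) (Br (get tRes) (cC c1) (cC c2))
  | For x c => Loop x (cC c)
  | SetA a x y e =>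
      let goto := Goto (fun s => get (Row x) s && get (Col y) s) in
      Sq (cE e) (Br (get tRes) (Sq goto (Sq (Do (put (Ar a) true) MoveS) GoHome))
                               (Sq goto (Sq (Do (put (Ar a) false) MoveS) GoHome)))
  | SetF f e => Sq (cE e) (Do (fun s => put (Fg f) (get tRes s) s) MoveS)
  | Take f =>
      Sq (Goto (fun s => (s == sTwo) || (s == sOut)))
         (Br (fun s => s == sTwo)
            (Sq (Do (fun _ => sDead) MoveS) (Sq GoHome (Do (put (Fg f) true) MoveS)))
            (Sq GoHome (Do (put (Fg f) false) MoveS)))
  | Push c =>
      Sq (Goto (fun s => ~~ get (Ct c) s)) (Sq (Do (put (Ct c) true) MoveS) GoHome)
  | Pop c =>
      Br (get (Ct c))
         (Sq (Goto (fun s => ~~ get (Ct c) s))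
             (Sq (Do id MoveL) (Sq (Do (put (Ct c) false) MoveS) GoHome)))
         (@Nop _)
  | Out s => Sq (Goto (pred1 blank)) (Sq (Do (fun _ => oraw s) MoveS) GoHome)
  end.

End Language.

(** * Simulation on the tape *)

Section Simulation.
Variables (V A F C : finType) (n off K0 : nat).
Hypothesis n_gt0 : 0 < n.
Notation store := (store A F C).
Notation trk := (trk V A F C).
Notation sym := (sym V A F C).
Notation tape := (nat -> sym).
Implicit Types (t : tape) (u w : trk) (st : store) (vw : nat -> trk -> bool).

(** Scratch and result tracks may hold anything, and flags matter in the first cell only. The marks
    of the first cell and of row starts have their own clauses in [agree]. *)
Definition strict u (p : nat) : bool :=
  match u with
  | inr _ => false
  | inl (inr (inl (inr _))) => p == 0
  | _ => true
  end.

Record agree vw t : Prop := Agree {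
  ag_cell : forall p, p < n * n -> isCell (t (off + p));
  ag_fst : forall p, p < n * n -> get (tFst V A F C) (t (off + p)) = (p == 0);
  ag_rs : forall p, p < n * n -> get (tRS V A F C) (t (off + p)) = (n %| p);
  ag_view : forall p u, p < n * n -> strict u p -> get u (t (off + p)) = vw p u;
  ag_tail : forall i, ~~ isCell (t (off + n * n + i)) }.

Definition same_tail t t' := forall i, t' (off + n * n + i) = t (off + n * n + i).

Lemma same_tail_refl t : same_tail t t. Proof. by []. Qed.

Lemma same_tail_trans t1 t2 t3 : same_tail t1 t2 -> same_tail t2 t3 -> same_tail t1 t3.
Proof. by move=> e1 e2 i; rewrite e2 e1. Qed.

Lemma nn_gt0 : 0 < n * n. Proof. by rewrite muln_gt0 n_gt0. Qed.

Lemma agree_ext vw vw' t : (forall p u, p < n * n -> strict u p -> vw p u = vw' p u) ->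
  agree vw t -> agree vw' t.
Proof. by move=> E [c f r v s]; split=> // p u lt_p st; rewrite v ?E. Qed.

Lemma get_noncell u (s : sym) : ~~ isCell s -> get u s = false.
Proof. by case: s. Qed.

Lemma agree_GoHome vw t d : agree vw t ->
  runs (@GoHome V A F C) t (off + d) (3 * d + 1) t off.
Proof.
move=> ag; apply: runs_GoBack; last by rewrite -[off]addn0 (ag_fst ag) // nn_gt0.
move=> i _; case: (ltnP i.+1 (n * n)) => lt_i; first by rewrite (ag_fst ag).
have -> : off + i.+1 = off + n * n + (i.+1 - n * n) by lia.
by rewrite get_noncell // (ag_tail ag).
Qed.

Lemma agree_put vw t p u b : agree vw t -> p < n * n ->
  u \notin [:: tFst V A F C; tRS V A F C] ->
  agree (fun q v => if (q == p) && (v == u) then b else vw q v)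
    (upd t (off + p) (put u b (t (off + p)))).
Proof.
move=> ag lt_p; rewrite !inE negb_or => /andP[/negbTE uF /negbTE uR].
have E q : upd t (off + p) (put u b (t (off + p))) (off + q) =
    if q == p then put u b (t (off + q)) else t (off + q).
  by rewrite /upd eqn_add2l; case: eqP => // ->.
have cellq q : q < n * n -> isCell (t (off + q)) := @ag_cell _ _ ag q.
split=> [q lt_q|q lt_q|q lt_q|q v lt_q sv|i]; rewrite ?E.
- by case: ifP => _; rewrite ?isCell_put cellq.
- by rewrite -(ag_fst ag lt_q); case: ifP => _ //; rewrite get_put ?cellq // eq_sym uF.
- by rewrite -(ag_rs ag lt_q); case: ifP => _ //; rewrite get_put ?cellq // eq_sym uR.
- by rewrite -(ag_view ag lt_q sv); case: ifP => _ //=; rewrite get_put ?cellq.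
- by rewrite -addnA E; case: eqP => [e|_]; [lia|rewrite addnA (ag_tail ag)].
Qed.

Lemma same_tail_upd t p s : p < n * n -> same_tail t (upd t (off + p) s).
Proof. by move=> lt_p i; rewrite /upd; case: eqP => // e; lia. Qed.

(** * Effect and cost of a single pass over the matrix *)

Section Sweep.
Variables (w : trk) (phi co : pred sym) (t : tape).

Fixpoint carry (p : nat) : bool :=
  if p is p'.+1 then co (put (tTmp V A F C) (carry p') (t (off + p'))) else false.

Definition swept p := put (tTmp V A F C) (carry p) (t (off + p)).

(** The tape when the pass stands on cell [p]: the cells before it are rewritten, and [p] has
    already received its carried bit. *)
Definition sweep_tape (p : nat) : tape := fun i =>
  if off <= i < off + p then put w (phi (swept (i - off))) (swept (i - off))
  else if i == off + p then swept p else t i.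

Lemma sweep_tapeE p : p < n * n -> sweep_tape (n * n) (off + p) = put w (phi (swept p)) (swept p).
Proof.
by move=> lt_p; rewrite /sweep_tape addKn; have -> : off <= off + p < off + n * n by lia.
Qed.

Hypothesis w_strict : w \notin [:: tFst V A F C; tRS V A F C].

Lemma sweep_tail vw : agree vw t -> same_tail t (sweep_tape (n * n)).
Proof.
move=> ag i; rewrite /sweep_tape; have -> : off <= off + n * n + i < off + n * n = false by lia.
case: eqP => // e; rewrite e.
by rewrite /swept put_raw // -[off + _]addn0 (ag_tail ag).
Qed.

Lemma sweep_agree vw : agree vw t ->
  agree (fun p u => if u == w then phi (swept p) else vw p u) (sweep_tape (n * n)).
Proof.
have [/negbTE wF /negbTE wR] : w != tFst V A F C /\ w != tRS V A F C.
  by move: w_strict; rewrite !inE negb_or => /andP[].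
move=> ag; have cellS p : p < n * n -> isCell (swept p).
  by move=> lt_p; rewrite isCell_put (ag_cell ag lt_p).
split=> [p lt_p|p lt_p|p lt_p|p u lt_p su|i]; rewrite ?sweep_tapeE //.
- by rewrite isCell_put cellS.
- by rewrite get_put ?cellS // eq_sym wF get_put ?(ag_cell ag lt_p) //= (ag_fst ag lt_p).
- by rewrite get_put ?cellS // eq_sym wR get_put ?(ag_cell ag lt_p) //= (ag_rs ag lt_p).
- rewrite get_put ?cellS //; case: ifP => // _.
  rewrite get_put ?(ag_cell ag lt_p) // (ag_view ag lt_p) //.
  by case: eqP => // eu; rewrite eu in su.
- by rewrite (sweep_tail ag) (ag_tail ag).
Qed.

Lemma sweep_run vw : agree vw t ->
  runs (Sweep w phi co) t off (10 * (n * n) + 10) (sweep_tape (n * n)) off.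
Proof.
move=> ag.
have step p : p < n * n -> forall b, b = carry p.+1 ->
  runs (Sq (Do (fun s => put w (phi s) s) MoveR) (Do (put (tTmp V A F C) b) MoveS))
    (sweep_tape p) (off + p) 2 (sweep_tape p.+1) (off + p.+1).
  move=> lt_p b eb; rewrite -[2]/(1 + 1).
  apply: runs_Sq; first by apply: runs_Do.
  rewrite /= -addnS.
  suff -> : sweep_tape p.+1 = upd (upd (sweep_tape p) (off + p)
      (put w (phi (sweep_tape p (off + p))) (sweep_tape p (off + p)))) (off + p.+1)
      (put (tTmp V A F C) b (upd (sweep_tape p) (off + p)
      (put w (phi (sweep_tape p (off + p))) (sweep_tape p (off + p))) (off + p.+1))).
    exact: runs_Do.
  apply: functional_extensionality => i; rewrite /upd /sweep_tape !eqxx.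
  rewrite !eqn_add2l; have -> : (p.+1 == p) = false by lia.
  have -> : off <= off + p < off + p = false by lia.
  have -> : off <= off + p.+1 < off + p = false by lia.
  case: (i =P off + p.+1) => [->|ne1].
    by rewrite leq_addr ltnn /= /swept eb.
  case: (i =P off + p) => [->|ne2].
    have -> : off <= off + p < off + p.+1 by lia.
    by rewrite addKn.
  by have -> : (off <= i < off + p.+1) = (off <= i < off + p) by lia.
have [|||t' [h' [R [Et Eh]]]] := @runs_Wh _ (@isCell V A F C)
  (Br co (Sq (Do (fun s => put w (phi s) s) MoveR) (Do (put (tTmp V A F C) true) MoveS))
         (Sq (Do (fun s => put w (phi s) s) MoveR) (Do (put (tTmp V A F C) false) MoveS)))
  (fun p t' h' => t' = sweep_tape p /\ h' = off + p) (n * n) 4 _ _ (sweep_tape 0) off.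
- move=> p _ _ lt_p [-> ->].
  have E : sweep_tape p (off + p) = swept p.
    by rewrite /sweep_tape eqxx; have -> : off <= off + p < off + p = false by lia.
  rewrite E isCell_put (ag_cell ag) //; split=> //.
  exists (sweep_tape p.+1), (off + p.+1); split=> //.
  apply: runs_Br; rewrite E.
  by case: ifP => ce; apply: step => //=; rewrite -/(swept p) ce.
- move=> _ _ [-> ->]; rewrite /sweep_tape eqxx.
  have -> : off <= off + n * n < off + n * n = false by lia.
  by rewrite isCell_put -[off + _]addn0 (ag_tail ag).
- by rewrite addn0.
rewrite {}Et {}Eh in R.
apply: runsW (runs_Sq _ (runs_Sq R (agree_GoHome (n * n) (sweep_agree ag)))) _.
  have -> : sweep_tape 0 = upd t off (put (tTmp V A F C) false (t off)).
    apply: functional_extensionality => i; rewrite /sweep_tape /upd addn0 /swept addn0.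
    by have -> : off <= i < off = false by lia.
  exact: runs_Do.
by lia.
Qed.

End Sweep.

Lemma get_swept vw co t p u : agree vw t -> p < n * n ->
  get u (swept co t p) = if u == tTmp V A F C then carry co t p else get u (t (off + p)).
Proof. by move=> ag lt_p; rewrite get_put // (ag_cell ag lt_p). Qed.

(** Budget digits are never erased but turned dead, so the output always begins at the same
    position. *)
Definition tail st : seq sym :=
  sThree V A F C :: nseq (K0 - kin st) (sDead V A F C) ++ nseq (kin st) (sTwo V A F C) ++
  sOut V A F C :: [seq oraw V A F C s | s <- outp st].

(* An inactive variable is one marked with the out of range value [n]. *)
Definition view (me lc : V -> nat) st (p : nat) (u : trk) : bool :=
  match u with
  | inl (inl (inl (inl x))) => p %/ n == me x
  | inl (inl (inl (inr x))) => p %% n == me x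
  | inl (inl (inr x)) => p < lc x
  | inl (inr (inl (inl a))) => arr st a (p %/ n) (p %% n)
  | inl (inr (inl (inr f))) => flg st f
  | inl (inr (inr c)) => p < cnt st c
  | inr _ => false
  end.

Record Rel (me lc : V -> nat) st t : Prop := MkRel {
  rel_ag : agree (view me lc st) t;
  rel_tail : forall i, t (off + n * n + i) = nth (blank V A F C) (tail st) i;
  rel_kin : kin st <= K0;
  rel_cnt : forall c, cnt st c <= n * n }.

Definition updm (me : V -> nat) x i : V -> nat := fun y => if y == x then i else me y.

Lemma divn_pred p : 0 < p -> ~~ (n %| p) -> p.-1 %/ n = p %/ n.
Proof. by move=> p0; rewrite -[in n %| p](prednK p0) -[in RHS](prednK p0) divnS // => /negbTE->. Qed.

Lemma modn_pred p i : 0 < p -> (p.-1 %% n == i) && ~~ (n %| p) = (p %% n == i.+1).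
Proof.
move=> p0; rewrite -{2 3}(prednK p0) modnS.
case: ifP => /= _; last by rewrite andbT eqSS.
by rewrite andbF.
Qed.

Section Marks.
Variables (me lc : V -> nat) (st : store) (x : V).

Lemma run_initCol t : Rel me lc st t ->
  exists t', [/\ runs (initCol A F C x) t off (10 * (n * n) + 10) t' off, same_tail t t'
    & agree (fun p u => if u == Col A F C x then p %% n == 0 else view me lc st p u) t'].
Proof.
case=> ag _ _ _; eexists; split; first exact: sweep_run ag.
  exact: sweep_tail ag.
apply: agree_ext (sweep_agree _ _ _ ag) => // p u lt_p _.
by case: eqP => // _; rewrite (get_swept _ _ ag lt_p) //= (ag_rs ag).
Qed.

Lemma run_initRow t :
  agree (fun p u => if u == Col A F C x then p %% n == 0 else view me lc st p u) t ->
  exists t', [/\ runs (initRow A F C x) t off (10 * (n * n) + 10) t' off, same_tail t t'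
    & agree (view (updm me x 0) lc st) t'].
Proof.
move=> ag; eexists; split; first exact: sweep_run ag.
  exact: sweep_tail ag.
set phi := fun s : sym => _.
have phiE p : p < n * n -> phi (swept phi t p) = (p == 0) || (carry phi t p && ~~ (n %| p)).
  by move=> lt_p; rewrite /phi !(get_swept _ _ ag lt_p) //= (ag_rs ag lt_p) (ag_fst ag lt_p).
have cE p : p < n * n -> phi (swept phi t p) = (p < n).
  elim: p => [|p IH] lt_p; rewrite phiE //=.
  rewrite -/(swept phi t p) IH; last exact: ltnW.
  case: (ltnP p n) => le_p /=; last by lia.
  case: (ltnP p.+1 n) => [lt_pn|ge_p]; first by rewrite gtnNdvd.
  have -> : p.+1 = n by lia.
  by rewrite dvdnn.
apply: agree_ext (sweep_agree _ _ _ ag) => // -p [[[[y|y]|y]|[[y|y]|y]]|//] lt_p _ //=;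
  rewrite /updm.
  rewrite -[_ == _]/(y == x) cE //; case: eqP => // _.
  by rewrite eqn0Ngt divn_gt0 // ltnNge.
by rewrite -[_ == Col _ _ _ _]/(y == x); case: eqP.
Qed.

Lemma run_shift i t : agree (view (updm me x i) lc st) t ->
  exists t1 t', [/\ runs (shiftCol A F C x) t off (10 * (n * n) + 10) t1 off,
    runs (shiftRow A F C x) t1 off (20 * (n * n) + 20) t' off, same_tail t t' & agree (view (updm me x i.+1) lc st) t'].
Proof.
move=> ag0; set colphi := fun s : sym => get (tTmp V A F C) s && ~~ get (tRS V A F C) s.
have R1 := @sweep_run (Col A F C x) colphi (get (Col A F C x)) t isT _ ag0.
have ag1 := @sweep_agree (Col A F C x) colphi (get (Col A F C x)) t isT _ ag0.
have st1 := @sweep_tail (Col A F C x) colphi (get (Col A F C x)) t isT _ ag0.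
have E1 p : p < n * n -> colphi (swept (get (Col A F C x)) t p) = (p %% n == i.+1).
  move=> lt_p; rewrite /colphi !(get_swept _ _ ag0 lt_p) //= (ag_rs ag0 lt_p).
  case: p lt_p => [|p] lt_p; first by rewrite mod0n dvdn0 andbF.
  rewrite -(modn_pred i (ltn0Sn p)) /= -/(swept (get (Col A F C x)) t p).
  by rewrite (get_swept _ _ ag0 (ltnW lt_p)) //= (ag_view ag0 (ltnW lt_p)) //= /updm eqxx.
set t1 := sweep_tape _ _ _ t _ in R1 ag1 st1.
set phi2 := fun s : sym => get (tRS V A F C) s && get (tTmp V A F C) s.
have R2 := @sweep_run (tTmp2 V A F C) phi2 (get (Row A F C x)) t1 isT _ ag1.
have ag2 := @sweep_agree (tTmp2 V A F C) phi2 (get (Row A F C x)) t1 isT _ ag1.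
have st2 := @sweep_tail (tTmp2 V A F C) phi2 (get (Row A F C x)) t1 isT _ ag1.
have E2 p : p < n * n -> phi2 (swept (get (Row A F C x)) t1 p) = (n %| p) && (p %/ n == i.+1).
  move=> lt_p; rewrite /phi2 !(get_swept _ _ ag1 lt_p) //= (ag_rs ag1 lt_p).
  case: p lt_p => [|p] lt_p; first by rewrite div0n andbF.
  rewrite /= -/(swept (get (Row A F C x)) t1 p).
  rewrite (get_swept _ _ ag1 (ltnW lt_p)) //= (ag_view ag1 (ltnW lt_p)) //= /updm eqxx.
  by case dv: (n %| p.+1) => //=; rewrite divnS // dv add1n eqSS.
have E2' p : p < n * n ->
    get (tTmp2 V A F C) (sweep_tape (tTmp2 V A F C) phi2 (get (Row A F C x)) t1 (n * n) (off + p))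
    = (n %| p) && (p %/ n == i.+1).
  move=> lt_p; rewrite sweep_tapeE // get_put ?eqxx ?E2 // isCell_put.
  exact: (ag_cell ag1 lt_p).
set t2 := sweep_tape _ _ _ t1 _ in R2 ag2 st2 E2'.
set phi3 := fun s : sym => get (tTmp2 V A F C) s || (get (tTmp V A F C) s && ~~ get (tRS V A F C) s).
have R3 := @sweep_run (Row A F C x) phi3 phi3 t2 isT _ ag2.
have ag3 := @sweep_agree (Row A F C x) phi3 phi3 t2 isT _ ag2.
have st3 := @sweep_tail (Row A F C x) phi3 phi3 t2 isT _ ag2.
have phi3E p : p < n * n -> phi3 (swept phi3 t2 p) =
    ((n %| p) && (p %/ n == i.+1)) || (carry phi3 t2 p && ~~ (n %| p)).
  by move=> lt_p; rewrite /phi3 !(get_swept _ _ ag2 lt_p) //= (ag_rs ag2 lt_p) E2'.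
have E3 p : p < n * n -> phi3 (swept phi3 t2 p) = (p %/ n == i.+1).
  elim: p => [|p IH] lt_p; rewrite phi3E //; first by rewrite dvdn0 div0n.
  rewrite [carry _ _ _]/= -/(swept phi3 t2 p) IH; last exact: ltnW.
  case dv: (n %| p.+1) => /=; first by rewrite andbF orbF.
  by rewrite andbT -(@divn_pred p.+1) ?dv.
exists t1, (sweep_tape (Row A F C x) phi3 phi3 t2 (n * n)); split=> //.
- by apply: runsW (runs_Sq R2 R3) _; lia.
- exact: same_tail_trans st1 (same_tail_trans st2 st3).
apply: agree_ext ag3 => // -p [[[[y|y]|y]|[[y|y]|y]]|//] lt_p _ //=; rewrite /updm.
  by rewrite -[_ == Row _ _ _ _]/(y == x) E3 //; case: eqP.
by rewrite -[_ == Col _ _ _ _]/(y == x) E1 //; case: eqP.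
Qed.

Lemma run_gotoRow i t : i <= n -> agree (view (updm me x i) lc st) t ->
  runs (gotoRow A F C x) t off (3 * (n * n) + 1) t (off + i * n).
Proof.
move=> le_i ag.
have le_in : i * n <= n * n by rewrite leq_mul2r le_i orbT.
apply: runsW (runs_Goto (d := i * n) _ _) _; last lia.
  move=> j lt_j; have lt_jn := leq_trans lt_j le_in.
  rewrite (ag_cell ag lt_jn) orbF (ag_view ag lt_jn) //= /updm eqxx.
  by rewrite neq_ltn ltn_divLR // lt_j.
case: (ltngtP i n) le_i => // [lt_i _|-> _].
  have lt_in : i * n < n * n by rewrite ltn_mul2r n_gt0.
  by rewrite (ag_view ag lt_in) //= /updm eqxx mulnK // eqxx.
by have := ag_tail ag 0; rewrite addn0 => ->; rewrite orbT.
Qed.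

End Marks.

Lemma Rel_tail me lc st t t' me' lc' : Rel me lc st t -> same_tail t t' ->
  agree (view me' lc' st) t' -> Rel me' lc' st t'.
Proof. by case=> ag tl k c st' ag'; split=> // i; rewrite st' tl. Qed.

(** The value [n] means that [x] is inactive; after [n] shifts its mark is [n] again, so the loop
    leaves no trace of [x]. Both [lc] and [st] are indexed by the iteration: counting loops change
    only the former, command loops only the latter. *)
Lemma run_Loop (me : V -> nat) (lc : nat -> V -> nat) (st : nat -> store) x body B t :
  me x = n ->
  (forall i t, i < n -> Rel (updm me x i) (lc i) (st i) t ->
    exists2 t', runs body t off B t' off & Rel (updm me x i) (lc i.+1) (st i.+1) t') ->
  Rel me (lc 0) (st 0) t ->
  exists2 t', runs (Loop x body) t off (100 * (n * n) + n * (B + 100 * (n * n))) t' off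
    & Rel me (lc n) (st n) t'.
Proof.
move=> mex bodyP R0; have nn0 := nn_gt0.
have [t1 [r1 tl1 ag1]] := run_initCol x R0.
have [t2 [r2 tl2 ag2]] := run_initRow ag1.
have R2 := Rel_tail R0 (same_tail_trans tl1 tl2) ag2.
have [|||t3 [h3 [r3 [R3 Eh]]]] := @runs_Wh _ (@isCell V A F C)
  (Sq (@GoHome V A F C) (Sq body (Sq (shiftCol A F C x) (Sq (shiftRow A F C x) (gotoRow A F C x)))))
  (fun i t h => Rel (updm me x i) (lc i) (st i) t /\ h = off + i * n)
  n (B + 36 * (n * n) + 32) _ _ t2 (off + 0 * n).
- move=> i t' _ lt_i [R ->]; have lt_in : i * n < n * n by rewrite ltn_mul2r n_gt0.
  split; first exact: (ag_cell (rel_ag R)).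
  have [t4 r4 R4] := bodyP _ _ lt_i R.
  have [t5' [t5 [r5a r5b tl5 ag5]]] := run_shift (rel_ag R4).
  exists t5, (off + i.+1 * n); split; last first.
    by split=> //; apply: Rel_tail R4 tl5 ag5.
  have rb := agree_GoHome (i * n) (rel_ag R).
  have rg := run_gotoRow lt_i ag5.
  by apply: runsW (runs_Sq rb (runs_Sq r4 (runs_Sq r5a (runs_Sq r5b rg)))) _; lia.
- by move=> t' _ [R ->]; have := ag_tail (rel_ag R) 0; rewrite addn0.
- by [].
rewrite {}Eh in r3.
have Rn : Rel me (lc n) (st n) t3.
  have ag3 := rel_ag R3; apply: (Rel_tail R3 (@same_tail_refl _)); apply: agree_ext ag3.
  move=> p [[[[y|y]|y]|[[y|y]|y]]|//] lt_p _ //=; rewrite /updm.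
    by case: (y =P x) => // ->; rewrite mex.
  by case: (y =P x) => // ->; rewrite mex.
exists t3 => //.
have rg := run_gotoRow (leq0n n) ag2; have rh := agree_GoHome (n * n) (rel_ag R3).
apply: runsW (runs_Sq r1 (runs_Sq r2 (runs_Sq rg (runs_Sq r3 rh)))) _.
have := leq_pmull n n_gt0; nia.
Qed.

End Simulation.

(** * Correctness of compiled expressions *)

Section Compile.
Variables (V A F C : finType) (n off K0 : nat).
Hypothesis n_gt0 : 0 < n.
Notation store := (store A F C).
Notation trk := (trk V A F C).
Notation sym := (sym V A F C).
Notation tape := (nat -> sym).
Notation expr := (expr V A F C).
Notation cmd := (cmd V A F C).
Notation Rel := (@Rel V A F C n off K0).
Notation tRes := (tRes V A F C).
Implicit Types (t : tape) (st : store) (e : expr) (M : nat) (me lc : V -> nat).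

Lemma Rel_put me lc st me' lc' st' t p u b :
  Rel me lc st t -> p < n * n -> u \notin [:: tFst V A F C; tRS V A F C] ->
  tail V K0 st' = tail V K0 st -> kin st' = kin st -> (forall c, cnt st' c <= n * n) ->
  (forall q v, q < n * n -> strict v q ->
     view n me' lc' st' q v = if (q == p) && (v == u) then b else view n me lc st q v) ->
  Rel me' lc' st' (upd t (off + p) (put u b (t (off + p)))).
Proof.
move=> R lt_p us tE kE cE vE; split=> //.
- apply: agree_ext (agree_put n_gt0 b (rel_ag R) lt_p us) => q v lt_q sv; by rewrite vE.
- by move=> i; rewrite same_tail_upd // tE (rel_tail R).
- by rewrite kE (rel_kin R).
Qed.

Lemma run_Answer me lc st t d b v : Rel me lc st t -> b (t (off + d)) = v ->
  exists2 t', runs (Answer b) t (off + d) (3 * d + 4) t' off &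
    Rel me lc st t' /\ get tRes (t' off) = v.
Proof.
move=> R bt; have nn := nn_gt0 n_gt0.
exists (upd t (off + 0) (put tRes v (t (off + 0)))); last first.
  split.
    apply: (Rel_put R) => // [|q u lt_q su]; first exact: (rel_cnt R).
    by rewrite andbC; case: eqP => // eu; rewrite eu in su.
  by rewrite addn0 /upd eqxx get_put ?eqxx // -[off]addn0 (ag_cell (rel_ag R)).
have rh := agree_GoHome n_gt0 d (rel_ag R).
rewrite addn0; have -> : 3 * d + 4 = (3 * d + 1 + 1).+2 by lia.
apply: runs_Br; rewrite bt; case: {bt}v; apply: runs_Sq rh _; exact: runs_Do.
Qed.

Definition bound (bnd : seq V) (env : V -> 'I_n) me lc :=
  (forall x, x \in bnd -> me x = env x) /\ (forall x, x \notin bnd -> me x = n /\ lc x = 0).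

Lemma run_gotoXY me lc st t x y (i j : 'I_n) : Rel me lc st t -> me x = i -> me y = j ->
  runs (Goto (fun s : sym => get (Row A F C x) s && get (Col A F C y) s)) t off
    (3 * (n * n) + 1) t (off + (i * n + j)).
Proof.
move=> R mx my; have lt_ij : i * n + j < n * n.
  by rewrite -ltn_divLR // divnMDl // divn_small // addn0.
apply: runsW (runs_Goto (d := i * n + j) _ _) _; last lia.
  move=> k lt_k; have lt_kn := ltn_trans lt_k lt_ij.
  rewrite !(ag_view (rel_ag R) lt_kn) //= mx my; apply/negP => /andP[/eqP ei /eqP ej].
  by move: lt_k; rewrite {1}(divn_eq k n) ei ej ltnn.
rewrite !(ag_view (rel_ag R) lt_ij) //= mx my divnMDl // modnMDl.
by rewrite divn_small // modn_small // addn0 !eqxx.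
Qed.

Lemma run_gotoRow1 me lc st t x (i : 'I_n) : Rel me lc st t -> me x = i ->
  runs (Goto (get (Row A F C x))) t off (3 * (n * n) + 1) t (off + i * n).
Proof.
move=> R mx; have lt_i : i * n < n * n by rewrite ltn_mul2r n_gt0 ltn_ord.
apply: runsW (runs_Goto (d := i * n) _ _) _; last lia.
  move=> k lt_k; rewrite !(ag_view (rel_ag R) (ltn_trans lt_k lt_i)) //= mx.
  by rewrite neq_ltn ltn_divLR // lt_k.
by rewrite !(ag_view (rel_ag R) lt_i) //= mx mulnK // eqxx.
Qed.

(* The first unset cell of a unary counter of value [k]; the sentinel if [k = n * n]. *)
Lemma run_gotoUnary me lc st t u k : Rel me lc st t -> k <= n * n ->
  (forall p, strict u p) -> (forall p, p < n * n -> view n me lc st p u = (p < k)) ->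
  runs (Goto (fun s : sym => ~~ get u s)) t off (3 * k + 1) t (off + k).
Proof.
move=> R le_k su vu; apply: runs_Goto => [i lt_i|].
  have lt_in := leq_trans lt_i le_k.
  by rewrite (ag_view (rel_ag R) lt_in) // vu // lt_i.
case: (ltnP k (n * n)) => lt_k; first by rewrite (ag_view (rel_ag R) lt_k) // vu // ltnn.
have -> : k = n * n by lia.
by rewrite get_noncell // -[off + _]addn0 (ag_tail (rel_ag R)).
Qed.

Fixpoint kE (e : expr) (M : nat) : nat :=
  match e with
  | ENot e => kE e M + 40 * M
  | EAnd e1 e2 => kE e1 M + kE e2 M + 2
  | ECnt _ _ e => 200 * M + M * (kE e M + 120 * M)
  | _ => 40 * M
  end.

Lemma thr_le me lc st t o : Rel me lc st t -> thr st o <= n * n.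
Proof. by move=> R; case: o => //= c; apply: (rel_cnt R). Qed.

Lemma cE_correct M e : n * n <= M -> forall bnd env me lc st t,
  wfE bnd e -> bound bnd env me lc -> Rel me lc st t ->
  exists2 t', runs (cE e) t off (kE e M) t' off
    & Rel me lc st t' /\ get tRes (t' off) = beval env st e.
Proof.
move=> leM; have nn := nn_gt0 n_gt0; have le_nn : n <= n * n by rewrite leq_pmulr.
elim: e => [a x y|f|c|x y|x y|e IH|e1 IH1 e2 IH2|o x e IH] bnd env me lc st t /=.
- case/andP=> bx b_y [mE _] R; have rg := run_gotoXY R (mE _ bx) (mE _ b_y).
  have lt_ij : env x * n + env y < n * n.
    by rewrite -ltn_divLR // divnMDl // divn_small // addn0.
  have [t' ra Ra] := @run_Answer _ _ _ _ (env x * n + env y) (get (Ar V F C a)) _ R erefl.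
  exists t'; first by apply: runsW (runs_Sq rg ra) _; lia.
  case: Ra => Ra ->; split=> //; rewrite (ag_view (rel_ag R) lt_ij) //=.
  by rewrite divnMDl // modnMDl divn_small // modn_small // addn0.
- move=> _ _ R; have [t' ra Ra] := @run_Answer _ _ _ _ 0 (get (Fg V A C f)) _ R erefl.
  exists t'; first by move: ra; rewrite addn0 => /runsW; apply; lia.
  by case: Ra => Ra ->; split=> //; rewrite (ag_view (rel_ag R)).
- move=> _ _ R; have [t' ra Ra] := @run_Answer _ _ _ _ 0 (get (Ct V A F c)) _ R erefl.
  exists t'; first by move: ra; rewrite addn0 => /runsW; apply; lia.
  by case: Ra => Ra ->; split=> //; rewrite (ag_view (rel_ag R)).
- case/andP=> bx b_y [mE _] R; have rg := run_gotoRow1 R (mE _ bx).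
  have lt_i : env x * n < n * n by rewrite ltn_mul2r n_gt0 ltn_ord.
  have [t' ra Ra] := @run_Answer _ _ _ _ (env x * n) (get (Row A F C y)) _ R erefl.
  exists t'; first by apply: runsW (runs_Sq rg ra) _; lia.
  by case: Ra => Ra ->; split=> //; rewrite (ag_view (rel_ag R) lt_i) //= mulnK // mE.
- case/andP=> bx b_y [mE _] R; set d := minn (env x) (env y).
  have lt_d : d < n by rewrite gtn_min ltn_ord.
  have lt_i : d * n < n * n by rewrite ltn_mul2r n_gt0.
  have rg : runs (Goto (fun s : sym => get (Row A F C x) s || get (Row A F C y) s)) t off
      (3 * (n * n) + 1) t (off + d * n).
    apply: runsW (runs_Goto (d := d * n) _ _) _; last lia.
      move=> k lt_k; have lt_kn := ltn_trans lt_k lt_i.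
      rewrite !(ag_view (rel_ag R) lt_kn) //= !mE // -ltn_divLR // in lt_k *.
      by move: lt_k; rewrite /d; lia.
    rewrite !(ag_view (rel_ag R) lt_i) //= mulnK // !mE // /d.
    by case: (leqP (env x) (env y)) => _; rewrite eqxx ?orbT.
  have [t' ra Ra] := @run_Answer _ _ _ _ (d * n) (fun s => ~~ get (Row A F C y) s) _ R erefl.
  exists t'; first by apply: runsW (runs_Sq rg ra) _; lia.
  case: Ra => Ra ->; split=> //; rewrite (ag_view (rel_ag R) lt_i) //= mulnK // mE //.
  by rewrite /d; lia.
- move=> w bd R; have [t1 r1 [R1 v1]] := IH _ _ _ _ _ _ w bd R.
  have [t' ra Ra] := @run_Answer _ _ _ _ 0 (fun s => ~~ get tRes s) _ R1 erefl.
  rewrite addn0 in ra Ra.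
  exists t'; first by apply: runsW (runs_Sq r1 ra) _; lia.
  by case: Ra => Ra ->; rewrite v1.
- case/andP=> w1 w2 bd R; have [t1 r1 [R1 v1]] := IH1 _ _ _ _ _ _ w1 bd R.
  have [t2 r2 [R2 v2]] := IH2 _ _ _ _ _ _ w2 bd R1.
  rewrite -v1 -v2; case vt: (get tRes (t1 off)).
    exists t2 => //; apply: runsW (runs_Sq r1 (runs_Br (B := kE e2 M) _)) _; last lia.
    by rewrite vt.
  exists t1; last by rewrite vt.
  apply: runsW (runs_Sq r1 (runs_Br (B := 0) _)) _; last lia.
  by rewrite vt; apply: runs_Nop.
case/andP=> xb w [mE m0] R.
have [mx lx] := m0 x xb.
pose sat (j : 'I_n) := beval (upde env x j) st e.
(* Content of the local counter of [x] before iteration [i]. *)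
pose num i := count sat (take i (enum 'I_n)).
have num_le i : num i <= n.
  by apply: leq_trans (count_size _ _) _; rewrite size_take_min size_enum_ord; lia.
have numS (i : 'I_n) : num i.+1 = num i + sat i.
  rewrite /num (take_nth i) ?size_enum_ord // -cats1 count_cat /= nth_ord_enum.
  by rewrite addn0.
pose lc' i := updm lc x (num i).
have body i t0 : i < n -> Rel (updm me x i) (lc' i) st t0 ->
  exists2 t', runs (Sq (cE e) (Br (get tRes)
           (Sq (Goto (fun s => ~~ get (Lc A F C x) s)) (Sq (Do (put (Lc A F C x) true) MoveS) (@GoHome V A F C)))
           (@Nop _))) t0 off (kE e M + 6 * (n * n) + 5) t' off
     & Rel (updm me x i) (lc' i.+1) st t'.
  move=> lt_i R0; pose i' := Ordinal lt_i.
  have bd : bound (x :: bnd) (upde env x i') (updm me x i) (lc' i).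
    split=> y; rewrite inE /upde /updm /lc' /updm ?negb_or.
      by case: eqP => // _ /mE.
    by case/andP=> /negbTE-> /m0.
  have [t1 r1 [R1 v1]] := IH _ _ _ _ _ _ w bd R0.
  rewrite -/(sat i') in v1; have lt_num : num i < n * n.
    apply: leq_trans (leq_mul n_gt0 (leqnn n)); rewrite mul1n.
    apply: leq_ltn_trans (count_size _ _) _; rewrite size_take_min size_enum_ord; lia.
  have nE := numS i'; rewrite /= -v1 in nE.
  case vt: (get tRes (t1 off)); last first.
    exists t1; last by rewrite /lc' nE vt addn0.
    apply: runsW (runs_Sq r1 (runs_Br (B := 0) _)) _; last lia.
    by rewrite vt; apply: runs_Nop.
  have ru := run_gotoUnary (u := Lc A F C x) R1 (ltnW lt_num) (fun _ => isT).
  have {}ru := ru (fun p lt_p => ltac:(by rewrite /= /lc' /updm eqxx)).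
  have R2 : Rel (updm me x i) (lc' i.+1) st
      (upd t1 (off + num i) (put (Lc A F C x) true (t1 (off + num i)))).
    apply: (Rel_put R1) => // [|q [[[[y|y]|y]|[[y|y]|y]]|//] lt_q _ /=]; rewrite ?andbF //.
      exact: (rel_cnt R1).
    rewrite -[_ == Lc _ _ _ _]/(y == x) /lc' /updm nE vt.
    case: (y =P x) => _; last by rewrite andbF.
    by rewrite andbT addn1 ltnS leq_eqVlt; case: (q == _).
  exists (upd t1 (off + num i) (put (Lc A F C x) true (t1 (off + num i)))) => //.
  apply: runsW (runs_Sq r1 (runs_Br (B := 6 * (n * n) + 3) _)) _; last lia.
  rewrite vt; apply: runsW (runs_Sq ru (runs_Sq (runs_DoS _ _ _) (agree_GoHome n_gt0 (num i) (rel_ag R2)))) _ => //.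
  lia.
have lc0 : lc' 0 = lc.
  apply: functional_extensionality => y; rewrite /lc' /updm /num take0 /=.
  by case: eqP => // ->.
have [|t1 r1 R1] := run_Loop n_gt0 (lc := lc') (st := fun _ => st) (t := t) mx body _; first by rewrite lc0.
set N := num n; have NE : N = #|[pred i | sat i]|.
  rewrite /N /num -[X in take X]size_enum_ord take_size cardE -size_filter.
  by rewrite /enum_mem -filter_predI; congr size; apply: eq_filter => i; rewrite /= andbT.
have le_N : N <= n := num_le n.
have thrL := thr_le o R.
(* The search stops at the first cell within the count but beyond the threshold, or on the separator
   at [n * n] if there is none. *)
pose d := if thr st o < N then thr st o else n * n.
have viewT p : p < n * n ->
  (if o is Some c then get (Ct V A F c) (t1 (off + p)) else false) = (p < thr st o).
  move=> lt_p; case: (o) => [c|] //=.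
  by rewrite (ag_view (rel_ag R1) lt_p).
have viewL p : p < n * n -> get (Lc A F C x) (t1 (off + p)) = (p < N).
  by move=> lt_p; rewrite (ag_view (rel_ag R1) lt_p) //= /lc' /updm eqxx.
have le_d : d <= n * n by rewrite /d; case: ifP.
have rg : runs (Goto (fun s : sym => ~~ isCell s || (get (Lc A F C x) s &&
    ~~ (if o is Some c then get (Ct V A F c) s else false)))) t1 off (3 * (n * n) + 1) t1 (off + d).
  apply: runsW (runs_Goto (d := d) _ _) _; last lia.
    move=> k lt_k; have lt_kn := leq_trans lt_k le_d.
    rewrite (ag_cell (rel_ag R1) lt_kn) viewL // viewT //=.
    by move: lt_k; rewrite /d; case: (ltnP (thr st o) N); lia.
  rewrite /d; case: (ltnP (thr st o) N) => lt_t.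
    have lt_d : thr st o < n * n by lia.
    by rewrite viewL // viewT // lt_t ltnn orbT.
  by rewrite -[off + _]addn0 (ag_tail (rel_ag R1)).
have [t2 r2 [R2 v2]] := @run_Answer _ _ _ _ d (@isCell V A F C) _ R1 erefl.
have v2E : get tRes (t2 off) = (thr st o < N).
  rewrite v2 /d; case: (ltnP (thr st o) N) => lt_t; first by rewrite (ag_cell (rel_ag R1)) //; lia.
  by apply/negbTE; rewrite -[off + _]addn0 (ag_tail (rel_ag R1)).
have r3 := @sweep_run V A F C n off n_gt0 (Lc A F C x) (fun _ => false) (fun _ => false) t2 isT _ (rel_ag R2).
have tl3 := @sweep_tail V A F C n off n_gt0 (Lc A F C x) (fun _ => false) (fun _ => false) t2 isT _ (rel_ag R2).
have ag3 := @sweep_agree V A F C n off n_gt0 (Lc A F C x) (fun _ => false) (fun _ => false) t2 isT _ (rel_ag R2).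
have resE := @sweep_tapeE V A F C n off n_gt0 (Lc A F C x) (fun _ => false) (fun _ => false) t2 0 nn.
set t3 := sweep_tape _ _ _ _ _ _ in r3 tl3 ag3 resE.
exists t3.
  apply: runsW (runs_Sq r1 (runs_Sq rg (runs_Sq r2 r3))) _.
  have : n * (kE e M + 6 * (n * n) + 5 + 100 * (n * n)) <= M * (kE e M + 120 * M).
    by apply: leq_mul; lia.
  by lia.
split; last first.
  rewrite addn0 in resE; rewrite resE -NE -v2E get_put; last first.
    by rewrite isCell_put (ag_cell (rel_ag R2)).
  by rewrite get_put ?(ag_cell (rel_ag R2)) //= addn0.
apply: (Rel_tail R2 tl3); apply: agree_ext ag3.
move=> p [[[[y|y]|y]|[[y|y]|y]]|//] lt_p _ //=.
rewrite -[_ == Lc _ _ _ _]/(y == x) /lc' /updm.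
by case: (y =P x) => // ->; rewrite lx.
Qed.


End Compile.

(** * Correctness of compiled commands *)

Section Compile.
Variables (V A F C : finType) (n off K0 : nat).
Hypothesis n_gt0 : 0 < n.
Notation store := (store A F C).
Notation trk := (trk V A F C).
Notation sym := (sym V A F C).
Notation tape := (nat -> sym).
Notation expr := (expr V A F C).
Notation cmd := (cmd V A F C).
Notation Rel := (@Rel V A F C n off K0).
Notation tRes := (tRes V A F C).
Implicit Types (t : tape) (st : store) (e : expr) (M : nat) (me lc : V -> nat).

Fixpoint kC (c : cmd) (M : nat) : nat :=
  match c with
  | Skip => 0
  | Seq c1 c2 => kC c1 M + kC c2 M
  | If e c1 c2 => kE e M + kC c1 M + kC c2 M + 2
  | For _ c => 100 * M + M * (kC c M + 100 * M)
  | SetA _ _ _ e | SetF _ e => kE e M + 40 * M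
  | _ => 40 * M
  end.

Fixpoint outs (c : cmd) : nat :=
  match c with
  | Seq c1 c2 | If _ c1 c2 => outs c1 + outs c2
  | For _ c => n * outs c
  | Out _ => 1
  | _ => 0
  end.

Lemma size_outp c (env : V -> 'I_n) st : size (outp (eval env c st)) <= size (outp st) + outs c.
Proof.
elim: c env st => [|c1 IH1 c2 IH2|e c1 IH1 c2 IH2|x c IH|a x y e|f e|f|c|c|s] env st /=;
  rewrite ?addn0 ?addn1 ?size_rcons //.
- apply: leq_trans (IH2 _ _) _; have := IH1 env st; lia.
- case: ifP => _; first by have := IH1 env st; lia.
  by have := IH2 env st; lia.
rewrite -[X in X * outs c]size_enum_ord; elim: (enum _) st => [|i s IHs] st /=.
  by rewrite addn0.
rewrite mulSn addnA; apply: leq_trans (IHs _) _.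
by rewrite leq_add2r; apply: IH.
Qed.

Definition ext st := n * n + K0 + 3 + size (outp st).

Lemma size_tail st : kin st <= K0 -> size (tail V K0 st) = K0 + 2 + size (outp st).
Proof. by move=> le_k; rewrite /= !size_cat !size_nseq /= size_map; lia. Qed.

Lemma oraw_nonblank s : oraw V A F C s != blank V A F C.
Proof.
rewrite /oraw /blank /raw -[_ == _]/(inord s.+1 == _ :> 'I_8) -val_eqE /= inordK //.
by have := ltn_ord s; lia.
Qed.

Lemma set_cnt_id st c : set_cnt st c (cnt st c) = st.
Proof.
case: st => ar fl cn k o; rewrite /set_cnt /=; congr Store.
by apply: functional_extensionality => d; case: eqP => // ->.
Qed.

(** The head walks across the output, so [M] has to cover the tape in use together with all that [c]
    may still write. *)
Lemma cC_correct c : forall bnd (env : V -> 'I_n) me lc st t M,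
  wfC bnd c -> bound bnd env me lc -> Rel me lc st t -> ext st + outs c <= M ->
  exists2 t', runs (cC c) t off (kC c M) t' off & Rel me lc (eval env c st) t'.
Proof.
have nn := nn_gt0 n_gt0; have le_nn : n <= n * n by rewrite leq_pmulr.
elim: c => [|c1 IH1 c2 IH2|e c1 IH1 c2 IH2|x c IH|a x y e|f e|f|c|c|s] bnd env me lc st t M /=.
- by move=> _ _ R _; exists t => //; apply: runs_Nop.
- case/andP=> w1 w2 bd R leM.
  have [|t1 r1 R1] := IH1 _ _ _ _ _ _ M w1 bd R; first by rewrite /ext in leM *; lia.
  have [|t2 r2 R2] := IH2 _ _ _ _ _ _ M w2 bd R1.
    by have := size_outp c1 env st; rewrite /ext in leM *; lia.
  by exists t2 => //; apply: runs_Sq r1 r2.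
- case/and3P=> we w1 w2 bd R leM.
  have [|t1 r1 [R1 v1]] := cE_correct n_gt0 (M := M) _ we bd R; first by rewrite /ext in leM; lia.
  rewrite -v1; case vt: (get tRes (t1 off)).
    have [|t2 r2 R2] := IH1 _ _ _ _ _ _ M w1 bd R1; first by rewrite /ext in leM *; lia.
    exists t2 => //; apply: runsW (runs_Sq r1 (runs_Br (B := kC c1 M) _)) _; last lia.
    by rewrite vt.
  have [|t2 r2 R2] := IH2 _ _ _ _ _ _ M w2 bd R1; first by rewrite /ext in leM *; lia.
  exists t2 => //; apply: runsW (runs_Sq r1 (runs_Br (B := kC c2 M) _)) _; last lia.
  by rewrite vt.
- case/andP=> xb w [mE m0] R leM; have [mx _] := m0 x xb.
  pose stI i := foldl (fun s i => eval (upde env x i) c s) st (take i (enum 'I_n)).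
  have outI i : i <= n -> size (outp (stI i)) <= size (outp st) + i * outs c.
    elim: i => [|i IHi] lt_i; first by rewrite /stI take0 leq_addr.
    rewrite /stI (take_nth (Ordinal lt_i)) ?size_enum_ord // -cats1 foldl_cat /=.
    apply: leq_trans (size_outp _ _ _) _; rewrite mulSn addnCA addnC leq_add2l.
    exact: IHi (ltnW lt_i).
  have body i t0 : i < n -> Rel (updm me x i) lc (stI i) t0 ->
      exists2 t', runs (cC c) t0 off (kC c M) t' off & Rel (updm me x i) lc (stI i.+1) t'.
    move=> lt_i R0; pose i' := Ordinal lt_i.
    have -> : stI i.+1 = eval (upde env x i') c (stI i).
      rewrite /stI (take_nth i') ?size_enum_ord // -cats1 foldl_cat /=.
      by rewrite -[X in nth _ _ X]/(nat_of_ord i') nth_ord_enum.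
    apply: (IH (x :: bnd) (upde env x i')) => //.
      split=> y; rewrite inE /upde /updm ?negb_or.
        by case: eqP => // _ /mE.
      by case/andP=> /negbTE-> /m0.
    have : i.+1 * outs c <= n * outs c by rewrite leq_mul2r lt_i orbT.
    by rewrite mulSn; have := outI i (ltnW lt_i); rewrite /ext in leM *; lia.
  have [|t1 r1 R1] := run_Loop n_gt0 (lc := fun _ => lc) (st := stI) (t := t) mx body _; first by rewrite /stI take0.
  exists t1; last by rewrite /stI -[X in take X]size_enum_ord take_size in R1.
  apply: runsW r1 _; apply: leq_add; first by rewrite /ext in leM; lia.
  by apply: leq_mul; rewrite /ext in leM; lia.
- case/and3P=> bx b_y w bd R leM.
  have [|t1 r1 [R1 v1]] := cE_correct n_gt0 (M := M) _ w bd R; first by rewrite /ext in leM; lia.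
  case: (bd) => [mE _]; have rg := run_gotoXY n_gt0 R1 (mE _ bx) (mE _ b_y).
  have lt_ij : env x * n + env y < n * n.
    by rewrite -ltn_divLR // divnMDl // divn_small // addn0.
  set p := env x * n + env y in rg lt_ij.
  set b := beval env st e in v1 *.
  have R2 : Rel me lc (set_arr st a (fun i j => if (i == env x) && (j == env y) then b else arr st a i j))
      (upd t1 (off + p) (put (Ar V F C a) b (t1 (off + p)))).
    apply: (Rel_put n_gt0 R1) => // [|q [[[[z|z]|z]|[[z|z]|z]]|//] lt_q _ /=]; rewrite ?andbF //.
      exact: (rel_cnt R1).
    rewrite -[_ == Ar _ _ _ _]/(z == a); case: (z =P a) => [->|_]; last by rewrite andbF.
    rewrite andbT; congr (if _ then _ else _).
    apply/andP/eqP => [[/eqP eq1 /eqP eq2]|->].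
      by rewrite /p -eq1 -eq2 -divn_eq.
    by rewrite /p divnMDl // modnMDl divn_small // modn_small // addn0 !eqxx.
  exists (upd t1 (off + p) (put (Ar V F C a) b (t1 (off + p)))) => //.
  have rh := agree_GoHome n_gt0 p (rel_ag R2).
  apply: runsW (runs_Sq r1 (runs_Br (B := 6 * (n * n) + 3) _)) _; last by rewrite /ext in leM; lia.
  rewrite v1; move: rh; case: (b) => rh;
  by apply: runsW (runs_Sq rg (runs_Sq (runs_DoS _ _ _) rh)) _ => //; lia.
- move=> w bd R leM.
  have [|t1 r1 [R1 v1]] := cE_correct n_gt0 (M := M) _ w bd R; first by rewrite /ext in leM; lia.
  exists (upd t1 (off + 0) (put (Fg V A C f) (get tRes (t1 off)) (t1 (off + 0)))).
    rewrite addn0; apply: runsW (runs_Sq r1 (runs_DoS (fun s => put (Fg V A C f) (get tRes s) s) _ _)) _.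
    by rewrite /ext in leM; lia.
  rewrite -v1.
  apply: (Rel_put n_gt0 R1) => // [|q [[[[z|z]|z]|[[z|z]|z]]|//] lt_q sq /=]; rewrite ?andbF //.
    exact: (rel_cnt R1).
  by rewrite -[_ == Fg _ _ _ _]/(z == f); have /= -> := sq.
- move=> _ bd R leM; set dead := K0 - kin st.
  have tlE := rel_tail R; have le_kin := rel_kin R.
  have nc i := ag_tail (rel_ag R) i.
  set d := n * n + dead.+1.
  have tlD : t (off + d) = if 0 < kin st then sTwo V A F C else sOut V A F C.
    rewrite /d addnA tlE /= nth_cat size_nseq -/dead ltnn subnn.
    by case: (kin st).
  have rg : runs (Goto (fun s : sym => (s == sTwo V A F C) || (s == sOut V A F C))) t off
      (3 * d + 1) t (off + d).
    apply: runs_Goto => [i lt_i|]; last by rewrite tlD; case: ifP; rewrite eqxx ?orbT.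
    case: (ltnP i (n * n)) => lt_in; first by case: (t (off + i)) (ag_cell (rel_ag R) lt_in).
    have -> : off + i = off + n * n + (i - n * n) by lia.
    rewrite tlE /=; case ej: (i - n * n) => [|j] //=.
    have lt_j : j < dead by rewrite /d in lt_i; lia.
    by rewrite nth_cat size_nseq lt_j nth_nseq lt_j.
  have le_d : 3 * d + 5 <= 5 * M by rewrite /ext in leM; rewrite /d /dead; lia.
  have sub st' t' : Rel me lc st' t' -> kin st' = (kin st).-1 -> arr st' = arr st ->
      cnt st' = cnt st -> outp st' = outp st -> flg st' = flg st -> forall b,
      Rel me lc (let s := set_flg st f b in Store (arr s) (flg s) (cnt s) (kin st).-1 (outp s))
        (upd t' (off + 0) (put (Fg V A C f) b (t' (off + 0)))).
    move=> R' kE aE cE oE fE b.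
    apply: (Rel_put n_gt0 R') => // [|c|q [[[[z|z]|z]|[[z|z]|z]]|//] lt_q sq /=]; rewrite ?andbF //.
    - by rewrite /tail /= kE oE.
    - exact: (rel_cnt R).
    - by rewrite aE.
    - by rewrite -[_ == Fg _ _ _ _]/(z == f) fE; have /= -> := sq.
    - by rewrite cE.
  case: (posnP (kin st)) => [k0|k_gt0].
    exists (upd t (off + 0) (put (Fg V A C f) false (t (off + 0)))); last first.
      by apply: (sub st t R _ erefl erefl erefl erefl false); rewrite k0.
    rewrite addn0; apply: runsW (runs_Sq rg (runs_Br (B := 3 * d + 2) _)) _; last lia.
    rewrite tlD k0 /=.
    apply: runsW (runs_Sq (agree_GoHome n_gt0 d (rel_ag R)) (runs_DoS _ _ _)) _; lia.
  set st1 := Store (arr st) (flg st) (cnt st) (kin st).-1 (outp st).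
  have same i : i < n * n -> upd t (off + d) (sDead V A F C) (off + i) = t (off + i).
    by move=> lt_i; rewrite /upd eqn_add2l; case: eqP => // e; rewrite /d in e; lia.
  have tl1 i : upd t (off + d) (sDead V A F C) (off + n * n + i) = nth (blank V A F C) (tail V K0 st1) i.
    rewrite /upd /d -[off + n * n + i]addnA eqn_add2l eqn_add2l addnA.
    have eD : K0 - (kin st).-1 = dead.+1 by rewrite /dead; lia.
    have -> : tail V K0 st1 = sThree V A F C :: nseq dead (sDead V A F C) ++
       sDead V A F C :: nseq (kin st).-1 (sTwo V A F C) ++
      sOut V A F C :: [seq oraw V A F C s | s <- outp st].
      rewrite /tail /= eD; congr (_ :: _).
      by rewrite -[dead.+1]addn1 nseqD -catA.
    case: eqP => [->|ne] /=; first by rewrite nth_cat size_nseq ltnn subnn.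
    rewrite tlE /tail -/dead; case: i ne => //= i ne; rewrite [in LHS]nth_cat [in RHS]nth_cat !size_nseq.
    case: ltnP => // ge_i; have -> : i - dead = (i - dead).-1.+1 by lia.
    by rewrite -[in LHS](prednK k_gt0).
  have R1 : Rel me lc st1 (upd t (off + d) (sDead V A F C)).
    split=> //; rewrite /st1 /=; last exact: (rel_cnt R); last lia.
    have [ac af ar av ax] := rel_ag R.
    split=> [p lt_p|p lt_p|p lt_p|p u lt_p su|i]; rewrite ?same //.
    - exact: ac.
    - exact: af.
    - exact: ar.
    - exact: (av _ _ lt_p su).
    - by rewrite /upd; case: ifP => // _; apply: ax.
  exists (upd (upd t (off + d) (sDead V A F C)) (off + 0)
    (put (Fg V A C f) true (upd t (off + d) (sDead V A F C) (off + 0)))); last first.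
    by apply: (sub st1 _ _ erefl erefl erefl erefl erefl true).
  rewrite addn0; apply: runsW (runs_Sq rg (runs_Br (B := 3 * d + 3) _)) _; last lia.
  rewrite tlD k_gt0 eqxx.
  apply: runsW (runs_Sq (runs_DoS _ _ _) (runs_Sq (agree_GoHome n_gt0 d (rel_ag R1)) (runs_DoS _ _ _))) _; lia.
- move=> _ bd R leM; have le_c := rel_cnt R c.
  have ru := run_gotoUnary n_gt0 (u := Ct V A F c) R le_c (fun _ => isT) (fun p _ => erefl).
  (* With a full counter the search stops on the separator, where [put] does nothing, in agreement
     with the saturation of [Push]. *)
  case: (ltnP (cnt st c) (n * n)) => lt_c; last first.
    have E : cnt st c = n * n by lia.
    exists t; last by rewrite (_ : minn (n * n) (cnt st c).+1 = cnt st c) ?set_cnt_id //; lia.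
    have rd : runs (Do (put (Ct V A F c) true) MoveS) t (off + cnt st c) 1 t (off + cnt st c).
      rewrite -{2}[t](upd_id _ (off + cnt st c)).
      rewrite -[X in upd _ _ X](put_raw (Ct V A F c) true); first exact: runs_Do.
      by rewrite E -[off + _]addn0 (ag_tail (rel_ag R)).
    apply: runsW (runs_Sq ru (runs_Sq rd (agree_GoHome n_gt0 _ (rel_ag R)))) _.
    by rewrite /ext in leM; lia.
  have cE : minn (n * n) (cnt st c).+1 = (cnt st c).+1 by lia.
  have R2 : Rel me lc (set_cnt st c (minn (n * n) (cnt st c).+1))
      (upd t (off + cnt st c) (put (Ct V A F c) true (t (off + cnt st c)))).
    apply: (Rel_put n_gt0 R) => // [d|q [[[[z|z]|z]|[[z|z]|z]]|//] lt_q sq /=]; rewrite ?andbF //.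
      by rewrite /=; case: ifP => _; [lia|apply: (rel_cnt R)].
    rewrite -[_ == Ct _ _ _ _]/(z == c) cE; case: (z =P c) => [->|_]; last by rewrite andbF.
    by rewrite andbT ltnS [in LHS]leq_eqVlt; case: eqP.
  exists (upd t (off + cnt st c) (put (Ct V A F c) true (t (off + cnt st c)))) => //.
  apply: runsW (runs_Sq ru (runs_Sq (runs_DoS _ _ _) (agree_GoHome n_gt0 _ (rel_ag R2)))) _ => //.
  by rewrite /ext in leM; lia.
- move=> _ bd R leM; have le_c := rel_cnt R c.
  have tc : get (Ct V A F c) (t off) = (0 < cnt st c).
    by rewrite -[off]addn0 (ag_view (rel_ag R)).
  case: (posnP (cnt st c)) => [c0|c_gt0].
    exists t; last by rewrite (_ : (cnt st c).-1 = cnt st c) ?set_cnt_id // c0.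
    apply: (@runsW _ _ _ _ 2); last by rewrite /ext in leM; lia.
    by apply: runs_Br; rewrite tc c0; apply: runs_Nop.
  have ru := run_gotoUnary n_gt0 (u := Ct V A F c) R le_c (fun _ => isT) (fun p _ => erefl).
  have lt_c : (cnt st c).-1 < n * n by lia.
  have R2 : Rel me lc (set_cnt st c (cnt st c).-1)
      (upd t (off + (cnt st c).-1) (put (Ct V A F c) false (t (off + (cnt st c).-1)))).
    apply: (Rel_put n_gt0 R) => // [d|q [[[[z|z]|z]|[[z|z]|z]]|//] lt_q sq /=]; rewrite ?andbF //.
      by rewrite /=; case: ifP => _; [lia|apply: (rel_cnt R)].
    rewrite -[_ == Ct _ _ _ _]/(z == c); case: (z =P c) => [->|_]; last by rewrite andbF.
    by rewrite andbT; case: eqP; lia.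
  exists (upd t (off + (cnt st c).-1) (put (Ct V A F c) false (t (off + (cnt st c).-1)))) => //.
  have hE : mv MoveL (off + cnt st c) = off + (cnt st c).-1 by rewrite /=; lia.
  have rl : runs (Do id MoveL) t (off + cnt st c) 1 t (off + (cnt st c).-1).
    by rewrite -hE -{2}[t](upd_id _ (off + cnt st c)); apply: runs_Do; rewrite /=; lia.
  apply: (@runsW _ _ _ _ (6 * (n * n) + 4).+2); last by rewrite /ext in leM; lia.
  apply: runs_Br; rewrite tc c_gt0.
  apply: runsW (runs_Sq ru (runs_Sq rl (runs_Sq (runs_DoS _ _ _) (agree_GoHome n_gt0 _ (rel_ag R2))))) _ => //.
  lia.
move=> _ bd R leM; have tlE := rel_tail R.
set d := n * n + size (tail V K0 st).
have sT := size_tail (rel_kin R).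
have nE i : off + i = off + n * n + (i - n * n) \/ i < n * n by lia.
have rg : runs (Goto (pred1 (blank V A F C))) t off (3 * d + 1) t (off + d).
  apply: runs_Goto => [i lt_i|]; last by rewrite /= /d addnA tlE nth_default.
  case: (ltnP i (n * n)) => lt_in; first by case: (t (off + i)) (ag_cell (rel_ag R) lt_in).
  have -> : off + i = off + n * n + (i - n * n) by lia.
  have lt_j : i - n * n < size (tail V K0 st) by rewrite /d in lt_i; lia.
  rewrite tlE /=; have := mem_nth (blank V A F C) lt_j.
  rewrite /tail inE mem_cat mem_nseq mem_cat mem_nseq inE.
  case/or4P=> [/eqP->|/andP[_ /eqP->]|/andP[_ /eqP->]|/orP[/eqP->|]] //.
  by case/mapP=> s' _ ->; apply: oraw_nonblank.
set st1 := Store _ _ _ _ _.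
have tl1 i : upd t (off + d) (oraw V A F C s) (off + n * n + i) = nth (blank V A F C) (tail V K0 st1) i.
  have -> : tail V K0 st1 = rcons (tail V K0 st) (oraw V A F C s).
    by rewrite /tail /= map_rcons -!cats1 /= -!catA /=.
  rewrite /upd /d addnA eqn_add2l tlE nth_rcons.
  by case: ltngtP => // ge_i; rewrite nth_default // ltnW.
have same i : i < n * n -> upd t (off + d) (oraw V A F C s) (off + i) = t (off + i).
  by move=> lt_i; rewrite /upd eqn_add2l; case: eqP => // e; rewrite /d in e; lia.
have R1 : Rel me lc st1 (upd t (off + d) (oraw V A F C s)).
  split=> //; rewrite /st1 /=; last exact: (rel_cnt R); last exact: (rel_kin R).
  have [ac af ar av ax] := rel_ag R.
  split=> [p lt_p|p lt_p|p lt_p|p u lt_p su|i]; rewrite ?same //.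
  - exact: ac.
  - exact: af.
  - exact: ar.
  - exact: (av _ _ lt_p su).
  - by rewrite /upd; case: ifP => // _; apply: ax.
exists (upd t (off + d) (oraw V A F C s)) => //.
apply: runsW (runs_Sq rg (runs_Sq (runs_DoS _ _ _) (agree_GoHome n_gt0 _ (rel_ag R1)))) _ => //.
by rewrite /ext in leM; rewrite /d sT; lia.
Qed.

End Compile.

(** * Reading the input and time bound *)

(** Restricting to positive arguments makes powers monotone in the exponent, which sums of bounds
    need. *)
Definition poly_bounded (f : nat -> nat) := exists a d, forall m, 0 < m -> f m <= a * m ^ d.

Lemma poly_const c : poly_bounded (fun _ => c).
Proof. by exists c, 0 => m _; rewrite expn0 muln1. Qed.

Lemma poly_id : poly_bounded id.
Proof. by exists 1, 1 => m _; rewrite expn1 mul1n. Qed.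

Lemma poly_add f g : poly_bounded f -> poly_bounded g -> poly_bounded (fun m => f m + g m).
Proof.
case=> a [d Hf] [b [e Hg]]; exists (a + b), (d + e) => m m0.
rewrite mulnDl; apply: leq_add; [apply: leq_trans (Hf m m0) _|apply: leq_trans (Hg m m0) _];
  by rewrite leq_mul2l leq_pexp2l ?orbT // ?leq_addl ?leq_addr.
Qed.

Lemma poly_mul f g : poly_bounded f -> poly_bounded g -> poly_bounded (fun m => f m * g m).
Proof.
case=> a [d Hf] [b [e Hg]]; exists (a * b), (d + e) => m m0.
by rewrite expnD mulnACA; apply: leq_mul; auto.
Qed.

Lemma poly_comp f g : poly_bounded f -> poly_bounded g -> (forall m, 0 < m -> 0 < g m) ->
  poly_bounded (fun m => f (g m)).
Proof.
case=> a [d Hf] [b [e Hg]] g0; exists (a * b ^ d), (e * d) => m m0.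
apply: leq_trans (Hf _ (g0 m m0)) _; rewrite -mulnA leq_mul2l expnM -expnMn.
by apply/orP; right; case: (d) => // d'; rewrite leq_exp2r //; apply: Hg.
Qed.

Section Costs.
Variables (V A F C : finType).

Lemma poly_scale c f : poly_bounded f -> poly_bounded (fun m => c * f m).
Proof. exact: (poly_mul (poly_const c)). Qed.

Lemma kE_poly (e : expr V A F C) : poly_bounded (kE e).
Proof.
have lin c : poly_bounded (fun M => c * M) := poly_scale c poly_id.
elim: e => *; rewrite /kE -/kE; rewrite -?/kE;
  do ?[exact: lin | assumption | exact: poly_const | exact: poly_id | apply: poly_add | apply: poly_mul].
Qed.

Lemma kC_poly (c : cmd V A F C) : poly_bounded (kC c).
Proof.
have lin b : poly_bounded (fun M => b * M) := poly_scale b poly_id.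
elim: c => *; rewrite /kC -/kC;
  do ?[exact: lin | exact: kE_poly | assumption | exact: poly_const | exact: poly_id | apply: poly_add | apply: poly_mul].
Qed.

Lemma outs_poly (c : cmd V A F C) : poly_bounded (fun n => outs n c).
Proof.
elim: c => *; rewrite /outs -/outs;
  do ?[assumption | exact: poly_const | exact: poly_id | apply: poly_add | apply: poly_mul].
Qed.

End Costs.

Section Machine.
Variables (V A F C : finType) (aE : A).
Notation sym := (sym V A F C).
Notation lp := (lp sym).

Definition enc (s : sym) : nat :=
  match s with inl i => val i | inr c => 8 + enum_rank (c : cell V A F C) end.

Definition dec (a : nat) : sym := odflt (blank V A F C) [pick s | enc s == a].

Lemma enc_inj : injective enc.
Proof.
case=> [i|c] [j|d] /=.
- by move/val_inj->.
- by move=> E; have := ltn_ord i; rewrite E; lia.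
- by move=> E; have := ltn_ord j; rewrite -E; lia.
- by move/addnI/val_inj/enum_rank_inj->.
Qed.

Lemma encK : cancel enc dec.
Proof.
move=> s; rewrite /dec; case: pickP => [s' /eqP/enc_inj //|/(_ s)].
by rewrite eqxx.
Qed.

Lemma enc_lt s : enc s < 8 + #|cell V A F C|.
Proof. by case: s => [i|c] /=; [have := ltn_ord i; lia|rewrite ltn_add2l ltn_ord]. Qed.

Definition sF0 : sym := raw V A F C (@Ordinal 8 4 isT).
Definition sF1 : sym := raw V A F C (@Ordinal 8 5 isT).
Notation One := (sOne V A F C).
Notation Two := (sTwo V A F C).
Notation Three := (sThree V A F C).
Notation Dead := (sDead V A F C).
Notation SOut := (sOut V A F C).
Notation Blank := (blank V A F C).

Definition newCell (rs : bool) (s : sym) : sym :=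
  inr [ffun u => if u == tRS V A F C then rs else (u == Ar V F C aE) && (s == Two)].

Definition Convert (rs : bool) : lp :=
  Sq (Goto (pred1 Three)) (Sq (Do id MoveR) (Sq (Goto (fun s => ~~ isCell s)) (Do (newCell rs) MoveR))).

Definition isF (s : sym) := (s == sF0) || (s == sF1).

(* The unary prefix serves as a ring of length [n] to recognize the first
   column: its symbols are crossed out in step with the conversion of the
   matrix, and restored when exhausted. *)
Definition initStep : lp :=
  Sq (GoBack isF)
 (Sq (Goto (fun s => (s == sF0) || (s == Two) || (s == Three)))
 (Sq (Br (pred1 Three)
        (Sq (Do id MoveL) (Sq (Wh (pred1 Dead) (Do (fun _ => Two) MoveL)) (Do (fun _ => sF0) MoveS)))
        (@Nop _))
     (Br (pred1 sF0) (Sq (Do (fun _ => sF1) MoveS) (Convert true))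
                     (Sq (Do (fun _ => Dead) MoveS) (Convert false))))).

Definition initP : lp :=
  Sq (Do (fun _ => sF0) MoveS)
 (Sq (Goto (pred1 Three))
 (Sq (Do id MoveR)
 (Sq (Wh (fun s => (s == One) || (s == Two)) initStep)
 (Sq (Goto (pred1 Blank))
 (Sq (Do (fun _ => SOut) MoveS)
 (Sq (GoBack isF)
 (Sq (Goto (pred1 Three))
 (Sq (Do id MoveR) (Do (put (tFst V A F C) true) MoveS))))))))).

Definition finP : lp := Sq (Goto (pred1 SOut)) (Do id MoveR).

(** A leading separator means that there are no vertices; the machine then halts at once and the
    input is its own output. *)
Definition fullP (c : cmd V A F C) : lp :=
  Br (pred1 Three) (@Nop _) (Sq initP (Sq (cC c) finP)).

Section Init.
Variables (n k : nat) (bit : nat -> bool) (t0 : nat -> sym).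
Hypothesis n_gt0 : 0 < n.
Let off := n.+1.
Hypothesis t0_prefix : forall i, i < n -> t0 i = Two.
Hypothesis t0_sep : t0 n = Three.
Hypothesis t0_mat : forall p, p < n * n -> t0 (off + p) = if bit p then Two else One.
Hypothesis t0_sep2 : t0 (off + n * n) = Three.
Hypothesis t0_k : forall i, t0 (off + n * n + i.+1) = if i < k then Two else Blank.

(** The prefix with its first [v] symbols crossed out. Position 0 shows [sF0] or [sF1] for the two
    cases, since it must also mark the left end of the tape. *)
Definition ring v i : sym :=
  if i == 0 then (if 0 < v then sF1 else sF0) else if i < v then Dead else Two.

Definition partial v q : nat -> sym := fun i =>
  if i < n then ring v i
  else if off <= i < off + q then newCell (n %| i - off) (t0 i) else t0 i.

Lemma partial_prefix v q i : i < n -> partial v q i = ring v i.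
Proof. by rewrite /partial => ->. Qed.

Lemma partial_sep v q : partial v q n = Three.
Proof. by rewrite /partial /off ltnn. Qed.

Lemma partial_cell v q p : p < q -> partial v q (off + p) = newCell (n %| p) (t0 (off + p)).
Proof.
move=> lt_p; rewrite /partial addKn; have -> : (off + p < n) = false by rewrite /off; lia.
by have -> : off <= off + p < off + q by lia.
Qed.

Lemma partial_raw v q p : q <= p -> partial v q (off + p) = t0 (off + p).
Proof.
move=> le_p; rewrite /partial; have -> : (off + p < n) = false by rewrite /off; lia.
by have -> : (off <= off + p < off + q) = false by lia.
Qed.

Lemma isF_ring v i : isF (ring v i) = (i == 0).
Proof. by rewrite /ring; case: eqP => _; case: ifP. Qed.

Lemma partial_notF v q i : q <= n * n -> 0 < i <= off + n * n + k -> ~~ isF (partial v q i).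
Proof.
move=> le_q /andP[i_gt0 le_i]; case: (ltngtP i n) => lt_in.
- by rewrite partial_prefix // isF_ring; lia.
- have -> : i = off + (i - off) by rewrite /off; lia.
  case: (ltnP (i - off) q) => lt_i; first by rewrite partial_cell.
  rewrite partial_raw //; case: (ltngtP (i - off) (n * n)) => lt_nn.
  + by rewrite t0_mat //; case: ifP.
  + have -> : off + (i - off) = off + n * n + (i - off - n * n).-1.+1 by lia.
    by rewrite t0_k; case: ifP.
  + by rewrite lt_nn t0_sep2.
- by rewrite lt_in partial_sep.
Qed.

Lemma run_toStart v q d : q <= n * n -> d <= off + n * n + k ->
  runs (GoBack isF) (partial v q) d (3 * d + 1) (partial v q) 0.
Proof.
move=> le_q le_d; have := @runs_GoBack _ isF (partial v q) 0 d.
rewrite !add0n; apply; last by rewrite partial_prefix // isF_ring.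
by move=> i lt_i; rewrite add0n partial_notF //; lia.
Qed.

Lemma run_Convert v q b : v <= n -> q < n * n -> b = (n %| q) -> forall i, i < n ->
  runs (Convert b) (partial v q) i (3 * off + 3 * q + 10) (partial v q.+1) (off + q.+1).
Proof.
move=> le_v lt_q eb i lt_i.
have r1 : runs (Goto (pred1 Three)) (partial v q) i (3 * (n - i) + 1) (partial v q) n.
  have := @runs_Goto _ (pred1 Three) (partial v q) i (n - i); rewrite subnKC; last exact: ltnW.
  apply; last by rewrite /= partial_sep.
  move=> j lt_j; rewrite partial_prefix; last lia.
  by rewrite /ring; case: ifP => _; case: ifP.
have r2 : runs (Do id MoveR) (partial v q) n 1 (partial v q) off.
  by rewrite -[X in runs _ _ _ _ X](upd_id _ n); apply: runs_Do.
have r3 : runs (Goto (fun s => ~~ isCell s)) (partial v q) off (3 * q + 1) (partial v q) (off + q).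
  apply: runs_Goto => [j lt_j|]; first by rewrite partial_cell.
  by rewrite partial_raw // t0_mat //; case: ifP.
have r4 : runs (Do (newCell b) MoveR) (partial v q) (off + q) 1 (partial v q.+1) (off + q.+1).
  rewrite addnS.
  suff -> : partial v q.+1 = upd (partial v q) (off + q) (newCell b (partial v q (off + q))).
    exact: (@runs_Do _ _ MoveR).
  apply: functional_extensionality => j; rewrite /upd; case: eqP => [->|ne].
    by rewrite partial_cell // partial_raw // eb.
  rewrite /partial; case: ifP => // ge_n.
  by have -> : (off <= j < off + q.+1) = (off <= j < off + q) by lia.
by apply: runsW (runs_Sq r1 (runs_Sq r2 (runs_Sq r3 r4))) _; rewrite /off; lia.
Qed.

(** The prefix while it is being restored from right to left, with the last [j] symbols done;
    position 0 comes last. *)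
Definition reset j q : nat -> sym := fun i =>
  if i < n then (if i == 0 then sF1 else if i < n - j then Dead else Two) else partial n q i.

Lemma run_reset q : runs
    (Sq (Do id MoveL) (Sq (Wh (pred1 Dead) (Do (fun _ => Two) MoveL)) (Do (fun _ => sF0) MoveS)))
    (partial n q) n (3 * n + 4) (partial 0 q) 0.
Proof.
have r1 : runs (Do id MoveL) (partial n q) n 1 (partial n q) n.-1.
  by rewrite -[X in runs _ _ _ _ X](upd_id _ n); apply: runs_Do.
have E0 : partial n q = reset 0 q.
  apply: functional_extensionality => i; rewrite /reset /partial; case: ifP => // lt_i.
  by rewrite /ring n_gt0 subn0.
have [|||t' [h' [r2 [Et Eh]]]] := @runs_Wh _ (pred1 Dead) (Do (fun _ => Two) MoveL)
   (fun j t h => t = reset j q /\ h = n.-1 - j) n.-1 1 _ _ (partial n q) n.-1.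
- move=> j _ _ lt_j [-> ->]; rewrite /= {1}/reset.
  have -> : n.-1 - j < n by lia.
  have -> : (n.-1 - j == 0) = false by lia.
  have -> : n.-1 - j < n - j by lia.
  split=> //; exists (reset j.+1 q), (n.-1 - j.+1); split=> //.
  have -> : n.-1 - j.+1 = mv MoveL (n.-1 - j) by rewrite /=; lia.
  suff -> : reset j.+1 q = upd (reset j q) (n.-1 - j) Two by apply: runs_Do; rewrite /=; lia.
  apply: functional_extensionality => i; rewrite /upd /reset; case: (i =P n.-1 - j) => [->|ne].
    have -> : n.-1 - j < n by lia.
    have -> : (n.-1 - j == 0) = false by lia.
    by have -> : (n.-1 - j < n - j.+1) = false by lia.
  case: ifP => // lt_i; case: eqP => // i0.
  by have -> : (i < n - j.+1) = (i < n - j) by lia.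
- by move=> _ _ [-> ->]; rewrite subnn /= /reset n_gt0.
- by rewrite subn0.
have {}Eh : h' = 0 by lia.
rewrite Et Eh in r2.
have r3 : runs (Do (fun _ => sF0) MoveS) (reset n.-1 q) 0 1 (partial 0 q) 0.
  suff -> : partial 0 q = upd (reset n.-1 q) 0 sF0 by apply: (@runs_DoS _ (fun _ => sF0)).
  apply: functional_extensionality => i; rewrite /upd /partial /reset /ring.
  case: eqP => [->|/eqP/negbTE i0]; first by rewrite n_gt0.
  case: ifP => lt_i; last by rewrite /partial lt_i.
  by have -> : (i < n - n.-1) = false by lia.
by apply: runsW (runs_Sq r1 (runs_Sq r2 r3)) _; lia.
Qed.

(* Number of crossed out prefix symbols after the conversion of [q] cells. *)
Definition vis q := if q is q'.+1 then (q' %% n).+1 else 0.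

Lemma run_visit q v : v < n -> q < n * n -> v = q %% n -> 
  runs (Br (pred1 sF0) (Sq (Do (fun _ => sF1) MoveS) (Convert true))
                     (Sq (Do (fun _ => Dead) MoveS) (Convert false)))
    (partial v q) v (3 * off + 3 * q + 13) (partial v.+1 q.+1) (off + q.+1).
Proof.
move=> lt_v lt_q ev.
have upE s : s = (if v == 0 then sF1 else Dead) -> upd (partial v q) v s = partial v.+1 q.
  move=> ->; apply: functional_extensionality => i; rewrite /upd; case: eqP => [->|ne].
    rewrite partial_prefix // /ring; case: eqP => //.
    by rewrite ltnSn.
  rewrite /partial; case: ifP => // lt_i; rewrite /ring; case: eqP => [i0|_].
    by have -> : 0 < v by lia.
  by have -> : (i < v.+1) = (i < v) by lia.
have ringv : (ring v v == sF0) = (v == 0).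
  by rewrite /ring ltnn; case: (v =P 0) => // ->.
apply: (@runsW _ _ _ _ (1 + (3 * off + 3 * q + 10)).+2); last lia.
apply: runs_Br; rewrite [pred1 _ _]/= partial_prefix // ringv.
case: eqP => v0; apply: (@runs_Sq _ _ _ _ _ 1 (partial v.+1 q) v).
- by rewrite -(upE sF1) ?v0 //; apply: (@runs_DoS _ (fun _ => sF1)).
- by apply: run_Convert => //; rewrite /dvdn -ev v0.
- by rewrite -(upE Dead); [apply: (@runs_DoS _ (fun _ => Dead))|case: eqP].
- by apply: run_Convert => //; rewrite /dvdn -ev; case: eqP.
Qed.

Lemma run_initStep q : q < n * n ->
  runs initStep (partial (vis q) q) (off + q) (20 * (off + n * n)) (partial (vis q.+1) q.+1) (off + q.+1).
Proof.
move=> lt_q; have r1 := @run_toStart (vis q) q (off + q) (ltnW lt_q) ltac:(lia).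
have vis_le : vis q <= n by case: (q) => //= q'; apply: ltn_pmod.
set P := fun s : sym => (s == sF0) || (s == Two) || (s == Three).
have r2 : runs (Goto P) (partial (vis q) q) 0 (3 * vis q + 1) (partial (vis q) q) (vis q).
  have := @runs_Goto _ P (partial (vis q) q) 0 (vis q); rewrite add0n; apply.
    move=> i lt_i; rewrite add0n partial_prefix; last lia.
    rewrite /ring lt_i; case: eqP => _ //.
    by have -> : 0 < vis q by lia.
  case: (ltngtP (vis q) n) vis_le => // [lt_v _|-> _]; last by rewrite partial_sep.
  rewrite partial_prefix // /ring ltnn; case: eqP => // ->.
  by [].
case: (ltngtP (vis q) n) vis_le => // [lt_v _|ev _].
  have ev : vis q = q %% n.
    move: lt_v; rewrite /vis; case: (q) => [|q'] //; rewrite ?mod0n //.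
    move=> lt_v; rewrite modnS; case: ifP => // dv.
    have : n %| (q' %% n).+1 by rewrite /dvdn -addn1 modnDml addn1 -/(dvdn n q'.+1).
    by move/dvdn_leq => /(_ isT); lia.
  have r3 := run_visit lt_v lt_q ev.
  have -> : vis q.+1 = (vis q).+1 by rewrite /vis -/(vis q) {1}ev.
  apply: runsW (runs_Sq r1 (runs_Sq r2 (runs_Sq (runs_Br (B := 0) _) r3))) _.
    have -> : pred1 Three (partial (vis q) q (vis q)) = false.
      by rewrite /= partial_prefix // /ring; case: ifP => _; case: ifP.
    exact: runs_Nop.
  by rewrite /off in lt_v *; lia.
have ev0 : 0 = q %% n.
  move: ev; rewrite /vis; case: (q) => [|q'] //; first by rewrite mod0n.
  by move=> [ev]; rewrite -addn1 -modnDml addn1 ev modnn.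
have r3 := run_visit n_gt0 lt_q ev0.
have -> : vis q.+1 = 1 by rewrite /vis -ev0.
have rr := run_reset q; rewrite ev in r1 r2 *.
apply: runsW (runs_Sq r1 (runs_Sq r2 (runs_Sq (runs_Br (B := 3 * n + 4) _) r3))) _.
  by rewrite [pred1 _ _]/= partial_sep eqxx.
by rewrite /off; lia.
Qed.

Definition st0 : store A F C :=
  Store (fun a i j => (a == aE) && bit (i * n + j)) (fun _ => false) (fun _ => 0) k [::].

Lemma run_initP : exists2 t', runs initP t0 0 (100 * (off + n * n + k + 1) ^ 2) t' off
  & Rel n off k (fun _ => n) (fun _ => 0) st0 t'.
Proof.
have nn : 0 < n * n by rewrite muln_gt0 n_gt0.
have E1 : upd t0 0 sF0 = partial 0 0.
  apply: functional_extensionality => i; rewrite /upd /partial /ring.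
  case: eqP => [->|_]; first by rewrite n_gt0.
  case: ifP => [lt_i|]; first by rewrite t0_prefix.
  by have -> : (off <= i < off + 0) = false by lia.
have r1 : runs (Do (fun _ => sF0) MoveS) t0 0 1 (partial 0 0) 0.
  by rewrite -E1; apply: (@runs_DoS _ (fun _ => sF0)).
have gotoSep v q t' : (forall i, i <= n -> t' i = partial v q i) ->
    runs (Goto (pred1 Three)) t' 0 (3 * n + 1) t' n.
  move=> E; have := @runs_Goto _ (pred1 Three) t' 0 n; rewrite add0n; apply.
    move=> i lt_i; rewrite add0n E /= ?partial_prefix //; last exact: ltnW.
    by rewrite /ring; case: ifP => _; case: ifP.
  by rewrite /= E // partial_sep.
have r2 := @gotoSep 0 0 (partial 0 0) (fun _ _ => erefl).
have right t' : runs (Do id MoveR) t' n 1 t' off.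
  by rewrite -[X in runs _ _ _ _ X](upd_id _ n); apply: runs_Do.
have [|||t4 [h4 [r4 [Et Eh]]]] := @runs_Wh _ (fun s => (s == One) || (s == Two)) initStep
   (fun q t h => t = partial (vis q) q /\ h = off + q) (n * n) (20 * (off + n * n)) _ _ (partial 0 0) off.
- move=> q _ _ lt_q [-> ->]; rewrite partial_raw // t0_mat //; split; first by case: ifP.
  by eexists; eexists; split; first exact: run_initStep.
- by move=> _ _ [-> ->]; rewrite partial_raw // t0_sep2.
- by rewrite addn0.
rewrite {}Et {}Eh in r4; set t5 := partial (vis _) _ in r4.
have t5k i : t5 (off + n * n + i) = if i is i'.+1 then if i' < k then Two else Blank else Three.
  rewrite -addnA /t5 partial_raw ?leq_addr // addnA.
  by case: i => [|i]; rewrite ?addn0 // t0_k.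
have r5 : runs (Goto (pred1 Blank)) t5 (off + n * n) (3 * k.+1 + 1) t5 (off + n * n + k.+1).
  apply: runs_Goto => [i lt_i|] /=; rewrite t5k ?ltnn //.
  by case: i lt_i => //= i; rewrite ltnS => ->.
set t6 := upd t5 (off + n * n + k.+1) SOut.
have r6 : runs (Do (fun _ => SOut) MoveS) t5 (off + n * n + k.+1) 1 t6 (off + n * n + k.+1).
  exact: (@runs_DoS _ (fun _ => SOut)).
have t6E i : i <= off + n * n + k -> t6 i = t5 i.
  by move=> le_i; rewrite /t6 /upd; case: eqP => // e; lia.
have r7 : runs (GoBack isF) t6 (off + n * n + k.+1) (3 * (off + n * n + k.+1) + 1) t6 0.
  have := @runs_GoBack _ isF t6 0 (off + n * n + k.+1); rewrite add0n; apply; last first.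
    by rewrite t6E // /t5 partial_prefix // isF_ring.
  move=> i lt_i; rewrite add0n; case: (i.+1 =P off + n * n + k.+1) => [->|ne].
    by rewrite /t6 /upd eqxx.
  by rewrite t6E /t5 ?partial_notF //; lia.
have r8 : runs (Goto (pred1 Three)) t6 0 (3 * n + 1) t6 n.
  by apply: (gotoSep (vis (n * n)) (n * n)) => i le_i; rewrite t6E; [|rewrite /off; lia].
set t9 := upd t6 off (put (tFst V A F C) true (t6 off)).
have r9 : runs (Do (put (tFst V A F C) true) MoveS) t6 off 1 t9 off by apply: runs_DoS.
exists t9.
  have rr := runs_Sq r6 (runs_Sq r7 (runs_Sq r8 (runs_Sq (right _ t6) r9))).
  apply: (runsW (runs_Sq r1 (runs_Sq r2 (runs_Sq (right _ (partial 0 0)) (runs_Sq r4 (runs_Sq r5 rr)))))).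
  set s := off + n * n + k + 1.
  have : n * n * (20 * (off + n * n) + 2) + 1 <= s * (22 * s) + 1.
    by rewrite leq_add2r; apply: leq_mul; rewrite /s /off; lia.
  have -> : s ^ 2 = s * s by [].
  have : s <= s * s by rewrite leq_pmulr // /s; lia.
  by rewrite {1}/s /off; lia.
have t6c p : p < n * n -> t6 (off + p) = newCell (n %| p) (t0 (off + p)).
  by move=> lt_p; rewrite t6E; [apply: partial_cell|lia].
have t9c p : p < n * n -> t9 (off + p) =
    if p == 0 then put (tFst V A F C) true (newCell (n %| p) (t0 (off + p)))
    else newCell (n %| p) (t0 (off + p)).
  move=> lt_p; rewrite /t9 /upd; case: (p =P 0) => [->|p0].
    by rewrite addn0 eqxx -[X in t6 X]addn0 t6c ?addn0.
  have -> : (off + p == off) = false by lia.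
  exact: t6c.
have sC p : p < n * n -> (t0 (off + p) == Two) = bit p by move/t0_mat->; case: (bit p).
split=> //.
- split=> [p lt_p|p lt_p|p lt_p|p u lt_p su|i].
  + by rewrite t9c //; case: ifP.
  + by rewrite t9c //; case: eqP => [->|_] /=; rewrite ffunE ?eqxx.
  + by rewrite t9c //; case: eqP => [->|_] /=; rewrite ffunE //= ffunE /= ?eqxx.
  + have -> : get u (t9 (off + p)) = (u == Ar V F C aE) && bit p.
      case: u su => // u _; rewrite t9c //; case: eqP => [p0|_] /=; rewrite !ffunE /= ?sC //.
    move: u su => [[[[y|y]|y]|[[y|y]|y]]|//] _ //=.
    * by have : p %/ n < n; [rewrite ltn_divLR|case: eqP => // ->; rewrite ltnn].
    * by have := ltn_pmod p n_gt0; case: eqP => // ->; rewrite ltnn.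
    * by rewrite -divn_eq.
  + rewrite /t9 /upd; have -> : (off + n * n + i == off) = false by lia.
    by rewrite /t6 /upd; case: eqP => // _; rewrite t5k; case: i => // i; case: ifP.
move=> i; rewrite /t9 /upd; have -> : (off + n * n + i == off) = false by lia.
rewrite /t6 /upd eqn_add2l t5k /tail /= subnn /=.
case: i => [|i] //=; rewrite eqSS nth_cat size_nseq nth_nseq.
case: (ltngtP i k) => [//|lt_k|->]; last by rewrite subnn.
have -> : i - k = (i - k).-1.+1 by lia.
by rewrite /= nth_nil.
Qed.

End Init.

Variables (c : cmd V A F C).
Hypothesis wf_c : wfC [::] c.

Definition init_store (G : graph) (k : nat) : store A F C :=
  Store (fun a i j => (a == aE) &&
           nth false [seq gadj i j | i <- enum 'I_(gn G), j <- enum 'I_(gn G)] (i * gn G + j))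
        (fun _ => false) (fun _ => 0) k [::].

Definition out_nat (st : store A F C) : seq nat := [seq (nat_of_ord s).+1 | s <- outp st].

Lemma size_encode G k : size (encode G k) = gn G + 1 + gn G * gn G + 1 + k.
Proof.
by rewrite /encode !size_cat !size_nseq size_allpairs !size_enum_ord /=; lia.
Qed.

Lemma outs_mono n m : n <= m -> outs n c <= outs m c.
Proof.
move=> le_nm; elim: (c) => //= *; first by apply: leq_add.
  by apply: leq_add.
by apply: leq_mul.
Qed.

(** The final head position counts the vertex prefix with its separator, the matrix, the second
    separator, the [k] budget digits and the output separator; the output starts right there. *)
Lemma encode_run (G : graph) k (env : V -> 'I_(gn G)) (L := size (encode G k)) M :
  0 < gn G -> L + 3 + outs (gn G) c <= M ->
  exists2 t', runs (fullP c) (fun i => dec (nth 0 (encode G k) i)) 0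
     (100 * L ^ 2 + kC c M + 5 * M + 10) t'
     ((gn G).+1 + gn G * gn G + k + 2)
   & forall i, enc (t' ((gn G).+1 + gn G * gn G + k + 2 + i)) =
       nth 0 (out_nat (eval env c (init_store G k))) i.
Proof.
set n := gn G => n_gt0 leM; set mat := [seq gadj i j | i <- enum 'I_n, j <- enum 'I_n].
have size_mat : size mat = n * n by rewrite size_allpairs size_enum_ord.
have decE (s : sym) : dec (enc s) = s := encK s.
set t0 := fun i => dec (nth 0 (encode G k) i).
have p1 i : i < n -> t0 i = Two.
  by move=> lt_i; rewrite /t0 /encode nth_cat size_nseq lt_i nth_nseq lt_i (decE Two).
have p2 : t0 n = Three.
  by rewrite /t0 /encode nth_cat size_nseq ltnn subnn (decE Three).
have pm i : t0 (n.+1 + i) = dec (nth 0 ([seq (if gadj i j then 2 else 1) | i <- enum 'I_n, j <- enum 'I_n]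
    ++ [:: 3] ++ nseq k 2) i).
  rewrite /t0 /encode nth_cat size_nseq; have -> : (n.+1 + i < n) = false by lia.
  by have -> : n.+1 + i - n = i.+1 by lia.
have sz2 : size [seq (if gadj i j then 2 else 1) | i <- enum 'I_n, j <- enum 'I_n] = n * n.
  by rewrite size_allpairs size_enum_ord.
have matE : [seq (if gadj i j then 2 else 1) | i <- enum 'I_n, j <- enum 'I_n] =
    [seq (if b then 2 else 1) | b <- mat].
  by rewrite /mat map_allpairs.
have p3 p : p < n * n -> t0 (n.+1 + p) = if nth false mat p then Two else One.
  move=> lt_p; rewrite pm nth_cat sz2 lt_p matE (nth_map false) ?size_mat //.
  by case: (nth _ _ _); [rewrite (decE Two)|rewrite (decE One)].
have p4 : t0 (n.+1 + n * n) = Three.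
  by rewrite pm nth_cat sz2 ltnn subnn (decE Three).
have p5 i : t0 (n.+1 + n * n + i.+1) = if i < k then Two else Blank.
  rewrite -addnA pm nth_cat sz2; have -> : (n * n + i.+1 < n * n) = false by lia.
  have -> : n * n + i.+1 - n * n = i.+1 by lia.
  by rewrite /= nth_nseq; case: ifP => _; [rewrite (decE Two)|rewrite (decE Blank)].
have LE : L = n.+1 + n * n + k + 1 by rewrite /L size_encode -/n; lia.
have [t1 r1 R1] := run_initP n_gt0 p1 p2 p3 p4 p5.
rewrite -LE in r1.
have bd : bound [::] env (fun _ => n) (fun _ => 0) by split.
have [|t2 r2 R2] := @cC_correct V A F C n n.+1 k n_gt0 c [::] env _ _ _ _ M wf_c bd R1.
  by rewrite /ext /=; lia.
have -> : init_store G k = st0 n k (nth false mat) by [].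
set st' := eval env c _ in R2 *.
have szo : size (outp st') <= outs n c by have := size_outp n_gt0 c env (st0 n k (nth false mat)); rewrite add0n.
have kin' : kin st' <= k := rel_kin R2.
have tailE i : t2 (n.+1 + n * n + i) = nth Blank (tail V k st') i := rel_tail R2 i.
have szT := size_tail V n_gt0 kin'.
have nO i : i < k.+1 -> nth Blank (tail V k st') i != SOut.
  move=> lt_i; rewrite /tail catA.
  case: i lt_i => [|i] lt_i //=; rewrite nth_cat size_cat !size_nseq subnK //.
  rewrite ltnS in lt_i; rewrite lt_i nth_cat size_nseq !nth_nseq.
  by case: ifP => // lt_d; case: ifP.
have isO : nth Blank (tail V k st') k.+1 = SOut.
  rewrite /tail catA /= nth_cat size_cat !size_nseq subnK // ltnn subnn //.
have r3 : runs (Goto (pred1 SOut)) t2 n.+1 (3 * (n * n + k.+1) + 1) t2 (n.+1 + (n * n + k.+1)).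
  apply: runs_Goto => [i lt_i|]; last by rewrite addnA tailE isO /=.
  case: (ltnP i (n * n)) => lt_in; first by case: (t2 _) (ag_cell (rel_ag R2) lt_in).
  have -> : n.+1 + i = n.+1 + n * n + (i - n * n) by lia.
  by rewrite tailE; apply: nO; lia.
exists t2.
  have -> : n.+1 + n * n + k + 2 = mv MoveR (n.+1 + (n * n + k.+1)) by rewrite /=; lia.
  have r4 : runs (Do id MoveR) t2 (n.+1 + (n * n + k.+1)) 1 t2 (mv MoveR (n.+1 + (n * n + k.+1))).
    by rewrite -[X in runs _ _ _ _ X](upd_id _ (n.+1 + (n * n + k.+1))); apply: runs_Do.
  have rr := runs_Sq r1 (runs_Sq r2 (runs_Sq r3 r4)).
  apply: (@runsW _ _ _ _ (100 * L ^ 2 + (kC c M + (3 * (n * n + k.+1) + 1 + 1))).+2).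
    by apply: runs_Br; rewrite /= p1.
  by lia.
move=> i; have -> : n.+1 + n * n + k + 2 + i = n.+1 + n * n + (k + 2 + i) by lia.
rewrite tailE /tail catA; have -> : k + 2 + i = (k + i.+1).+1 by lia.
rewrite /= nth_cat size_cat !size_nseq subnK //.
have -> : (k + i.+1 < k) = false by lia.
have -> : k + i.+1 - k = i.+1 by lia.
rewrite /= /out_nat; case: (ltnP i (size (outp st'))) => lt_i.
  by rewrite !(nth_map ord0) //= inordK //; have := ltn_ord (nth ord0 (outp st') i); lia.
by rewrite !nth_default ?size_map.
Qed.

(** A graph without vertices admits no environment, hence the separate first clause. *)
Lemma machine : exists M : TM, TM_wf M /\ exists a d : nat, forall (G : graph) (k : nat),
  (gn G = 0 -> exists t cf, [/\ t <= a * size (encode G k) ^ d + a,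
      run M (init_config (encode G k)) t = Some cf & output cf = encode G k]) /\
  (forall env : V -> 'I_(gn G), 0 < gn G ->
    exists t cf, [/\ t <= a * size (encode G k) ^ d + a,
      run M (init_config (encode G k)) t = Some cf &
      output cf = out_nat (eval env c (init_store G k))]).
Proof.
exists (tm_of enc dec (8 + #|cell V A F C|) (fullP c)); split.
  by apply: tm_of_wf => [s|]; [apply: enc_lt|lia].
have ns4 : 4 <= 8 + #|cell V A F C| by lia.
have dec0 : enc (dec 0) = 0 by rewrite (encK Blank).
have decE G k a : a \in encode G k -> enc (dec a) = a.
  have d1 : enc (dec 1) = 1 by rewrite (encK One).
  have d2 : enc (dec 2) = 2 by rewrite (encK Two).
  have d3 : enc (dec 3) = 3 by rewrite (encK Three).
  rewrite /encode !mem_cat !mem_nseq !inE.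
  case/or4P=> [/andP[_ /eqP->]|/eqP->|/allpairsP[p [_ _ ->]]|] //; first by case: ifP.
  by case/orP=> [/eqP->|/andP[_ /eqP->]].
have [b [e Hb]] : poly_bounded (fun L => 100 * L ^ 2 + kC c (L + 3 + outs L c) +
    5 * (L + 3 + outs L c) + 10).
  have PM : poly_bounded (fun L => L + 3 + outs L c).
    by do ?[exact: poly_id | exact: poly_const | exact: outs_poly | apply: poly_add].
  apply: poly_add; last exact: poly_const.
  apply: poly_add; last exact: poly_scale PM.
  apply: poly_add; last by apply: poly_comp (kC_poly c) PM _ => m m0; lia.
  by apply: poly_scale; apply: (poly_mul poly_id poly_id).
exists (b + 2), e => G k; split.
  move=> n0.
  have ex : runs (fullP c) (fun i => dec (nth 0 (encode G k) i)) 0 2 (fun i => dec (nth 0 (encode G k) i)) 0.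
    apply: (@runsW _ _ _ _ 0.+2) => //; apply: runs_Br.
    have -> : pred1 Three (dec (nth 0 (encode G k) 0)).
      have -> : nth 0 (encode G k) 0 = 3 by case: G n0 => n ad sy ir /= n0; subst n.
      by rewrite (encK Three).
    exact: runs_Nop.
  case: ex => t le_t /(run_exec encK ns4 dec0) /(_ (@decE G k)) [cf rcf rep].
  exists t, cf; split=> //; first by lia.
  apply: (output_represents rep) => [i|].
    rewrite add0n; case: (ltnP i (size (encode G k))) => lt_i; last by rewrite nth_default // dec0.
    by rewrite (decE G k) // mem_nth.
  rewrite /encode !mem_cat !mem_nseq !inE /= !andbF /= orbF.
  by apply/allpairsP => -[p [_ _]]; case: ifP.
move=> env n_gt0.
have le_n : gn G <= size (encode G k) by rewrite size_encode; lia.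
have leM : size (encode G k) + 3 + outs (gn G) c <= size (encode G k) + 3 + outs (size (encode G k)) c.
  by rewrite leq_add2l outs_mono.
have [t' [t le_t ex] outE] := encode_run env n_gt0 leM.
have [cf rcf rep] := run_exec encK ns4 dec0 ex (@decE G k).
exists t, cf; split=> //; last first.
  apply: (output_represents rep) => //.
  by apply/mapP => -[s _].
have L0 : 0 < size (encode G k) by lia.
by apply: leq_trans le_t _; apply: leq_trans (Hb _ L0) _; rewrite mulnDl; lia.
Qed.

End Machine.

(** * Paw-free graphs and optimal solutions *)

Lemma card_exchange (U : finType) (A B Z Q : {set U}) :
  Z \subset A -> #|Q| <= #|Z| -> B \subset (A :\: Z) :|: Q -> #|B| <= #|A|.
Proof.
move=> sZ leQ sB; apply: leq_trans (subset_leq_card sB) _.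
apply: leq_trans (leq_card_setU _ _) _.
by rewrite cardsD (setIidPr sZ); have := subset_leq_card sZ; lia.
Qed.

Lemma card_removed (U : finType) (A B Z : {set U}) :
  Z \subset A -> Z != set0 -> B \subset A :\: Z -> #|B| < #|A|.
Proof.
rewrite -card_gt0 => sZ Z0 sB; apply: leq_ltn_trans (subset_leq_card sB) _.
by rewrite cardsD (setIidPr sZ); have := subset_leq_card sZ; lia.
Qed.

Section Paws.
Variable T : finType.
Implicit Types (e f : rel T) (X Y D : {set T}).

Definition paw e a b c d := [&& e a b, e b c, e a c, e c d, ~~ e a d & ~~ e b d].

Definition pawfree_on Y e :=
  forall a b c d, a \in Y -> b \in Y -> c \in Y -> d \in Y -> ~~ paw e a b c d.

Definition diff e f Y := [set p : T * T | [&& p.1 \in Y, p.2 \in Y & e p.1 p.2 != f p.1 p.2]].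

(* Edits are counted as ordered pairs, hence the factor 2. *)
Definition yes e Y k := exists f : rel T,
  [/\ symmetric f, irreflexive f, pawfree_on Y f & #|diff e f Y| <= k.*2].

Definition tri e a b c := [&& e a b, e b c & e a c].

Lemma pawfree_sub X Y e : X \subset Y -> pawfree_on Y e -> pawfree_on X e.
Proof. by move=> /subsetP sXY pf a b c d aX bX cX dX; apply: pf; apply: sXY. Qed.

Definition tri_in e Y x := [exists b in Y, exists c in Y, tri e x b c].

Lemma tri_inP e Y x : reflect (exists b c, [/\ b \in Y, c \in Y & tri e x b c]) (tri_in e Y x).
Proof.
apply: (iffP existsP).
  by case=> b /andP[bY /existsP[c /andP[cY t]]]; exists b, c.
case=> b [c [bY cY t]]; exists b; rewrite bY; apply/existsP; exists c.
by rewrite cY.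
Qed.

(** * Triangle components of paw-free graphs *)

Section Olariu.
Variables (e : rel T) (Y : {set T}).
Hypotheses (sym : symmetric e) (irr : irreflexive e) (pf : pawfree_on Y e).

Lemma tri_rot a b c : tri e a b c -> tri e b c a.
Proof. by case/and3P=> ab bc ac; rewrite /tri bc (sym c a) ac (sym b a) ab. Qed.

Lemma tri_swap a b c : tri e a b c -> tri e b a c.
Proof. by case/and3P=> ab bc ac; rewrite /tri (sym b a) ab ac bc. Qed.

(** Otherwise [x] is pendant at [a] on the triangle, which is a paw. *)
Lemma tri_two a b c x : a \in Y -> b \in Y -> c \in Y -> x \in Y ->
  tri e a b c -> e x a -> e x b || e x c.
Proof.
move=> aY bY cY xY /and3P[ab bc ac] xa; rewrite -[_ || _]negbK negb_or; apply/negP.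
case/andP=> xb xc; have := pf bY cY aY xY; rewrite /paw bc (sym c a) ac (sym b a) ab (sym a x) xa.
by rewrite (sym b x) (negbTE xb) (sym c x) (negbTE xc).
Qed.

(** In a paw-free graph the vertices seeing a given triangle already form its whole connected
    component, so no paths are needed. *)
Definition tcomp a b c := [set x in Y | [|| e x a, e x b | e x c]].

Section Component.
Variables a b c : T.
Hypotheses (aY : a \in Y) (bY : b \in Y) (cY : c \in Y) (abc : tri e a b c).

Lemma comp_sub x : x \in tcomp a b c -> x \in Y. Proof. by rewrite inE => /andP[]. Qed.

Lemma comp_a : a \in tcomp a b c.
Proof. by case/and3P: abc => ab _ _; rewrite inE aY ab orbT. Qed.

Lemma comp_b : b \in tcomp a b c.
Proof. by case/and3P: abc => ab bc _; rewrite inE bY bc !orbT. Qed.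

Lemma comp_c : c \in tcomp a b c.
Proof. by case/and3P: abc => ab bc ac; rewrite inE cY sym ac. Qed.

Lemma comp_pair x : x \in tcomp a b c ->
  [\/ e x a && e x b, e x b && e x c | e x a && e x c].
Proof.
rewrite inE => /andP[xY /or3P[xa|xb|xc]].
- have := tri_two aY bY cY xY abc xa.
  by case/orP=> h; [apply: Or31|apply: Or33]; rewrite xa h.
- have := tri_two bY cY aY xY (tri_rot abc) xb.
  by case/orP=> h; [apply: Or32|apply: Or31]; rewrite xb h.
- have := tri_two cY aY bY xY (tri_rot (tri_rot abc)) xc.
  by case/orP=> h; [apply: Or33|apply: Or32]; rewrite xc h.
Qed.

(** By [comp_pair], [x] forms a triangle with two of [a], [b], [c]. As [y] sees [x], it sees another
    vertex of that triangle, hence one of [a], [b], [c]. *)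
Lemma comp_closed x y : x \in tcomp a b c -> y \in Y -> e x y -> y \in tcomp a b c.
Proof.
move=> xD yY xy; have xY := comp_sub xD; have yx : e y x by rewrite sym.
case/and3P: abc => ab bc ac; rewrite inE yY /=.
case: (comp_pair xD) => /andP[h1 h2].
- have /orP[->|->] : e y a || e y b; rewrite ?orbT //.
  by apply: (tri_two xY aY bY yY) => //; rewrite /tri h1 ab h2.
- have /orP[->|->] : e y b || e y c; rewrite ?orbT //.
  by apply: (tri_two xY bY cY yY) => //; rewrite /tri h1 bc h2.
- have /orP[->|->] : e y a || e y c; rewrite ?orbT //.
  by apply: (tri_two xY aY cY yY) => //; rewrite /tri h1 ac h2.
Qed.

End Component.

Lemma comp_eq a b c p q s x : a \in Y -> b \in Y -> c \in Y -> tri e a b c ->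
  p \in Y -> q \in Y -> s \in Y -> tri e p q s -> p \in tcomp a b c ->
  x \in tcomp a b c -> x \in tcomp p q s.
Proof.
move=> aY bY cY abc pY qY sY pqs pD xD.
have pD' := comp_a pY pqs; have cl := comp_closed pY qY sY pqs.
case/and3P: (abc) => ab bc ac.
have aD : a \in tcomp p q s.
  move: pD; rewrite inE => /andP[_ /or3P[pa|pb|pc]].
  - exact: cl pD' aY pa.
  - by apply: (cl b) => //; [apply: cl pD' bY pb|rewrite sym].
  - by apply: (cl c) => //; [apply: cl pD' cY pc|rewrite sym].
move: (xD); rewrite inE => /andP[xY /or3P[xa|xb|xc]].
- by apply: (cl a) => //; rewrite sym.
- by apply: (cl b) => //; [apply: cl aD bY ab|rewrite sym].
- by apply: (cl c) => //; [apply: cl aD cY ac|rewrite sym].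
Qed.

Lemma in_tri a b c x : a \in Y -> b \in Y -> c \in Y -> tri e a b c ->
  x \in tcomp a b c -> exists p q, [/\ p \in Y, q \in Y & tri e x p q].
Proof.
move=> aY bY cY abc xD; case/and3P: (abc) => ab bc ac.
case: (comp_pair aY bY cY abc xD) => /andP[h1 h2].
- by exists a, b; rewrite /tri h1 ab h2.
- by exists b, c; rewrite /tri h1 bc h2.
- by exists a, c; rewrite /tri h1 ac h2.
Qed.

(* Olariu: the component of a triangle is complete multipartite. *)
Lemma comp_multi a b c u v w : a \in Y -> b \in Y -> c \in Y -> tri e a b c ->
  u \in tcomp a b c -> v \in tcomp a b c -> w \in tcomp a b c ->
  ~~ e u v -> ~~ e v w -> ~~ e u w.
Proof.
move=> aY bY cY abc uD vD wD uv vw; apply/negP => uw.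
have [[uY vY] wY] := (comp_sub uD, comp_sub vD, comp_sub wD).
have [p [q [pY qY upq]]] := in_tri aY bY cY abc uD.
have [s sY uws] : exists2 s, s \in Y & tri e u w s.
  case/and3P: (upq) => up pq uq.
  have /orP[wp|wq] := tri_two uY pY qY wY upq (etrans (sym w u) uw).
    by exists p; rewrite // /tri uw wp up.
  by exists q; rewrite // /tri uw wq uq.
(* In the component of the triangle [u], [w], [s] the vertex [v] misses [u] and [w], so it sees [s]
   alone, against [tri_two]. *)
have := comp_eq aY bY cY abc uY wY sY uws uD vD.
rewrite inE vY (sym v u) (negbTE uv) (negbTE vw) /= => vs.
have := tri_two sY uY wY vY (tri_rot (tri_rot uws)) vs.
by rewrite (sym v u) (negbTE uv) (negbTE vw).
Qed.

End Olariu.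

Lemma ex_min (A : Type) (P : A -> Prop) (mu : A -> nat) :
  (exists x, P x) -> exists2 x, P x & forall y, P y -> mu x <= mu y.
Proof.
case=> x Px; move: {2}(mu x) (leqnn (mu x)) => b.
elim: b x Px => [|b IH] x Px le_b.
  by exists x => // y _; rewrite (leq_trans le_b).
case: (classic (exists2 y, P y & mu y < mu x)) => [[y Py lt_y]|no].
  by apply: (IH y Py); lia.
exists x => // y Py; rewrite leqNgt; apply/negP => lt_y.
by apply: no; exists y.
Qed.

(** * Solutions minimizing the sum of edits and additions *)

Section Minimal.
Variables (e : rel T) (X K : {set T}) (k : nat).
Hypotheses (sym : symmetric e) (irr : irreflexive e) (sKX : K \subset X).

Definition adds f := [set p : T * T | [&& p.1 \in K, p.2 \in K, f p.1 p.2 & ~~ e p.1 p.2]].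

Definition solution f :=
  [/\ symmetric f, irreflexive f, pawfree_on K f & #|diff e f K| <= k.*2].

Variable f : rel T.
Hypothesis sol : solution f.
Hypothesis minimal : forall g, solution g -> #|diff e f K| + #|adds f| <= #|diff e g K| + #|adds g|.

Let fsym : symmetric f. Proof. by case: sol. Qed.
Let firr : irreflexive f. Proof. by case: sol. Qed.
Let fpf : pawfree_on K f. Proof. by case: sol. Qed.

Lemma adds_sub : adds f \subset diff e f K.
Proof.
apply/subsetP => -[u v]; rewrite !inE /= => /and4P[-> -> -> /negbTE->].
by [].
Qed.

(** The additions [Z] are given up for at most as many other edits [Q]: the number of edits does not
    grow, an addition disappears, and the minimal sum would drop. *)
Lemma no_improvement g (Z Q : {set T * T}) : symmetric g -> irreflexive g -> pawfree_on K g ->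
  Z \subset adds f -> Z != set0 -> #|Q| <= #|Z| ->
  diff e g K \subset (diff e f K :\: Z) :|: Q -> adds g \subset adds f :\: Z -> False.
Proof.
move=> gs gi gp sZ Z0 leQ sd sa; have [_ _ _ le_k] := sol.
have sZd : Z \subset diff e f K := subset_trans sZ adds_sub.
have cd : #|diff e g K| <= #|diff e f K| := card_exchange sZd leQ sd.
have ca : #|adds g| < #|adds f| := card_removed sZ Z0 sa.
have sg : solution g by split=> //; apply: leq_trans le_k.
by have := minimal sg; rewrite leqNgt -addnS leq_add.
Qed.

(** Undo all additions inside [D], a union of components of [f], and delete the pairs of [del] as
    well. Then [D] has no triangle left, so no paw, and the undone additions pay for the
    deletions. *)
Lemma no_undo (D : {set T}) (del : rel T) : symmetric del ->
  D \subset K -> (forall u v, u \in D -> v \in K -> f u v -> v \in D) ->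
  (forall a b c, a \in D -> b \in D -> c \in D -> tri e a b c -> tri f a b c ->
     [|| del a b, del b c | del a c]) ->
  (exists u v, [/\ u \in D, v \in D, f u v & ~~ e u v]) ->
  #|[set p : T * T | [&& p.1 \in D, p.2 \in D & del p.1 p.2]]| <=
    #|[set p in adds f | (p.1 \in D) && (p.2 \in D)]| -> False.
Proof.
move=> sdel sDK clD notri [u0 [v0 [u0D v0D fuv euv]]] leQ.
pose g u v := if (u \in D) && (v \in D) then [&& e u v, f u v & ~~ del u v] else f u v.
have gf u v : g u v -> f u v by rewrite /g; case: ifP => // _ /and3P[].
have DK u : u \in D -> u \in K by apply: (subsetP sDK).
have gs : symmetric g.
  by move=> u v; rewrite /g andbC sym fsym sdel.
apply: (no_improvement (g := g) (Z := [set p in adds f | (p.1 \in D) && (p.2 \in D)])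
  (Q := [set p : T * T | [&& p.1 \in D, p.2 \in D & del p.1 p.2]])) => //.
- by move=> u; rewrite /g irr firr; case: ifP.
- move=> a b c d aK bK cK dK; apply/negP => pw.
  case/and5P: (pw) => ab bc ac cd /andP[ad bd].
  have [[[fab fbc] fac] fcd] := (gf _ _ ab, gf _ _ bc, gf _ _ ac, gf _ _ cd).
  case aD: (a \in D).
    have bD := clD _ _ aD bK fab; have cD := clD _ _ aD cK fac.
    move: ab bc ac; rewrite /g aD bD cD => /and3P[eab _ dab] /and3P[ebc _ dbc] /and3P[eac _ dac].
    have := notri a b c aD bD cD; rewrite /tri eab ebc eac fab fbc fac => /(_ isT isT).
    by rewrite (negbTE dab) (negbTE dbc) (negbTE dac).
  have bD : (b \in D) = false by apply: contraFF aD => bD; apply: clD bD aK _; rewrite fsym.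
  have cD : (c \in D) = false by apply: contraFF aD => cD; apply: clD cD aK _; rewrite fsym.
  have dD : (d \in D) = false by apply: contraFF cD => dD; apply: clD dD cK _; rewrite fsym.
  by move: pw; rewrite /paw /g aD bD cD /=; apply/negP; apply: fpf.
- by apply/subsetP => p; rewrite inE => /andP[].
- by apply/set0Pn; exists (u0, v0); rewrite !inE /= u0D v0D fuv euv !DK.
- apply/subsetP => -[u v]; rewrite !inE /= => /and3P[uK vK]; rewrite uK vK /= /g.
  case: (u \in D); case: (v \in D); rewrite /= ?andbF ?orbF //=.
  by case: (e u v) (f u v) (del u v) => [] [] [].
apply/subsetP => -[u v]; rewrite !inE /= => /and4P[uK vK]; rewrite uK vK /= /g.
case: (u \in D); case: (v \in D); rewrite /= ?andbF //=; try by move=> -> ->.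
by case: (e u v).
Qed.

Lemma kept_triangle (D : {set T}) : D \subset K ->
  (forall u v, u \in D -> v \in K -> f u v -> v \in D) ->
  (exists u v, [/\ u \in D, v \in D, f u v & ~~ e u v]) ->
  exists a b c, [/\ a \in D, b \in D, c \in D, tri e a b c & tri f a b c].
Proof.
move=> sDK clD ex; apply: NNPP => no.
apply: (no_undo (del := fun _ _ => false)) sDK clD _ ex _ => //.
  by move=> a b c aD bD cD te tf; case: no; exists a, b, c.
apply: leq_trans (leq0n _); rewrite leqn0 cards_eq0; apply/eqP/setP => p.
by rewrite !inE !andbF.
Qed.

Definition W := [set v in K | tri_in f K v].

Lemma WP v : reflect (exists a b, [/\ v \in K, a \in K, b \in K & tri f v a b]) (v \in W).
Proof.
rewrite inE; apply: (iffP andP).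
  by case=> vK /tri_inP[a [b [aK bK t]]]; exists a, b.
by case=> a [b [vK aK bK t]]; split=> //; apply/tri_inP; exists a, b.
Qed.

Lemma W_closed u v : u \in W -> v \in K -> f u v -> v \in W.
Proof.
case/WP=> a [b [uK aK bK t]] vK uv; apply/WP.
have [|p [q [pK qK t']]] := in_tri fsym fpf uK aK bK t (x := v).
  by rewrite inE vK fsym uv.
by exists p, q.
Qed.

(** [K :\: W] is a union of components of [f] without triangles, so its additions could all be
    undone at no cost. *)
Lemma no_adds_outside u v : u \in K -> v \in K -> u \notin W -> v \notin W -> f u v -> e u v.
Proof.
move=> uK vK uW vW fuv; apply: contraT => euv.
have [|||a [b [c [aD bD cD _ t]]]] := @kept_triangle (K :\: W).
- exact: subsetDl.
- move=> x y; rewrite !in_setD => /andP[xW xK] yK fxy; rewrite yK andbT.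
  by apply: contra xW => yW; apply: W_closed yW xK _; rewrite fsym.
- by exists u, v; rewrite !in_setD uW vW uK vK.
move: aD bD cD; rewrite !in_setD => /andP[/negP aW aK] /andP[_ bK] /andP[_ cK].
by case: aW; apply/WP; exists b, c.
Qed.

(** A component without additions consists of original edges, its triangle included; one with
    additions contains an original triangle by [kept_triangle]. *)
Lemma comp_kept a b c : a \in K -> b \in K -> c \in K -> tri f a b c ->
  exists p q s, [/\ p \in tcomp f K a b c, q \in tcomp f K a b c, s \in tcomp f K a b c,
    tri e p q s & tri f p q s].
Proof.
move=> aK bK cK t; set D := tcomp f K a b c.
case: (classic (exists u v, [/\ u \in D, v \in D, f u v & ~~ e u v])) => [ex|no].
  apply: kept_triangle ex; first by apply/subsetP => x; apply: comp_sub.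
  by move=> u v; apply: comp_closed.
have [[aD bD] cD] := (comp_a aK t, comp_b bK t, comp_c fsym cK t).
have ef u v : u \in D -> v \in D -> f u v -> e u v.
  by move=> uD vD fuv; apply: contraT => euv; case: no; exists u, v.
exists a, b, c; split=> //; case/and3P: t => ab bc ac.
by rewrite /tri !ef.
Qed.


Lemma card_dep (I : {set T}) (F : T -> {set T}) :
  #|[set p : T * T | (p.1 \in I) && (p.2 \in F p.1)]| = \sum_(i in I) #|F i|.
Proof.
rewrite -sum1dep_card (eq_bigl (fun p : T * T => (p.1 \in I) && (p.2 \in F p.1))) //.
rewrite -(pair_big_dep (fun i => i \in I) (fun i j => j \in F i) (fun _ _ => 1)) /=.
by apply: eq_bigr => i _; rewrite sum1_card.
Qed.

Definition swap (p : T * T) := (p.2, p.1).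

Lemma swap_inj : injective swap. Proof. by case=> a b [c d] [-> ->]. Qed.

(* An optimal solution never puts into a triangle component a vertex [r] all of
   whose kept edges lead to vertices outside all triangles of [G[X]]: either
   isolating [r] is as cheap, or so many kept neighbors [l] of [r] pay for
   additions that the component is better made triangle-free. *)
Lemma kept_neighbor a b c r : a \in K -> b \in K -> c \in K -> tri f a b c ->
  r \in tcomp f K a b c -> ~~ tri_in e X r ->
  exists d, [/\ d \in tcomp f K a b c, e r d, f r d & tri_in e X d].
Proof.
move=> aK bK cK t rD ntr; set D := tcomp f K a b c in rD *.
have clD u v : u \in D -> v \in K -> f u v -> v \in D by apply: comp_closed.
have DK u : u \in D -> u \in K by apply: comp_sub.
have sDK : D \subset K by apply/subsetP.
have multi u v w : u \in D -> v \in D -> w \in D -> ~~ f u v -> ~~ f v w -> ~~ f u w.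
  by apply: comp_multi.
have := comp_kept aK bK cK t; rewrite -/D => kept; clearbody D.
pose D0 := [set d in D | tri_in e X d].
have D0D d : d \in D0 -> d \in D by rewrite inE => /andP[].
have triD0 u v w : u \in D -> v \in D -> w \in D -> tri e u v w ->
    [/\ u \in D0, v \in D0 & w \in D0].
  have KX z : z \in D -> z \in X by move/DK; apply: (subsetP sKX).
  move=> uD vD wD tuvw; rewrite !inE uD vD wD /=; split; apply/tri_inP.
  - by exists v, w; rewrite !KX.
  - by exists w, u; rewrite !KX // tri_rot.
  - by exists u, v; rewrite !KX // tri_rot // tri_rot.
apply: NNPP => no.
have noD0 d : d \in D0 -> f r d -> ~~ e r d.
  rewrite inE => /andP[dD td] frd; apply/negP => erd.
  by apply: no; exists d.
(* Under the contrary assumption all edges of [f] from [r] to [N0] are additions, whereas [L]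
   collects the original neighbors that [r] keeps, none of which is in [D0]. *)
pose N0 := [set d in D0 | f r d].
pose L := [set l in D | e r l && f r l].
have LD0 l : l \in L -> l \notin D0.
  rewrite inE => /and3P[_ erl frl]; apply/negP => lD0.
  by move: (noD0 l lD0 frl); rewrite erl.
have rD0 : r \notin D0 by rewrite inE rD.
(* Two adjacent vertices of the kept triangle lie in different parts, so [r] sees at least one of
   them. *)
have [d0 d0N] : exists d0, d0 \in N0.
  have [p [q [s [pD qD sD tp tf]]]] := kept.
  have [pD0 qD0 _] := triD0 _ _ _ pD qD sD tp.
  case frp: (f r p); first by exists p; rewrite inE pD0 frp.
  case frq: (f r q); first by exists q; rewrite inE qD0 frq.
  have := multi p r q pD rD qD; rewrite fsym frp frq => /(_ isT isT).
  by case/and3P: tf => ->.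
have [d0D0 frd0] : d0 \in D0 /\ f r d0 by move: d0N; rewrite inE => /andP[].
have erd0 := noD0 _ d0D0 frd0.
(* If [L] is not larger than [N0], isolating [r] trades the additions towards [N0] for deletions
   towards [L]. *)
case: (leqP #|L| #|N0|) => [leLN|ltNL].
  pose g u v := if (u == r) || (v == r) then false else f u v.
  pose cross (B : {set T}) := [set (r, v) | v in B] :|: [set (v, r) | v in B].
  have card_cross (B : {set T}) : r \notin B -> #|cross B| = #|B| + #|B|.
    move=> rB; rewrite cardsU disjoint_setI0 ?cards0 ?subn0.
      by rewrite !card_imset // => [u v [->]|u v [->]].
    rewrite -setI_eq0; apply/eqP/setP => -[u v]; rewrite !inE; apply/negP.
    case/andP=> /imsetP[w wB [-> ->]] /imsetP[w' wB' [rw _]].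
    by rewrite rw wB' in rB.
  have in_cross (B : {set T}) u v :
      ((u, v) \in cross B) = ((u == r) && (v \in B)) || ((v == r) && (u \in B)).
    rewrite !inE; congr orb; apply/imsetP/andP.
    - by case=> w wB [-> ->]; rewrite eqxx.
    - by case=> /eqP-> vB; exists v.
    - by case=> w wB [-> ->]; rewrite eqxx.
    - by case=> /eqP-> uB; exists u.
  have rN0 : r \notin N0 by rewrite inE negb_and rD0.
  have rL : r \notin L by rewrite inE irr andbF.
  apply: (no_improvement (g := g) (Z := cross N0) (Q := cross L)).
  - by move=> u v; rewrite /g orbC fsym.
  - by move=> u; rewrite /g firr; case: ifP.
  - move=> x y z w xK yK zK wK; rewrite /paw /g.
    case: (x =P r) => //= _; case: (y =P r) => //= _; case: (z =P r); rewrite ?andbF //= => _.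
    case: (w =P r); rewrite ?andbF //= => _; exact: fpf.
  - apply/subsetP => -[u v]; rewrite in_cross => uv; rewrite inE /=; move: uv.
    have N0P d : d \in N0 -> [&& r \in K, d \in K, f r d & ~~ e r d].
      by rewrite inE => /andP[dD0 frd]; rewrite frd (noD0 _ dD0 frd) !DK // D0D.
    case/orP=> /andP[/eqP-> dN]; have /and4P[rK dK frd nerd] := N0P _ dN; rewrite rK dK.
      by rewrite frd nerd.
    by rewrite fsym frd sym nerd.
  - by apply/set0Pn; exists (r, d0); rewrite in_cross eqxx d0N.
  - by rewrite !card_cross //; apply: leq_add.
  - have toL w : w \in K -> e r w -> f r w -> w \in L.
      by move=> wK erw frw; rewrite inE erw frw (clD r w rD wK frw).
    have N0f w : w \in N0 -> f r w by rewrite inE => /andP[].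
    apply/subsetP => -[u v]; rewrite inE /= => /and3P[uK vK].
    rewrite in_setU in_setD !in_cross [_ \in diff _ _ _]inE /= uK vK /g.
    case: (u =P r) => [->|_] /=; last case: (v =P r) => [->|_] //=.
    + rewrite (negbTE rN0) (negbTE rL) !andbF !orbF => erv.
      have {}erv : e r v by case: (e r v) erv.
      case frv: (f r v); first by rewrite (toL v) ?orbT.
      have /negbTE-> : v \notin N0 by apply/negP => /N0f; rewrite frv.
      by rewrite erv.
    + rewrite (sym u) (fsym u) => eru; have {}eru : e r u by case: (e r u) eru.
      case fru: (f r u); first by rewrite (toL u) ?orbT.
      have /negbTE-> : u \notin N0 by apply/negP => /N0f; rewrite fru.
      by rewrite eru ?andbF.
    + by move=> ->.
  apply/subsetP => -[u v]; rewrite inE /= => /and3P[uK vK].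
  rewrite in_setD in_cross [_ \in adds _]inE /= uK vK /g.
  by case: (u =P r) => //= _; case: (v =P r) => //= _.
have [l0 l0L] : exists l, l \in L by apply/card_gt0P; apply: leq_ltn_trans ltNL.
(* [Bt l] is the set of ends in [D0] of additions at [l]. Taking [l] with the fewest makes
   [#|L| * #|Bt l|] a lower bound for the additions between [L] and [D0]. *)
pose Bt l := [set d in D0 | f l d && ~~ e l d].
case: (arg_minnP (fun l => #|Bt l|) l0L) => l lL minl.
have {}lL : l \in L := lL.
have [lD erl frl] : [/\ l \in D, e r l & f r l] by move: lL; rewrite inE => /and3P[].
have lD0 := LD0 _ lL.
have no_tri_l u v : u \in D -> v \in D -> ~~ tri e l u v.
  by move=> uD vD; apply/negP => /(triD0 _ _ _ lD uD vD)[]; rewrite (negbTE lD0).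
(* Let [x], [y], [z] be a triangle both of [e] and of [f], with [x], [y] in [N0] but not in [B].
   Edges of [f] from [l] to [x] and [y] are then original, so [l], being in no original triangle of
   [X], cannot see both in [f]. It sees one since [x] and [y] lie in different parts. The other is
   in [Wl], the edge from [l] to [z] is an addition, and [z] is in [B] or in [X2]. So [del] meets
   the triangle. *)
pose B := N0 :&: Bt l; pose X2 := Bt l :\: N0; pose Wl := [set w in N0 | ~~ f l w].
pose del u v := [|| (u \in B) && (v \in N0), (v \in B) && (u \in N0),
                    (u \in Wl) && (v \in X2) | (v \in Wl) && (u \in X2)].
have delC u v : del u v = del v u.
  have or4C p1 p2 p3 p4 : [|| p1, p2, p3 | p4] = [|| p2, p1, p4 | p3] by case: p1 p2 p3 p4 => [] [] [] [].
  exact: or4C.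
have N0D0 s : s \in N0 -> s \in D0 by rewrite inE => /andP[].
have cardB : #|B| + #|X2| = #|Bt l|.
  by rewrite /B setIC /X2 cardsID.
apply: (@no_undo D del) => //.
- move=> u v w uD vD wD te tf; apply: contraT => /norP[duv /norP[dvw duw]].
  have [uD0 vD0 wD0] := triD0 _ _ _ uD vD wD te.
  have key x y z : x \in D0 -> y \in D0 -> z \in D0 -> tri e x y z -> tri f x y z ->
      ~~ del x y -> ~~ del y z -> ~~ del x z -> x \in N0 -> y \in N0 -> False.
    move=> xD0 yD0 zD0 txyz fxyz dxy dyz dxz xN yN.
    have xB : x \notin B by apply: contra dxy => xB; rewrite /del xB yN.
    have yB : y \notin B by apply: contra dxy => yB; rewrite /del yB xN !orbT.
    have inN s : s \in N0 -> s \notin B -> f l s -> e l s.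
      move=> sN sB fls; apply: contraT => els; case/negP: sB.
      by rewrite in_setI sN /= in_set (N0D0 s sN) fls els.
    have toX2 s : s \in D0 -> s \notin N0 -> f l s -> ~~ e l s -> s \in X2.
      by move=> sD0 sN fls els; rewrite in_setD sN in_set sD0 fls els.
    have kx := inN x xN xB; have ky := inN y yN yB.
    have [[xD yD] zD] := (D0D _ xD0, D0D _ yD0, D0D _ zD0).
    case/and3P: (txyz) => exy eyz exz; case/and3P: (fxyz) => fxy fyz fxz.
    case flx: (f l x); case fly: (f l y).
    - by move: (no_tri_l x y xD yD); rewrite /tri kx // ky // exy.
    - have yW : y \in Wl by rewrite in_set yN fly.
      have flz : f l z by apply: contraTT fyz => flz; apply: (multi y l z) => //; rewrite fsym fly.
      case elz: (e l z).
        by move: (no_tri_l x z xD zD); rewrite /tri kx // elz exz.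
      case zN: (z \in N0).
        have zB : z \notin B by apply: contra dyz => zB; rewrite /del zB yN !orbT.
        by move: (inN z zN zB flz); rewrite elz.
      by move/negP: dyz; apply; rewrite /del yW (toX2 z) ?zN ?elz ?orbT.
    - have xW : x \in Wl by rewrite in_set xN flx.
      have flz : f l z by apply: contraTT fxz => flz; apply: (multi x l z) => //; rewrite fsym flx.
      case elz: (e l z).
        by move: (no_tri_l y z yD zD); rewrite /tri ky // elz eyz.
      case zN: (z \in N0).
        have zB : z \notin B by apply: contra dxz => zB; rewrite /del zB xN !orbT.
        by move: (inN z zN zB flz); rewrite elz.
      by move/negP: dxz; apply; rewrite /del xW (toX2 z) ?zN ?elz ?orbT.
    - by move: (multi x l y xD lD yD); rewrite fsym flx fly fxy => /(_ isT isT).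
  have inN0 s : s \in D0 -> (s \in N0) = f r s by move=> sD0; rewrite in_set sD0.
  (* Vertices of [D0] outside [N0] lie in the part of [r] and are pairwise nonadjacent; hence a
     triangle has two vertices in [N0]. *)
  have two x y : x \in D0 -> y \in D0 -> f x y -> (x \in N0) || (y \in N0).
    move=> xD0 yD0 fxy; rewrite (inN0 x xD0) (inN0 y yD0); apply: contraT.
    rewrite negb_or => /andP[frx fry].
    have := multi x r y (D0D _ xD0) rD (D0D _ yD0); rewrite fsym (negbTE frx) (negbTE fry) fxy.
    by move=> /(_ isT isT).
  case/and3P: (tf) => fuv fvw fuw.
  have rot g x y z : symmetric g -> tri g x y z -> tri g y z x by move=> gs; apply: tri_rot.
  have sw g x y z : symmetric g -> tri g x y z -> tri g x z y.
    by move=> gs txyz; apply: tri_swap => //; do 2!apply: tri_rot => //.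
  case uN: (u \in N0).
    case vN: (v \in N0); first by case: (key u v w uD0 vD0 wD0 te tf duv dvw duw uN vN).
    have wN : w \in N0 by have := two v w vD0 wD0 fvw; rewrite vN.
    by case: (key u w v uD0 wD0 vD0 (sw _ _ _ _ sym te) (sw _ _ _ _ fsym tf) duw); rewrite // delC.
  have vN : v \in N0 by have := two u v uD0 vD0 fuv; rewrite uN.
  have wN : w \in N0 by have := two u w uD0 wD0 fuw; rewrite uN.
  by case: (key v w u vD0 wD0 uD0 (rot _ _ _ _ sym te) (rot _ _ _ _ fsym tf) dvw); rewrite // delC.
- by exists r, d0; rewrite rD (D0D _ d0D0) frd0 erd0.
set Z := [set p in adds f | _].
pose F (A A' : {set T}) := [set p : T * T | (p.1 \in A) && (p.2 \in A')].
have cardF (A A' : {set T}) : #|F A A'| = #|A| * #|A'|.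
  by rewrite /F (card_dep A (fun _ => A')) sum_nat_const.
have cardF' (A A' : {set T}) : #|swap @: F A A'| = #|A| * #|A'|.
  by rewrite card_imset ?cardF //; apply: swap_inj.
have inswap (A : {set T * T}) u v : ((u, v) \in swap @: A) = ((v, u) \in A).
  apply/imsetP/idP => [[[x y] xyA [-> ->]] //|vuA].
  by exists (v, u).
(* [B] and [X2] split [Bt l], and [Wl] is a subset of [N0]; each product occurs twice for the two
   orders of a pair. The same number bounds the additions from below because [#|N0| < #|L|]. *)
apply: (@leq_trans (#|Bt l| * #|N0| + #|Bt l| * #|N0|)).
  apply: (@leq_trans #|(F B N0 :|: swap @: F B N0) :|: (F Wl X2 :|: swap @: F Wl X2)|).
    apply/subset_leq_card/subsetP => -[u v]; rewrite inE => /and3P[_ _].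
    rewrite !in_setU !inswap ![_ \in F _ _]in_set /= /del.
    by case/or4P=> /andP[h1 h2]; rewrite h1 h2 ?orbT.
  apply: leq_trans (leq_card_setU _ _) _.
  apply: leq_trans (leq_add (leq_card_setU _ _) (leq_card_setU _ _)) _.
  rewrite !cardF !cardF' -cardB mulnDl.
  have : #|Wl| <= #|N0| by apply/subset_leq_card/subsetP => s; rewrite in_set => /andP[].
  move/(leq_mul (leqnn #|X2|)) => le2; rewrite (mulnC #|Wl|) [leqRHS]addnACA.
  by rewrite leq_add ?leq_add // (mulnC #|N0|).
pose Q := [set p : T * T | (p.1 \in L) && (p.2 \in Bt p.1)].
have QL x y : (x, y) \in Q -> x \in L /\ y \in D0.
  by rewrite in_set /= => /andP[xL]; rewrite in_set => /and3P[yD0 _ _].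
have cardQ : #|Bt l| * #|N0| <= #|Q|.
  rewrite card_dep; apply: (@leq_trans (#|L| * #|Bt l|)).
    by rewrite mulnC leq_mul2r (ltnW ltNL) orbT.
  by rewrite -sum_nat_const; apply: leq_sum => l' l'L; apply: minl.
apply: (@leq_trans #|Q :|: swap @: Q|).
  rewrite cardsU disjoint_setI0 ?cards0 ?subn0; first by rewrite card_imset ?leq_add //; apply: swap_inj.
  rewrite -setI_eq0; apply/eqP/setP => -[u v]; rewrite in_setI inswap in_set0.
  by apply/negP => /andP[/QL[/LD0/negP uD0 _] /QL[_ /uD0]].
apply/subset_leq_card/subsetP => -[u v].
have QZ x y : (x, y) \in Q -> [/\ x \in D, y \in D, f x y & ~~ e x y].
  rewrite in_set /= => /andP[xL]; rewrite in_set => /and3P[yD0 -> ->].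
  by rewrite (D0D _ yD0); split=> //; move: xL; rewrite in_set => /andP[].
rewrite in_setU inswap => h; rewrite in_set [_ \in adds _]in_set /=.
case/orP: h => /QZ[]; first by move=> uD vD fuv euv; rewrite !DK // fuv euv uD vD.
move=> vD uD fuv euv.
by rewrite fsym fuv sym euv !DK // uD vD.
Qed.


End Minimal.
End Paws.

(** * Extending a solution from the kernel *)

Section Extension.
Variables (T : finType) (e : rel T) (S A K X : {set T}) (k : nat).
Hypotheses (sym : symmetric e) (irr : irreflexive e).
Let N := X :\: A.
Hypotheses (sAK : A \subset K) (sKX : K \subset X).
Notation ttri := (tri_in e X).
(** [P1] and [P2] give the structure outside the core. [M1] to [M3] say that a discarded vertex
    attached in one of three ways has more than [2 * k] kept vertices supporting it. *)
Hypothesis P1 : forall x y, x \in N -> y \in N -> e x y -> ~~ ttri x.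
Hypothesis P2 : forall x b c, x \in N -> b \in X -> c \in X -> tri e x b c ->
  [/\ b \in A, c \in A & (b \in S) || (c \in S)].
Hypothesis M1 : forall a x, a \in A -> x \in X :\: K -> e x a -> ~~ ttri x ->
  k.*2 < #|[set y in N :&: K | ~~ ttri y && e y a]|.
Hypothesis M2 : forall a z x, a \in A -> z \in N :&: K -> ~~ ttri z -> e z a ->
  x \in X :\: K -> e x z ->
  k.*2 < #|[set y in N :&: K | ~~ ttri y && e y a]| \/ k.*2 < #|[set y in N :&: K | e y z]|.
Hypothesis M3 : forall s b x, s \in S -> s \in A -> b \in A -> x \in X :\: K ->
  k.*2 < #|[set y in N :&: K | (e y s == e x s) && (e y b == e x b)]|.

Variable f : rel T.
Hypothesis sol : solution e K k f.
Hypothesis minimal : forall g, solution e K k g ->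
  #|diff e f K| + #|adds e K f| <= #|diff e g K| + #|adds e K g|.

Let fsym : symmetric f. Proof. by case: sol. Qed.
Let firr : irreflexive f. Proof. by case: sol. Qed.
Let fpf : pawfree_on K f. Proof. by case: sol. Qed.
Notation W := (W K f).

Definition untouched y := forall v, v \in K -> f y v = e y v.

(** At most [k.*2] ordered pairs are edited, so at most that many vertices occur as first entry of
    such a pair. *)
Lemma ex_untouched (Q : {set T}) : k.*2 < #|Q| -> Q \subset K ->
  exists2 y, y \in Q & untouched y.
Proof.
move=> ltQ sQK; pose touched := [set p.1 | p in diff e f K].
have [_ _ _ le_k] := sol.
have /subsetPn[y yQ yt] : ~~ (Q \subset touched).
  apply/negP => /subset_leq_card; rewrite leqNgt (leq_ltn_trans _ ltQ) //.
  exact: leq_trans (leq_imset_card _ _) le_k.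
exists y => // v vK; apply/eqP; rewrite eq_sym; apply: contraR yt => ne.
by apply/imsetP; exists (y, v); rewrite // inE (subsetP sQK) ?vK.
Qed.

Lemma in_NK y : y \in N :&: K -> [/\ y \in N, y \in K & y \in X].
Proof. by rewrite in_setI in_setD => /andP[/andP[-> ->] ->]. Qed.

Lemma NK_sub (P : pred T) : [set y in N :&: K | P y] \subset K.
Proof. by apply/subsetP => y; rewrite inE => /andP[/in_NK[]]. Qed.

Lemma outN x : x \in X :\: K -> x \in N.
Proof.
rewrite !in_setD => /andP[xK ->]; rewrite andbT.
by apply: contra xK; apply: (subsetP sAK).
Qed.

Lemma K_X x : x \in K -> x \in X. Proof. exact: (subsetP sKX). Qed.
Lemma A_K x : x \in A -> x \in K. Proof. exact: (subsetP sAK). Qed.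

Lemma KA_N x : x \in K -> x \notin A -> x \in N.
Proof. by move=> xK xA; rewrite in_setD xA K_X. Qed.

(** By [comp_kept] the component of [y] contains an original triangle that is kept. [y] sees two of
    its vertices in [f], and these edges are original because [y] is untouched. *)
Lemma untouched_tri y : y \in W -> untouched y -> ttri y.
Proof.
case/WP=> a [b [yK aK bK t]] uy.
have [p [q [s [pD qD sD te tf]]]] := comp_kept sym irr sol minimal yK aK bK t.
have [[pK qK] sK] := (comp_sub pD, comp_sub qD, comp_sub sD).
have yD : y \in tcomp f K p q s by apply: (comp_eq fsym fpf yK aK bK t pK qK sK tf pD (comp_a yK t)).
case/and3P: te => epq eqs eps.
have mk u v : u \in K -> v \in K -> e u v -> f y u -> f y v -> ttri y.
  move=> uK vK euv fyu fyv; apply/tri_inP; exists u, v; split; rewrite ?K_X //.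
  by rewrite /tri -!uy // fyu euv fyv.
case: (comp_pair fsym fpf pK qK sK tf yD) => /andP[h1 h2].
- exact: (mk p q).
- exact: (mk q s).
- exact: (mk p s).
Qed.

(** An untouched kept vertex in no triangle, with a neighbor in [W], would be in [W] itself and
    contradict [untouched_tri]. If [a] is in the core, [M1] supplies such a vertex. If not, [a] lies
    in no triangle, [kept_neighbor] yields a core vertex [d] of the same component joined to [a] by
    a kept edge, and [M2] supplies a neighbor of [d] or of [a]. *)
Lemma nt_no_neighbor x a : x \in X :\: K -> ~~ ttri x -> a \in W -> e x a -> False.
Proof.
move=> xXK ntx aW exa; have aK : a \in K by case/WP: aW => ? [? []].
have clash (y b : T) : y \in K -> untouched y -> ~~ ttri y -> b \in W -> e y b -> False.
  move=> yK uy nty bW eyb; case/negP: nty; apply: (untouched_tri _ uy).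
  have bK : b \in K by case/WP: bW => ? [? []].
  by apply: (W_closed sol bW yK); rewrite fsym uy.
case aA: (a \in A).
  have [y yQ uy] := ex_untouched (M1 aA xXK exa ntx) (NK_sub _).
  move: yQ; rewrite inE => /and3P[/in_NK[_ yK _] nty eya].
  exact: clash uy nty aW eya.
have aN : a \in N by apply: KA_N; rewrite ?aA.
have nta : ~~ ttri a by apply: (P1 aN (outN xXK)); rewrite sym.
case/WP: (aW) => b [c [_ bK cK t]].
have [d [dD ead fad td]] := kept_neighbor sym irr sKX sol minimal aK bK cK t (comp_a aK t) nta.
have dK := comp_sub dD.
have dW : d \in W by apply: (W_closed sol aW).
have dA : d \in A.
  apply: contraT => dA; have dN := KA_N dK dA.
  by move: td; rewrite (negbTE (P1 dN aN _)) // sym.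
have aNK : a \in N :&: K by rewrite in_setI aN.
case: (M2 dA aNK nta ead xXK exa) => lt_k.
  have [y yQ uy] := ex_untouched lt_k (NK_sub _).
  move: yQ; rewrite inE => /and3P[/in_NK[_ yK _] nty eyd].
  exact: clash uy nty dW eyd.
have [y yQ uy] := ex_untouched lt_k (NK_sub _).
move: yQ; rewrite inE => /andP[/in_NK[yN yK _] eya].
by apply: (clash y a) => //; apply: P1 eya.
Qed.

Lemma N_isolated x b : x \in N -> ttri x -> b \in N -> e x b = false.
Proof. by move=> xN tx bN; apply/negP => exb; move: tx; rewrite (negbTE (P1 xN bN exb)). Qed.

(** [M3] controls only two adjacencies at a time. The whole neighborhood is obtained from many
    untouched vertices, all of which turn out to be twins of a single [y] in [f]. *)
Lemma attached_twin x a : x \in X :\: K -> a \in W -> e x a ->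
  exists y, [/\ y \in N, y \in W, untouched y, ttri y & forall b, b \in K -> e x b = f y b].
Proof.
move=> xXK aW exa; have xN := outN xXK.
have tx : ttri x by apply: contraT => ntx; case: (nt_no_neighbor xXK ntx aW exa).
have aK : a \in K by case/WP: aW => ? [? []].
have aA : a \in A by apply: contraT => aA; rewrite (N_isolated xN tx (KA_N aK aA)) in exa.
have M3u s b : s \in S -> s \in A -> b \in A ->
    exists y, [/\ y \in N, y \in K, untouched y, e y s = e x s & e y b = e x b].
  move=> sS sA bA; have [y yQ uy] := ex_untouched (M3 sS sA bA xXK) (NK_sub _).
  by move: yQ; rewrite inE => /and3P[/in_NK[yN yK _] /eqP ys /eqP yb]; exists y.
have [s [sS sA]] : exists s, s \in S /\ s \in A.
  case/tri_inP: (tx) => b [c [bX cX t]]; have [bA cA /orP[bS|cS]] := P2 xN bX cX t.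
    by exists b.
  by exists c.
have [y [yN yK uy _ eya]] := M3u s a sS sA aA.
have inW z b : z \in K -> untouched z -> b \in W -> e z b -> z \in W.
  move=> zK uz bW ezb; have bK : b \in K by case/WP: bW => ? [? []].
  by apply: (W_closed sol bW zK); rewrite fsym uz.
have yW : y \in W by apply: (inW _ a) => //; rewrite eya.
have ty := untouched_tri yW uy.
have [p [pS pA eyp]] : exists p, [/\ p \in S, p \in A & e y p].
  case/tri_inP: (ty) => b [c [bX cX t]]; have [bA cA /orP[bS|cS]] := P2 yN bX cX t.
    by exists b; split=> //; case/and3P: t.
  by exists c; split=> //; case/and3P: t.
case/WP: (yW) => b0 [c0 [_ b0K c0K t0]].
have pW : p \in W by apply: (W_closed sol yW (A_K pA)); rewrite uy ?A_K.
(* Untouched vertices of [N] in the same triangle component are nonadjacent, so they lie in the same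
   part and have the same neighbors. *)
have twin z d : z \in N -> z \in K -> untouched z -> d \in K -> f y d -> e z d ->
    forall b, b \in K -> f z b = f y b.
  move=> zN zK uz dK fyd ezd b bK.
  have dD : d \in tcomp f K y b0 c0 by apply: (comp_closed fsym fpf yK b0K c0K t0 (comp_a yK t0)).
  have zD : z \in tcomp f K y b0 c0.
    by apply: (comp_closed fsym fpf yK b0K c0K t0 dD zK); rewrite fsym uz.
  have yD := comp_a yK t0.
  have yz : ~~ f y z by rewrite uy // (N_isolated yN ty zN).
  have zy : ~~ f z y by rewrite fsym.
  have cl := comp_closed fsym fpf yK b0K c0K t0.
  have mu := comp_multi fsym fpf yK b0K c0K t0.
  apply/idP/idP => fb.
    have bD := cl _ _ zD bK fb.
    by apply: contraTT fb; apply: mu.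
  have bD := cl _ _ yD bK fb.
  by apply: contraTT fb; apply: mu.
have fya : f y a by rewrite uy // eya.
have fyp : f y p by rewrite uy // A_K.
(* A vertex that agrees with [x] on [p] and [a] shares the neighbor [a] with [y], so it is a twin of
   [y] and sees [p]; by agreement so does [x]. *)
have exp : e x p.
  have [z [zN zK uz ezp eza]] := M3u p a pS pA aA.
  have tw := twin z a zN zK uz aK fya; rewrite eza exa in tw.
  by rewrite -ezp -uz ?A_K // (tw isT p (A_K pA)).
exists y; split=> // b bK; case bA: (b \in A); last first.
  have bN := KA_N bK (negbT bA).
  by rewrite uy // (N_isolated xN tx bN) (N_isolated yN ty bN).
(* A new [z] for each [b]: the common neighbor [p] makes it a twin of [y], and it agrees with [x] on
   [b]. *)
have [z [zN zK uz ezp ezb]] := M3u p b pS pA bA.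
have tw := twin z p zN zK uz (A_K pA) fyp; rewrite ezp exp in tw.
by rewrite -ezb -uz // (tw isT).
Qed.

Definition g u v := if (u \in K) && (v \in K) then f u v else e u v.

Let gsym : symmetric g. Proof. by move=> u v; rewrite /g andbC fsym sym. Qed.

(* [u'] stands for [u] in [K]. *)
Definition rep u u' := u' \in W /\
  ((u \in K /\ u' = u) \/
   [/\ u \in X :\: K, ttri u, u' \in N /\ ttri u', untouched u' & forall b, b \in K -> e u b = f u' b]).

Lemma W_K u : u \in W -> u \in K. Proof. by case/WP=> ? [? []]. Qed.

(** Two discarded vertices that lie in triangles are nonadjacent by [P1], and the same holds for
    their untouched representatives. *)
Lemma rep_edge u v u' v' : rep u u' -> rep v v' -> g u v = f u' v'.
Proof.
case=> u'W ru [v'W rv]; have [u'K v'K] := (W_K u'W, W_K v'W).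
case: ru => [[uK Eu]|[uX tu [u'N tu'] uu' Eu]].
  case: rv => [[vK Ev]|[vX tv [v'N tv'] uv' Ev]]; first by rewrite /g uK vK Eu Ev.
  have vK : (v \in K) = false by move: vX; rewrite in_setD => /andP[/negbTE].
  by rewrite /g vK andbF Eu sym Ev // fsym.
have uK : (u \in K) = false by move: uX; rewrite in_setD => /andP[/negbTE].
case: rv => [[vK Ev]|[vX tv [v'N tv'] uv' Ev]]; first by rewrite /g uK Ev Eu.
by rewrite /g uK uu' // (N_isolated (outN uX) tu (outN vX)) (N_isolated u'N tu' v'N).
Qed.

Definition hat u := exists u', rep u u'.

Lemma W_hat u : u \in W -> hat u.
Proof. by move=> uW; exists u; split=> //; left; split=> //; apply: W_K. Qed.

Lemma hat_closed u v : hat u -> u \in X -> v \in X -> g u v -> hat v.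
Proof.
case=> u' [u'W ru] uX vX guv.
case vK: (v \in K).
  apply: W_hat; case: ru => [[uK Eu]|[uXK tu _ uu' Eu]].
    by rewrite Eu in u'W; move: guv; rewrite /g uK vK /=; apply: (W_closed sol u'W).
  have uK : (u \in K) = false by move: uXK; rewrite in_setD => /andP[/negbTE].
  by move: guv; rewrite /g uK /= Eu //; apply: (W_closed sol u'W).
have vXK : v \in X :\: K by rewrite in_setD vK.
move: guv; rewrite /g vK andbF; case: ru => [[uK Eu]|[uXK tu _ _ _]]; last first.
  by rewrite (N_isolated (outN uXK) tu (outN vXK)).
rewrite Eu sym in u'W * => evu.
have [y [yN yW uy ty Ey]] := attached_twin vXK u'W evu.
exists y; split=> //; right; split=> //.
by apply: contraT => ntv; case: (nt_no_neighbor vXK ntv u'W evu).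
Qed.

(** If [b] and [c] are adjacent in [e], [P2] puts them in the core, and an untouched kept vertex
    seeing both places them in a triangle of [f]. Otherwise [bc] is an addition, and additions meet
    [W]. *)
Lemma no_new_triangle x b c : x \in X :\: K -> b \in X -> c \in X -> tri g x b c -> hat b.
Proof.
move=> xXK bX cX /and3P[xb bc xc]; have xN := outN xXK.
have xK : (x \in K) = false by move: xXK; rewrite in_setD => /andP[/negbTE].
have exb : e x b by move: xb; rewrite /g xK.
have exc : e x c by move: xc; rewrite /g xK.
case ebc: (e b c).
  have t : tri e x b c by rewrite /tri exb ebc exc.
  have [bA cA bcS] := P2 xN bX cX t; have [bK cK] := (A_K bA, A_K cA).
  have [y [yK uy eyb eyc]] : exists y, [/\ y \in K, untouched y, e y b & e y c].
    case/orP: bcS => sS.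
      have [y yQ uy] := ex_untouched (M3 sS bA cA xXK) (NK_sub _).
      move: yQ; rewrite inE exb exc => /and3P[/in_NK[_ yK _] /eqP ys /eqP yb].
      by exists y.
    have [y yQ uy] := ex_untouched (M3 sS cA bA xXK) (NK_sub _).
    move: yQ; rewrite inE exb exc => /and3P[/in_NK[_ yK _] /eqP ys /eqP yb].
    by exists y.
  apply: W_hat; apply/WP; exists c, y; split=> //.
  move: bc; rewrite /g bK cK /= /tri => ->.
  by rewrite (fsym c) (fsym b) !uy // eyb eyc.
have [bK cK] : b \in K /\ c \in K by move: bc; rewrite /g; case: ifP => [/andP[]|]; rewrite ?ebc.
have fbc : f b c by move: bc; rewrite /g bK cK.
case bW: (b \in W); first exact: W_hat.
case cW: (c \in W); first by apply: W_hat; apply: (W_closed sol cW bK); rewrite fsym.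
by have := no_adds_outside sym irr sol minimal bK cK (negbT bW) (negbT cW) fbc; rewrite ebc.
Qed.

(** The triangle of a paw has a vertex in [hat], which is closed under adjacency, so all four
    vertices have representatives; these would form a paw of [f]. *)
Lemma g_pawfree : pawfree_on X g.
Proof.
move=> a b c d aX bX cX dX; apply/negP => pw.
case/and5P: (pw) => ab bc ac cd _.
have hb_all : hat b -> False.
  move=> hb.
  have ha : hat a by apply: (hat_closed hb bX aX); rewrite gsym.
  have hc : hat c by apply: (hat_closed hb bX cX).
  have hd : hat d by apply: (hat_closed hc cX dX).
  case: ha hb hc hd => [a' ra] [b' rb] [c' rc] [d' rd].
  move: pw; rewrite /paw (rep_edge ra rb) (rep_edge rb rc) (rep_edge ra rc) (rep_edge rc rd).
  rewrite (rep_edge ra rd) (rep_edge rb rd); apply/negP; apply: fpf; apply: W_K.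
  - by case: ra.
  - by case: rb.
  - by case: rc.
  - by case: rd.
have inXK u : u \in X -> (u \in K) = false -> u \in X :\: K by rewrite in_setD => -> ->.
case aK: (a \in K); last first.
  by apply/hb_all/(no_new_triangle (inXK _ aX aK) bX cX); rewrite /tri ab bc ac.
case cK: (c \in K); last first.
  by apply/hb_all/(no_new_triangle (inXK _ cX cK) bX aX); rewrite /tri !(gsym c) bc gsym ab ac.
case bK: (b \in K); last first.
  apply: hb_all; apply: (hat_closed _ cX bX); last by rewrite gsym.
  by apply: (no_new_triangle (inXK _ bX bK) cX aX); rewrite /tri bc !(gsym _ a) ac ab.
apply: hb_all; apply: W_hat; apply/WP; exists a, c; split=> //.
by move: ab bc ac; rewrite /g aK bK cK /= /tri (fsym b a) => -> -> ->.
Qed.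

Lemma g_yes : yes e X k.
Proof.
exists g; split=> //; first by move=> u; rewrite /g irr firr; case: ifP.
  exact: g_pawfree.
have [_ _ _ le_k] := sol; apply: leq_trans le_k; apply: subset_leq_card.
apply/subsetP => -[u v]; rewrite !inE /= /g => /and3P[_ _].
by case: ifP => [/andP[-> ->]|]; rewrite ?eqxx.
Qed.

End Extension.

Lemma extension (T : finType) (e : rel T) (S A K X : {set T}) (k : nat) (N := X :\: A) :
  symmetric e -> irreflexive e -> A \subset K -> K \subset X ->
  (forall x y, x \in N -> y \in N -> e x y -> ~~ tri_in e X x) ->
  (forall x b c, x \in N -> b \in X -> c \in X -> tri e x b c ->
     [/\ b \in A, c \in A & (b \in S) || (c \in S)]) ->
  (forall a x, a \in A -> x \in X :\: K -> e x a -> ~~ tri_in e X x ->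
     k.*2 < #|[set y in N :&: K | ~~ tri_in e X y && e y a]|) ->
  (forall a z x, a \in A -> z \in N :&: K -> ~~ tri_in e X z -> e z a ->
     x \in X :\: K -> e x z ->
     k.*2 < #|[set y in N :&: K | ~~ tri_in e X y && e y a]| \/
     k.*2 < #|[set y in N :&: K | e y z]|) ->
  (forall s b x, s \in S -> s \in A -> b \in A -> x \in X :\: K ->
     k.*2 < #|[set y in N :&: K | (e y s == e x s) && (e y b == e x b)]|) ->
  yes e K k -> yes e X k.
Proof.
move=> sym irr sAK sKX P1 P2 M1 M2 M3 y.
have [f sol minimal] := @ex_min (rel T) (solution e K k) (fun g => #|diff e g K| + #|adds e K g|) y.
exact: (g_yes (f := f) sym irr sAK sKX P1 P2 M1 M2 M3 sol minimal).
Qed.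

(** * Reduction of false twins and of multipartite components *)

Section Reductions.
Variables (n : nat) (e : rel 'I_n) (k : nat).
Hypotheses (sym : symmetric e) (irr : irreflexive e).
Implicit Types (u v w : 'I_n) (Y Z U E : {set 'I_n}).

Definition ft u v := [forall w, e w u == e w v].

Lemma ftP u v : reflect (forall w, e w u = e w v) (ft u v).
Proof. by apply: (iffP forallP) => h w; apply/eqP; have := h w; [|move->]. Qed.

Lemma ftxx u : ft u u. Proof. exact/ftP. Qed.

Lemma ftC u v : ft u v = ft v u.
Proof. by apply/ftP/ftP => h w; rewrite h. Qed.

Lemma ft_trans : transitive ft.
Proof. by move=> v u w /ftP h1 /ftP h2; apply/ftP => x; rewrite h1. Qed.

Lemma ft_nadj u v : ft u v -> e u v = false.
Proof. by move/ftP <-; rewrite irr. Qed.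

Definition leader u := [forall v : 'I_n, ~~ ((v < u) && ft v u)].

(** After identifying false twins, [u] and [v] are true twins: their classes are two parts with the
    same neighbors elsewhere. *)
Definition ap u v := e u v && [forall w, (e w u != e w v) ==> (ft w u || ft w v)].

Lemma apP u v : reflect (e u v /\ forall w, e w u != e w v -> ft w u || ft w v) (ap u v).
Proof.
apply: (iffP andP) => -[euv h]; split=> //; first by move=> w; apply/implyP/(forallP h).
by apply/forallP => w; apply/implyP/h.
Qed.

Lemma untouched_ex f Z U j : #|diff e f Z| <= k.*2 -> U \subset Z -> k.*2 + j < #|U| ->
  exists2 u, u \in U & forall v, v \in Z -> f u v = e u v.
Proof.
move=> le_k sUZ lt_k; pose touched := [set p.1 | p in diff e f Z].
have /subsetPn[y yU yt] : ~~ (U \subset touched).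
  apply/negP => /subset_leq_card; rewrite leqNgt (leq_ltn_trans (leq_imset_card _ _)) //.
  by apply: leq_ltn_trans le_k _; apply: leq_ltn_trans lt_k; apply: leq_addr.
exists y => // v vZ; apply/eqP; rewrite eq_sym; apply: contraR yt => ne.
by apply/imsetP; exists (y, v); rewrite // inE (subsetP sUZ) ?vZ.
Qed.

(** [w] copies the row of an untouched false twin in [f], which costs no edit and creates no paw. *)
Lemma add_twin Z U w : w \notin Z -> U \subset Z -> (forall u, u \in U -> ft u w) ->
  k.*2 < #|U| -> yes e Z k -> yes e (w |: Z) k.
Proof.
move=> wZ sUZ ftU ltU [f [fs fi fp le_k]].
have [|u uU uu] := @untouched_ex f Z U 0 le_k sUZ; first by rewrite addn0.
have uZ := subsetP sUZ u uU; have /ftP uw := ftU u uU.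
pose phi a := if a == w then u else a.
have phiZ a : a \in w |: Z -> phi a \in Z.
  by rewrite /phi in_setU1; case: eqP.
exists (fun a b => f (phi a) (phi b)); split.
- by move=> a b; rewrite fs.
- by move=> a; rewrite fi.
- by move=> a b c d /phiZ aZ /phiZ bZ /phiZ cZ /phiZ dZ; apply: fp aZ bZ cZ dZ.
apply: leq_trans le_k; apply/subset_leq_card/subsetP => -[a b]; rewrite !inE /= /phi.
case: (a =P w) => [->|_] /=; last first.
  case: (b =P w) => [->|_] //=; case/andP=> aZ.
  by rewrite fs uu // (sym u) uw eqxx.
case: (b =P w) => [->|_] /=; first by rewrite irr fi.
by case/andP=> bZ; rewrite uu // (sym w) -uw (sym b) eqxx.
Qed.

(** Three vertices of [U] are untouched, which is why two more than [k.*2] are required; they span a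
    triangle of [f]. Away from the false twins of [w], the component of this triangle is exactly the
    neighborhood of [w], so the twin class of [w] fits in as one more part. *)
Lemma add_part Z U w : w \notin Z -> U \subset Z -> (forall u, u \in U -> ap u w) ->
  {in U &, forall u v, u != v -> e u v} -> k.*2 + 2 < #|U| ->
  yes e Z k -> yes e (w |: Z) k.
Proof.
move=> wZ sUZ apU clU ltU [f [fs fi fp le_k]].
have [u1 u1U uu1] := untouched_ex le_k sUZ ltU.
have ltU1 : k.*2 + 1 < #|U :\ u1| by move: ltU; rewrite (cardsD1 u1) u1U; lia.
have [u2 u2U' uu2] := untouched_ex le_k (subset_trans (subsetDl U [set u1]) sUZ) ltU1.
have [u21 u2U] : u2 != u1 /\ u2 \in U by apply/andP; rewrite -in_setD1.
have ltU2 : k.*2 + 0 < #|(U :\ u1) :\ u2| by move: ltU1; rewrite (cardsD1 u2) u2U'; lia.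
have sU2 : (U :\ u1) :\ u2 \subset Z.
  exact: subset_trans (subsetDl _ _) (subset_trans (subsetDl _ _) sUZ).
have [u3 u3U' uu3] := untouched_ex le_k sU2 ltU2.
have [u32 u3U''] : u3 != u2 /\ u3 \in U :\ u1 by apply/andP; rewrite -in_setD1.
have [u31 u3U] : u3 != u1 /\ u3 \in U by apply/andP; rewrite -in_setD1.
pose P := [set v | ft v w]; pose Z' := Z :\: P.
have UZ' u : u \in U -> u \in Z'.
  move=> uU; rewrite in_setD (subsetP sUZ) // andbT inE; apply/negP => /ft_nadj.
  by case/apP: (apU u uU) => ->.
have Z'Z v : v \in Z' -> v \in Z by rewrite in_setD => /andP[].
have t : tri f u1 u2 u3.
  by rewrite /tri uu1 ?uu2 ?uu1 ?(subsetP sUZ) // !clU // 1?eq_sym.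
have fp' : pawfree_on Z' f by apply: pawfree_sub fp; apply: subsetDl.
have [z1 [z2 z3]] := (UZ' _ u1U, (UZ' _ u2U, UZ' _ u3U)).
set D := tcomp f Z' u1 u2 u3.
have DZ' v : v \in D -> v \in Z' by apply: comp_sub.
have fe u v : u \in U -> (forall v, v \in Z -> f u v = e u v) -> v \in Z' -> f v u = e v u.
  by move=> uU uu /Z'Z vZ; rewrite fs uu // sym.
have wD v : v \in Z' -> e w v = (v \in D).
  move=> vZ'; have vP : ~~ ft v w by move: vZ'; rewrite !inE => /andP[].
  apply/idP/idP => [ewv|vD].
    rewrite inE vZ' !fe //=; case ev1: (e v u1) => //=.
    case/apP: (apU _ u1U) => _ /(_ v); rewrite ev1 (sym v w) ewv (negbTE vP) orbF => /(_ isT).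
    by move/ftP/(_ u2); rewrite sym => ->; rewrite clU.
  move: vD; rewrite inE vZ' !fe //= => ev.
  have [u uU evu] : exists2 u, u \in U & e v u.
    by case/or3P: ev => h; [exists u1|exists u2|exists u3].
  case/apP: (apU _ uU) => _ /(_ v); rewrite evu (negbTE vP) orbF (sym v w).
  by case: (e w v) => // /(_ isT) /ft_nadj; rewrite evu.
(* Original edges are restored at all false twins of [w], so no edit is added. *)
pose g a b := if (a \in P) || (b \in P) then e a b else f a b.
have gs : symmetric g by move=> a b; rewrite /g orbC sym fs.
pose DP := [pred x | (x \in w |: Z) && ((x \in P) || (x \in D))].
have inZ' x : x \in w |: Z -> x \notin P -> x \in Z'.
  rewrite in_setU1 => /orP[/eqP->|xZ] xP; first by rewrite inE ftxx in xP.
  by rewrite in_setD xP.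
have DnP x : x \in D -> x \notin P by move/DZ'; rewrite in_setD => /andP[].
have Pw x : x \in P -> forall y, e y x = e y w by rewrite inE => /ftP.
have gPD x y : x \in P -> y \in D -> g x y.
  by move=> xP yD; rewrite /g xP sym (Pw x xP) sym wD // DZ'.
have gPP x y : x \in P -> y \in P -> g x y = false.
  move=> xP yP; rewrite /g xP; move: xP yP; rewrite !inE => xw; rewrite ftC => wy.
  exact: ft_nadj (ft_trans xw wy).
have gDD x y : x \in D -> y \in D -> g x y = f x y.
  by move=> /DnP/negbTE xP /DnP/negbTE yP; rewrite /g xP yP.
have closed x y : DP x -> y \in w |: Z -> g x y -> DP y.
  case/andP=> xZ xPD yZ gxy; rewrite /DP /= yZ /=; case yP: (y \in P) => //=.
  have yZ' := inZ' y yZ (negbT yP); case/orP: xPD => xPD.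
    by move: gxy; rewrite /g xPD sym (Pw x xPD) sym wD.
  move: gxy; rewrite /g yP (negbTE (DnP _ xPD)) /=.
  exact: (comp_closed fs fp' z1 z2 z3 t).
have multi x y z : DP x -> DP y -> DP z -> ~~ g x y -> ~~ g y z -> ~~ g x z.
  case/andP=> _ /orP[xP|xD] /andP[_ /orP[yP|yD]] /andP[_ /orP[zP|zD]] xy yz.
  - by rewrite gPP.
  - by rewrite gPD in yz.
  - by rewrite gPD in xy.
  - by rewrite gPD in xy.
  - by rewrite gs gPD in xy.
  - by rewrite gs gPD in xy.
  - by rewrite gs gPD in yz.
  rewrite !gDD // in xy yz *.
  exact: (comp_multi fs fp' z1 z2 z3 t xD yD zD).
exists g; split=> //.
- by move=> a; rewrite /g irr fi; case: ifP.
- move=> a b c d aZ bZ cZ dZ; apply/negP => pw; case/and5P: (pw) => ab bc ac cd /andP[ad bd].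
  case DPa: (DP a).
    have DPb := closed _ _ DPa bZ ab; have DPd := closed _ _ (closed _ _ DPa cZ ac) dZ cd.
    by move: (multi a d b DPa DPd DPb ad); rewrite gs bd ab => /(_ isT).
  have DPb : DP b = false by apply: contraFF DPa => h; apply: closed h aZ _; rewrite gs.
  have DPc : DP c = false by apply: contraFF DPa => h; apply: closed h aZ _; rewrite gs.
  have DPd : DP d = false by apply: contraFF DPc => h; apply: closed h cZ _; rewrite gs.
  have nP x : x \in w |: Z -> DP x = false -> x \notin P.
    by rewrite /DP /= => ->; case: (x \in P).
  have aP := nP _ aZ DPa; have bP := nP _ bZ DPb; have cP := nP _ cZ DPc; have dP := nP _ dZ DPd.
  move: pw; rewrite /paw /g (negbTE aP) (negbTE bP) (negbTE cP) (negbTE dP) /=; apply/negP.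
  by apply: fp'; apply: inZ'.
apply: leq_trans le_k; apply/subset_leq_card/subsetP => -[a b].
rewrite ![_ \in diff _ _ _]in_set /= /g => /and3P[aZ bZ].
case: ifP => [_|/negbT]; first by rewrite eqxx.
by rewrite negb_or => /andP[aP bP] ->; rewrite !Z'Z ?inZ'.
Qed.

(** Vertices return in increasing order. What justified the removal of [w] are smaller vertices, and
    these are present by then. *)
Lemma yes_chain Y E : (forall w Z, w \in E -> w \notin Z -> Y \subset Z ->
    (forall u, u \in E -> u < w -> u \in Z) -> yes e Z k -> yes e (w |: Z) k) ->
  yes e Y k -> yes e (Y :|: E) k.
Proof.
move=> step yY; suff gen i : yes e (Y :|: [set u : 'I_n in E | u < i]) k.
  by have := gen n; congr (yes e _ k); apply/setP => u; rewrite !inE ltn_ord andbT.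
elim: i => [|i IH].
  by move: yY; congr (yes e _ k); apply/setP => u; rewrite !inE andbF orbF.
set Z := _ :|: _ in IH *.
have [lt_i|ge_i] := ltnP i n; last first.
  move: IH; congr (yes e _ k); apply/setP => u; rewrite !inE ltnS.
  by have := ltn_ord u; case: (ltngtP u i) => //; lia.
pose w := Ordinal lt_i.
have ZS : Y :|: [set u : 'I_n in E | u < i.+1] = if w \in E then w |: Z else Z.
  have ltS u : (u < i.+1) = (u == w) || (u < i) by rewrite ltnS leq_eqVlt.
  case wE: (w \in E); apply/setP => u; rewrite !inE ltS; case: (u =P w) => [->|_] //=.
    by rewrite wE orbT.
  by rewrite wE.
rewrite ZS; case: ifP => // wE; case: (boolP (w \in Z)) => wZ.
  by rewrite (setUidPr _) // sub1set.
apply: step => //; first exact: subsetUl.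
by move=> u uE lt_u; rewrite !inE uE lt_u orbT.
Qed.

Variables (S : {set 'I_n}) (m : nat).
Hypothesis pawS : forall a b c d, paw e a b c d ->
  1 < (a \in S) + (b \in S) + (c \in S) + (d \in S).
Hypothesis mk : k.*2 + 2 <= m.

Definition savoid x y z := [&& x \notin S, y \notin S, z \notin S & tri e x y z].

(* [E0] drops the triangle components out of reach of [S]; [E1] and [E2] keep
   [m + 1] false twins of each class and [m + 1] parts of each component. *)
Definition E0 x := [exists y, exists z, savoid x y z &&
  [forall s, (s \in S) ==> ~~ [|| e s x, e s y | e s z]]].
Definition E1 v := m < #|[pred u : 'I_n | (u < v) && ft u v]|.
Definition E2 v := m < #|[pred u : 'I_n | [&& u < v, leader u & ap u v]]|.
Definition reduced : {set 'I_n} := [set v | [&& ~~ E0 v, ~~ E1 v & ~~ E2 v]].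

Lemma pawfree_outside : pawfree_on (~: S) e.
Proof.
move=> a b c d; rewrite !inE => aS bS cS dS; apply/negP => /pawS.
by rewrite (negbTE aS) (negbTE bS) (negbTE cS) (negbTE dS).
Qed.

(** A paw has two vertices in [S], and only one vertex of [S] is present. This lets Olariu's
    structure be used together with any single vertex [s], which may lie inside or outside [S]. *)
Lemma pawfree_one s : pawfree_on (s |: ~: S) e.
Proof.
move=> a b c d aY bY cY dY; apply/negP => pw; have := pawS pw.
have uniq1 x y : x \in s |: ~: S -> y \in s |: ~: S -> x \in S -> y \in S -> x = y.
  by rewrite !inE => /orP[/eqP->|/negP//] /orP[/eqP->|/negP//].
have D x y : e x y -> x == y = false by case: eqP => // ->; rewrite irr.
case/and5P: pw => ab bc ac cd /andP[ad bd].
have ad' : (a == d) = false by apply: contraNF bd => /eqP <-; rewrite sym.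
have bd' : (b == d) = false by apply: contraNF ad => /eqP <-.
move: (uniq1 a b aY bY) (uniq1 b c bY cY) (uniq1 a c aY cY) (uniq1 c d cY dY)
  (uniq1 a d aY dY) (uniq1 b d bY dY).
case: (a \in S) (b \in S) (c \in S) (d \in S) => [] [] [] [] //= h1 h2 h3 h4 h5 h6.
all: try by have := D _ _ ab; rewrite h1 // eqxx.
all: try by have := D _ _ bc; rewrite h2 // eqxx.
all: try by have := D _ _ ac; rewrite h3 // eqxx.
all: try by have := D _ _ cd; rewrite h4 // eqxx.
all: try by have := ad'; rewrite h5 // eqxx.
all: by have := bd'; rewrite h6 // eqxx.
Qed.

Lemma E0P x : reflect (exists y z, savoid x y z /\
    forall s, s \in S -> ~~ [|| e s x, e s y | e s z]) (E0 x).
Proof.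
apply: (iffP existsP) => -[y].
  by case/existsP=> z /andP[sa /forallP h]; exists y, z; split=> // s; apply/implyP.
case=> z [sa h]; exists y; apply/existsP; exists z; rewrite sa /=.
by apply/forallP => s; apply/implyP/h.
Qed.

(** [v] sees a second vertex [a] of the triangle of [u]. A vertex [s] of [S] seeing [v] would have
    to see [u] or [a], as [s] together with the vertices outside [S] spans no paw. *)
Lemma E0_closed u v : E0 u -> e u v -> E0 v.
Proof.
case/E0P=> y [z [/and4P[uS yS zS t] noS]] euv.
have vS : v \notin S by apply/negP => /noS; rewrite sym euv.
have inC x : x \notin S -> x \in ~: S by rewrite inE.
have dom a : a \notin S -> tri e v u a -> (forall s, s \in S -> ~~ [|| e s u | e s a]) -> E0 v.
  move=> aS ta noS'; apply/E0P; exists u, a; split; first by rewrite /savoid vS uS aS.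
  move=> s sS; have := noS' s sS; rewrite !negb_or => /andP[su sa]; rewrite su sa !andbT.
  apply/negP => sv; have := @tri_two _ e (s |: ~: S) sym (@pawfree_one s) v u a s.
  by rewrite !in_setU1 eqxx !inE vS uS aS !orbT (negbTE su) (negbTE sa) => /(_ isT isT isT isT ta sv).
have := tri_two sym pawfree_outside (inC _ uS) (inC _ yS) (inC _ zS) (inC _ vS) t.
rewrite sym euv => /(_ isT); case/and3P: t => uy yz uz.
case/orP=> [vy|vz].
  by apply: (dom y yS); [rewrite /tri sym euv uy vy|move=> s /noS; rewrite !negb_or => /and3P[-> ->]].
by apply: (dom z zS); [rewrite /tri sym euv uz vz|move=> s /noS; rewrite !negb_or => /and3P[-> _ ->]].
Qed.

(** The removed vertices form components that avoid [S], so they are paw-free and may stay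
    unedited. *)
Lemma yes_E0 Z : yes e [set v in Z | ~~ E0 v] k -> yes e Z k.
Proof.
case=> f [fs fi fp le_k].
pose g a b := if E0 a || E0 b then e a b else f a b.
have gs : symmetric g by move=> a b; rewrite /g orbC sym fs.
have closed a b : E0 a -> g a b -> E0 b by rewrite /g => Ea; rewrite Ea; apply: E0_closed.
exists g; split=> //; first by move=> a; rewrite /g irr fi; case: ifP.
  move=> a b c d aZ bZ cZ dZ; apply/negP => pw; case/and5P: (pw) => ab bc ac cd _.
  have E0S x : E0 x -> x \in ~: S by case/E0P=> y [z [/and4P[xS _ _ _] _]]; rewrite inE.
  case Ea: (E0 a).
    have Eb := closed _ _ Ea ab; have Ec := closed _ _ Ea ac; have Ed := closed _ _ Ec cd.
    move: pw; rewrite /paw /g Ea Eb Ec Ed /=; apply/negP.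
    by apply: pawfree_outside; apply: E0S.
  have Eb : E0 b = false by apply: contraFF Ea => h; apply: closed h _; rewrite gs.
  have Ec : E0 c = false by apply: contraFF Ea => h; apply: closed h _; rewrite gs.
  have Ed : E0 d = false by apply: contraFF Ec => h; apply: closed h _; rewrite gs.
  move: pw; rewrite /paw /g Ea Eb Ec Ed /=; apply/negP.
  by apply: fp; rewrite inE ?aZ ?bZ ?cZ ?dZ ?Ea ?Eb ?Ec ?Ed.
apply: leq_trans le_k; apply/subset_leq_card/subsetP => -[a b]; rewrite !inE /= /g.
case: ifP => [_|/negbT]; first by rewrite eqxx !andbF.
by rewrite negb_or => /andP[-> ->] /and3P[-> -> ->].
Qed.

Lemma leader_E1 u : leader u -> E1 u = false.
Proof.
move/forallP => ru; rewrite /E1; apply: negbTE; rewrite -leqNgt.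
by rewrite eq_card0 // => v; rewrite inE; apply: negbTE (ru v).
Qed.

(** Components come back first, then parts, then twins. Parts are counted by leaders, which the twin
    rule never removes, so they are available when a part is restored. *)
Lemma reduced_yes : yes e reduced k -> yes e setT k.
Proof.
move=> yX.
pose Y1 := [set v | ~~ E1 v]; pose Y2 := [set v | ~~ E1 v && ~~ E2 v].
have y2 : yes e Y2 k.
  by apply: yes_E0; move: yX; congr (yes e _ k); apply/setP => v; rewrite !inE andbC.
have y1 : yes e Y1 k.
  have -> : Y1 = Y2 :|: [set v | E2 v && ~~ E1 v].
    by apply/setP => v; rewrite !inE; case: (E1 v) (E2 v) => [] [].
  apply: yes_chain y2 => w Z; rewrite inE => /andP[E2w E1w] wZ sYZ ltZ.
  set U := [pred u : 'I_n | [&& u < w, leader u & ap u w]] in E2w.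
  have UE u : (u \in [set u in U]) = [&& u < w, leader u & ap u w] by rewrite inE.
  apply: (@add_part Z [set u in U] w wZ).
  - apply/subsetP => u; rewrite UE => /and3P[lt_u ru _].
    case E2u: (E2 u); first by apply: ltZ => //; rewrite inE E2u leader_E1.
    by apply: (subsetP sYZ); rewrite inE leader_E1 ?E2u.
  - by move=> u; rewrite UE => /and3P[].
  (* Nonadjacent leaders attached to [w] by [ap] would be false twins, but a class has only one
     leader. *)
  - move=> u v; rewrite !UE => /and3P[_ ru /apP[uw _]] /and3P[_ rv /apP[vw h]] uv.
    apply: contraT => euv; have := h u; rewrite (negbTE euv) uw => /(_ isT).
    case/orP=> [|/ft_nadj]; last by rewrite uw.
    move=> fuv; case: (ltngtP u v) => [lt_uv|lt_vu|/val_inj eq_uv].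
    + by have := forallP rv u; rewrite lt_uv fuv.
    + by have := forallP ru v; rewrite lt_vu ftC fuv.
    + by rewrite eq_uv eqxx in uv.
  - by rewrite cardsE; apply: leq_ltn_trans mk E2w.
have -> : setT = Y1 :|: [set v | E1 v] by apply/setP => v; rewrite !inE orNb.
apply: yes_chain y1 => w Z; rewrite inE => E1w wZ sYZ ltZ.
set U := [pred u : 'I_n | (u < w) && ft u w] in E1w.
have UE u : (u \in [set u in U]) = (u < w) && ft u w by rewrite inE.
apply: (@add_twin Z [set u in U] w wZ).
- apply/subsetP => u; rewrite UE => /andP[lt_u _].
  case E1u: (E1 u); first by apply: ltZ; rewrite // inE.
  by apply: (subsetP sYZ); rewrite inE E1u.
- by move=> u; rewrite UE => /andP[].
- by rewrite cardsE; apply: leq_ltn_trans E1w; lia.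
Qed.

End Reductions.

(** * The kernel *)

Lemma card_cover (I T : finType) (P : {set I}) (F : I -> {set T}) (B : {set T}) c :
  (forall i, i \in P -> #|F i| <= c) ->
  (forall x, x \in B -> exists2 i, i \in P & x \in F i) -> #|B| <= #|P| * c.
Proof.
move=> leF covB; rewrite -sum_nat_const.
apply: (@leq_trans (\sum_(i in P) #|F i|)); last exact: leq_sum.
apply: (@leq_trans #|\bigcup_(i in P) F i|).
  by apply/subset_leq_card/subsetP => x /covB[i iP xF]; apply/bigcupP; exists i.
elim/big_rec2: _ => [|i s U _ le_U]; first by rewrite cards0.
by apply: leq_trans (leq_card_setU _ _) _; rewrite leq_add2l.
Qed.

(** * The first [m + 1] vertices with a given property *)

Section First.
Variables (n m : nat).
Implicit Types (phi : pred 'I_n) (x y : 'I_n).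

Definition rank phi x := #|[pred y : 'I_n | (y < x) && phi y]|.
Definition first phi : {set 'I_n} := [set x | phi x && (rank phi x <= m)].

Lemma rank_lt phi x y : phi x -> x < y -> rank phi x < rank phi y.
Proof.
move=> px lt_xy; apply/proper_card/properP; split.
  by apply/subsetP => z; rewrite !inE => /andP[lt_z ->]; rewrite (ltn_trans lt_z).
by exists x; rewrite !inE ?px ?lt_xy // ltnn.
Qed.

Lemma first_le phi : #|first phi| <= m.+1.
Proof.
rewrite -[leqRHS](card_ord m.+1) -(@card_in_imset _ _ (fun x => inord (rank phi x) : 'I_m.+1)).
  exact: max_card.
move=> x y; rewrite !inE => /andP[px lex] /andP[py ley] /(congr1 val).
rewrite /= !inordK ?ltnS // => E; apply: val_inj => /=.
case: (ltngtP x y) => // lt_xy; [have := rank_lt px lt_xy|have := rank_lt py lt_xy];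
  by rewrite E ltnn.
Qed.

(** Take the least element of rank above [m]: the elements before it all have rank at most [m], and
    there are more than [m] of them. *)
Lemma first_many phi x : phi x -> m < rank phi x -> m < #|first phi|.
Proof.
move=> px lt_m.
have Qx : [pred z : 'I_n | phi z && (m < rank phi z)] x by rewrite /= px.
case: (arg_minnP (fun z : 'I_n => val z) Qx) => y /= /andP[py lt_y] miny.
apply: leq_trans lt_y _; apply: subset_leq_card; apply/subsetP => z.
rewrite !inE => /andP[lt_zy pz]; rewrite pz /= leqNgt; apply/negP => lt_z.
by have := miny z; rewrite /= pz lt_z => /(_ isT); rewrite leqNgt lt_zy.
Qed.

End First.

Section Marking.
Variables (n : nat) (e : rel 'I_n) (S H : {set 'I_n}) (m k : nat).
Hypotheses (sym : symmetric e) (irr : irreflexive e).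
Hypothesis pawS : forall a b c d, paw e a b c d ->
  1 < (a \in S) + (b \in S) + (c \in S) + (d \in S).
Let S' := S :|: H.
Hypothesis pawS' : forall a b c d, paw e a b c d ->
  2 < (a \in S') + (b \in S') + (c \in S') + (d \in S').
Hypothesis mk : k.*2 + 2 <= m.

Definition inT1 x := [exists y, exists z, savoid e S x y z].
Definition inT2 x := (x \notin S :|: H) &&
  [exists y, exists s, [&& y \notin S :|: H, s \in S :|: H & tri e x y s]].
Notation X := (reduced e S m).
Definition core : {set 'I_n} := [set x in X | [|| x \in S :|: H, inT1 x | inT2 x]].
Notation A := core.
Definition rest : {set 'I_n} := X :\: A.
Notation N := rest.
Notation nt x := (~~ tri_in e X x).

(* For each type of attachment to the core, the first [m + 1] vertices are kept,
   so that one of them is untouched by any solution. *)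
Definition mark1 x := [&& x \in N, nt x & [exists a, [&& a \in A, e x a &
  ~~ (m < #|[pred y : 'I_n | [&& y < x, y \in N, nt y & e y a]]|)]]].
Definition mark2 x := (x \in N) && [exists z, [&& mark1 z, e x z &
  ~~ (m < #|[pred y : 'I_n | [&& y < x, y \in N & e y z]]|)]].
Definition mark3 x := (x \in N) && [exists s, exists b, [&& s \in S, s \in A, b \in A &
  ~~ (m < #|[pred y : 'I_n | [&& y < x, y \in N, e y s == e x s & e y b == e x b]]|)]].
Definition kernel : {set 'I_n} := [set x | [|| x \in A, mark1 x, mark2 x | mark3 x]].

Lemma NP x : x \in N -> [/\ x \in X, x \notin S :|: H, ~~ inT1 x & ~~ inT2 x].
Proof.
rewrite in_setD [_ \in core]in_set => /andP[nA xX]; move: nA; rewrite xX /= !negb_or.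
by case/and3P.
Qed.

(** A triangle at [x] with at most one vertex in [S :|: H] puts [x] into the core. If [b] and [c]
    are both there, [y] sees neither, as [x], [y] and one of them would form a triangle of the
    second kind; then [b], [c], [x], [y] is a paw with only two vertices in [S :|: H]. *)
Lemma rest_isolated x y : x \in N -> y \in N -> e x y -> nt x.
Proof.
move=> /NP[xX xS nT1 nT2] /NP[yX yS _ _] exy; apply/negP => /tri_inP[b [c [bX cX t]]].
have T2 p q : p \notin S' -> q \in S' -> tri e x p q -> False.
  move=> pS qS tpq; case/negP: nT2; rewrite /inT2 xS; apply/existsP; exists p.
  by apply/existsP; exists q; rewrite pS qS.
case/and3P: (t) => xb bc xc.
have t' : tri e x c b by rewrite /tri xc (sym c) bc xb.
case bS: (b \in S'); case cS: (c \in S').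
- have yb : ~~ e y b.
    by apply/negP => yb; apply: (T2 y b) => //; rewrite /tri exy yb xb.
  have yc : ~~ e y c.
    by apply/negP => yc; apply: (T2 y c) => //; rewrite /tri exy yc xc.
  have := @pawS' b c x y; rewrite /paw bc (sym c x) xc (sym b x) xb exy (sym b y) yb (sym c y) yc.
  by rewrite bS cS -/S' (negbTE xS) (negbTE yS) => /(_ isT).
- by apply: (T2 c b) => //; rewrite cS.
- by apply: (T2 b c) => //; rewrite bS.
case/negP: nT1; apply/existsP; exists b; apply/existsP; exists c.
move: xS bS cS; rewrite /savoid /S' !inE t !negb_or => /andP[-> _] /norP[-> _] /norP[-> _].
by [].
Qed.

Lemma rest_triangle x b c : x \in N -> b \in X -> c \in X -> tri e x b c ->
  [/\ b \in A, c \in A & (b \in S) || (c \in S)].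
Proof.
move=> xN bX cX t; case/and3P: (t) => xb bc xc.
have tx : tri_in e X x by apply/tri_inP; exists b, c.
have inA y : y \in X -> e x y -> y \in A.
  move=> yX xy; apply: contraT => yA; have yN : y \in N by rewrite in_setD yA.
  by move: (rest_isolated xN yN xy); rewrite tx.
split; rewrite ?inA // -[_ || _]negbK negb_or; apply/negP => /andP[bS cS].
have [_ xS nT1 _] := NP xN; case/negP: nT1.
apply/existsP; exists b; apply/existsP; exists c.
by move: xS; rewrite /savoid bS cS t inE negb_or => /andP[->].
Qed.

Lemma many_marked (phi : pred 'I_n) (Q : {set 'I_n}) x : phi x ->
  m < #|[pred y : 'I_n | (y < x) && phi y]| -> first m phi \subset Q -> k.*2 < #|Q|.
Proof.
move=> px lt_m /subset_leq_card le_Q; have := first_many px lt_m; lia.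
Qed.

Lemma kernel_yes : yes e kernel k -> yes e X k.
Proof.
have NX x : x \in N -> x \in X by rewrite in_setD => /andP[].
have markX x : x \in kernel -> x \in X.
  rewrite inE => /or4P[|/and3P[/NX]|/andP[/NX]|/andP[/NX]] //.
  by rewrite inE => /andP[].
have sAK : A \subset kernel by apply/subsetP => x xA; rewrite inE xA.
have outP x : x \in X :\: kernel -> [/\ x \in N, ~~ mark1 x, ~~ mark2 x & ~~ mark3 x].
  rewrite in_setD [_ \in kernel]in_set !negb_or => /andP[/and4P[xA -> -> ->] xX].
  by split=> //; rewrite in_setD xA.
have nm1 a z : a \in A -> z \in N -> nt z -> e z a -> ~~ mark1 z ->
    k.*2 < #|[set y in N :&: kernel | nt y && e y a]|.
  move=> aA zN ntz eza nz; apply: (@many_marked (fun y => [&& y \in N, nt y & e y a]) _ z).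
  - by rewrite zN ntz.
  - rewrite -[_ < _]negbK; apply: contra nz => nz; rewrite /mark1 zN ntz.
    by apply/existsP; exists a; rewrite aA eza.
  apply/subsetP => y; rewrite inE => /andP[/and3P[yN nty eya] le_y].
  rewrite inE nty eya inE yN inE /mark1 yN nty /=.
  by rewrite (_ : [exists a, _]) ?orbT //; apply/existsP; exists a; rewrite aA eya -leqNgt.
apply: (@extension _ e S A) => //.
- by apply/subsetP => x /markX.
- exact: rest_isolated.
- exact: rest_triangle.
- by move=> a x aA /outP[xN n1 _ _] exa ntx; apply: nm1 n1.
- move=> a z x aA zNK ntz eza /outP[xN _ n2 _] exz.
  have zN : z \in N by move: zNK; rewrite inE => /andP[].
  case m1: (mark1 z); last by left; apply: (nm1 a z); rewrite ?m1.
  right; apply: (@many_marked (fun y => (y \in N) && e y z) _ x); first by rewrite xN.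
    rewrite -[_ < _]negbK; apply: contra n2 => n2; rewrite /mark2 xN.
    by apply/existsP; exists z; rewrite m1 exz.
  apply/subsetP => y; rewrite inE => /andP[/andP[yN eyz] le_y].
  rewrite inE eyz inE yN inE /mark2 yN /= andbT.
  by rewrite (_ : [exists z, _]) ?orbT //; apply/existsP; exists z; rewrite m1 eyz -leqNgt.
move=> s b x sS sA bA /outP[xN _ _ n3].
apply: (@many_marked (fun y => [&& y \in N, e y s == e x s & e y b == e x b]) _ x).
- by rewrite xN !eqxx.
- rewrite -[_ < _]negbK; apply: contra n3 => n3; rewrite /mark3 xN.
  by apply/existsP; exists s; apply/existsP; exists b; rewrite sS sA bA.
apply/subsetP => y; rewrite inE => /andP[/and3P[yN /eqP eys /eqP eyb] le_y].
rewrite inE eys eyb !eqxx inE yN inE /mark3 yN /=.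
rewrite (_ : [exists s, _]) ?orbT //; apply/existsP; exists s; apply/existsP; exists b.
by rewrite sS sA bA eys eyb -leqNgt.
Qed.

(** * Bounds on the core and the kernel *)

Lemma class_le w : #|[set v in X | ft e v w]| <= m.+1.
Proof.
apply: leq_trans (first_le m (fun v => ft e v w)); apply/subset_leq_card/subsetP => v.
rewrite !inE => /andP[/and3P[_ nE1 _] fvw]; rewrite fvw leqNgt; apply: contra nE1.
rewrite /E1 /rank; congr (_ < _); apply: eq_card => u; rewrite !inE; congr (_ && _).
apply/idP/idP => h; first by apply: ft_trans h _; rewrite ftC.
exact: ft_trans h fvw.
Qed.

Lemma twin_half u v p q g : u \notin S -> v \notin S -> p \notin S -> q \notin S ->
  tri e u p q -> tri e v p q -> ~~ e u v -> e g u -> e g v.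
Proof.
move=> uS vS pS qS tu tv uv gu; case/and3P: (tu) => up pq uq; case/and3P: (tv) => vp _ vq.
have inY x : x \notin S -> x \in g |: ~: S by rewrite !inE => ->; rewrite orbT.
have gY : g \in g |: ~: S by rewrite !inE eqxx.
have pf := pawfree_one sym irr pawS (s := g).
have key r : r \notin S -> e u r -> e v r -> e g r -> e g v.
  move=> rS ur vr gr; apply: contraT => gv.
  have := pf g u r v gY (inY _ uS) (inY _ rS) (inY _ vS).
  by rewrite /paw gu ur gr (sym r v) vr gv uv.
have /orP[gp|gq] := tri_two sym pf (inY _ uS) (inY _ pS) (inY _ qS) gY tu gu.
  exact: (key p).
exact: (key q).
Qed.

(** [v] sees [p] but not [u], so it also sees [q]. Any [g] seeing [u] sees [p] or [q] as well, and
    missing [v] would make a paw with at most one vertex in [S]; by symmetry the neighborhoods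
    agree. *)
Lemma nonadj_twins u v p q : v \notin S -> savoid e S u p q -> ~~ e u v -> e v p -> ft e u v.
Proof.
move=> vS /and4P[uS pS qS tu] uv vp.
have inY x : x \notin S -> x \in ~: S by rewrite inE.
case/and3P: (tu) => up pq uq.
have tv : tri e v p q.
  have t' : tri e p q u by rewrite /tri pq (sym q) uq (sym p) up.
  have := tri_two sym (pawfree_outside pawS) (inY _ pS) (inY _ qS) (inY _ uS) (inY _ vS) t' vp.
  by rewrite (sym v u) (negbTE uv) orbF /tri vp pq => ->.
apply/ftP => g; apply/idP/idP; first exact: (twin_half uS vS pS qS tu tv uv).
by apply: (twin_half vS uS pS qS tv tu); rewrite sym.
Qed.

Definition around s : {set 'I_n} := [set x in X | [exists y, exists z,
  savoid e S x y z && [|| e s x, e s y | e s z]]].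

Lemma aroundP s x : reflect (x \in X /\ exists y z, savoid e S x y z /\ [|| e s x, e s y | e s z])
  (x \in around s).
Proof.
rewrite [x \in around s]in_set; apply: (iffP andP) => -[xX].
  by case/existsP=> y /existsP[z /andP[h1 h2]]; split=> //; exists y, z.
by case=> y [z [h1 h2]]; split=> //; apply/existsP; exists y; apply/existsP; exists z; rewrite h1.
Qed.

(** The triangles seen by [s] lie in one component of the graph on [s] and the complement of [S],
    which is complete multipartite. *)
Lemma around_twins s x x' : x \in around s -> x' \in around s -> ~~ e x x' -> ft e x x'.
Proof.
case/aroundP=> _ [y [z [sv sa]]] /aroundP[_ [y' [z' [sv' sa']]]] nxx.
case/and4P: (sv) => xS yS zS t; case/and4P: (sv') => xS' yS' zS' t'.
have inY w : w \notin S -> w \in s |: ~: S by rewrite !inE => ->; rewrite orbT.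
have sY : s \in s |: ~: S by rewrite !inE eqxx.
have pf := pawfree_one sym irr pawS (s := s).
have cl := comp_closed sym pf (inY _ xS) (inY _ yS) (inY _ zS) t.
set D := tcomp e (s |: ~: S) x y z in cl.
have sD : s \in D by rewrite [_ \in D]inE sY sa.
have xD' : x' \in D.
  case/and3P: (t') => xy' yz' xz'; case/or3P: sa' => h.
  - exact: cl sD (inY _ xS') h.
  - by apply: (cl y') (inY _ xS') _; [apply: cl sD (inY _ yS') h|rewrite sym].
  - by apply: (cl z') (inY _ xS') _; [apply: cl sD (inY _ zS') h|rewrite sym].
apply: (nonadj_twins xS' sv nxx).
have xD : x \in D by apply: comp_a (inY _ xS) t.
have yD : y \in D by apply: comp_b (inY _ yS) t.
apply: contraT => xy'.
have := comp_multi sym pf (inY _ xS) (inY _ yS) (inY _ zS) t xD xD' yD nxx xy'.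
by case/and3P: t => ->.
Qed.

Lemma ex_leader x : exists2 r, leader e r & ft e r x.
Proof.
case: (arg_minnP (fun z : 'I_n => val z) (ftxx e x : [pred z | ft e z x] x)) => r /= frx minr.
exists r => //; apply/forallP => v; apply/negP => /andP[lt_v fvr].
by have := minr v (ft_trans fvr frx); rewrite leqNgt lt_v.
Qed.

Lemma leader_inj r r' : leader e r -> leader e r' -> ft e r r' -> r = r'.
Proof.
move=> /forallP rr /forallP rr' f; case: (ltngtP r r') => [lt|lt|/val_inj//].
  by have := rr' r; rewrite lt f.
by have := rr r'; rewrite lt ftC f.
Qed.

Definition reps s : {set 'I_n} := [set r in around s | leader e r].

Lemma in_reps s r : (r \in reps s) = (r \in around s) && leader e r.
Proof. by rewrite [LHS]in_set. Qed.

Lemma in_reduced v : (v \in X) = [&& ~~ E0 e S v, ~~ E1 e m v & ~~ E2 e m v].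
Proof. by rewrite [LHS]in_set. Qed.

Lemma reps_adj s r r' : r \in reps s -> r' \in reps s -> r != r' -> e r r'.
Proof.
rewrite !in_reps => /andP[ra rr] /andP[ra' rr'] ne.
apply: contraT => nrr; case/eqP: ne; apply: (leader_inj rr rr').
exact: around_twins ra ra' nrr.
Qed.

Lemma leader_around s x r : x \in around s -> leader e r -> ft e r x -> r \notin S -> r \in reps s.
Proof.
case/aroundP=> xX [y [z [/and4P[xS yS zS t] sa]]] rr frx rS.
have E w : e w r = e w x by move/ftP: frx; apply.
have E' w : e r w = e x w by rewrite sym E sym.
rewrite in_reps rr andbT; apply/aroundP; split; last first.
  by exists y, z; rewrite /savoid rS yS zS /tri !E' E.
move: xX; rewrite !in_reduced => /and3P[nE0 _ nE2]; rewrite (leader_E1 m rr) /=; apply/andP; split.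
  apply: contra nE0 => /E0P[y' [z' [/and4P[_ yS' zS' t'] h]]]; apply/E0P; exists y', z'.
  split; first by rewrite /savoid xS yS' zS' /tri -!E'.
  by move=> s' s'S; rewrite -E; apply: h.
apply: contra nE2; rewrite /E2 => lt_m; apply: leq_trans lt_m _.
have le_rx : r <= x.
  rewrite leqNgt; apply/negP => lt_x; have := forallP rr x.
  by rewrite lt_x ftC frx.
apply/subset_leq_card/subsetP => u; rewrite !inE => /and3P[lt_u -> /apP[eur h]] /=.
rewrite (leq_trans lt_u le_rx) /=; apply/apP; split; first by rewrite -E.
move=> w; rewrite -E => /h /orP[->//|fwr].
by rewrite (ft_trans fwr frx) orbT.
Qed.

(** The representatives form a clique. Each of the at most [m] vertices of [S] separates at most one
    of them from the others; the remaining ones are pairwise related by [ap], and the reduction of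
    parts leaves at most [m + 1]. *)
Lemma reps_le s : #|S| <= m -> #|reps s| <= m + m.+1.
Proof.
move=> leS; pose miss (w : 'I_n) := [set r in reps s | ~~ e w r && [exists q in reps s, e w q]].
have in_miss w r : (r \in miss w) = (r \in reps s) && (~~ e w r && [exists q in reps s, e w q]).
  by rewrite [LHS]in_set.
pose Ms := [set r in reps s | [exists w in S, r \in miss w]].
have repS r : r \in reps s -> r \notin S /\ exists y z, savoid e S r y z.
  rewrite in_reps => /andP[/aroundP[_ [y [z [sv _]]]] _]; split; last by exists y, z.
  by case/and4P: sv.
have leM : #|Ms| <= m.
  apply: leq_trans leS; rewrite -[leqRHS]muln1; apply: (card_cover (F := miss)); last first.
    by move=> r; rewrite [_ \in Ms]in_set => /andP[_ /existsP[w /andP[wS rw]]]; exists w.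
  move=> w _; apply/card_le1_eqP => r r'; rewrite !(in_miss w).
  (* Two representatives missed by [w] form a triangle with [q], and [w] would be pendant at [q]: a
     paw with only [w] in [S]. *)
  move=> /andP[rR /andP[nwr /existsP[q /andP[qR wq]]]] /andP[rR' /andP[nwr' _]].
  apply/eqP; apply: contraT => ne.
  have nq x : ~~ e w x -> q != x by apply: contraNneq => <-.
  have [qS _] := repS q qR; have [rS _] := repS r rR; have [rS' _] := repS r' rR'.
  have inY x : x \notin S -> x \in w |: ~: S by rewrite !inE => ->; rewrite orbT.
  have t : tri e q r r' by rewrite /tri !(@reps_adj s) // ?nq // eq_sym.
  have := tri_two sym (pawfree_one sym irr pawS (s := w)) (inY _ qS) (inY _ rS) (inY _ rS') _ t wq.
  by rewrite !inE eqxx (negbTE nwr) (negbTE nwr') => /(_ isT).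
pose Um := reps s :\: Ms.
have UmP r r' : r \in Um -> r' \in Um -> r != r' -> ap e r r'.
  rewrite !in_setD => /andP[rM rR] /andP[rM' rR'] ne; have err := reps_adj rR rR' ne.
  have half x y w : x \in reps s -> y \in reps s -> y \notin Ms -> x != y -> e w x -> ~~ e w y -> ft e w y.
    move=> xR yR yM xy wx wy; have exy := reps_adj xR yR xy.
    have [xS _] := repS x xR; have [yS [p [q sv]]] := repS y yR.
    case wS: (w \in S).
      case/negP: yM; rewrite in_set yR; apply/existsP; exists w; rewrite wS in_miss yR wy.
      by apply/existsP; exists x; rewrite xR.
    rewrite ftC; case/and4P: sv => _ pS qS t; case/and3P: (t) => yp pq yq.
    have inY z : z \notin S -> z \in ~: S by rewrite inE.
    have := tri_two sym (pawfree_outside pawS) (inY _ yS) (inY _ pS) (inY _ qS) (inY _ xS) t exy.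
    case/orP=> h.
      apply: (@nonadj_twins y w x p); rewrite ?wS // 1?(sym y w) //.
      by rewrite /savoid yS xS pS /tri (sym y x) exy h yp.
    apply: (@nonadj_twins y w x q); rewrite ?wS // 1?(sym y w) //.
    by rewrite /savoid yS xS qS /tri (sym y x) exy h yq.
  apply/apP; split=> // w; case wr: (e w r); case wr': (e w r') => // _.
    by rewrite (half r r') ?wr' ?orbT.
  by rewrite (half r' r) ?wr // eq_sym.
have leU : #|Um| <= m.+1.
  apply: leq_trans (first_le m (fun u => u \in Um)); apply/subset_leq_card/subsetP => r rU.
  rewrite inE rU /= leqNgt; apply/negP => lt_m.
  have rX : r \in X by move: rU; rewrite in_setD in_reps => /andP[_ /andP[/aroundP[]]].
  have : ~~ E2 e m r by move: rX; rewrite in_reduced => /and3P[].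
  case/negP; apply: leq_trans lt_m _; apply/subset_leq_card/subsetP => u.
  rewrite -[u \in _]/((u < r) && (u \in Um)) => /andP[lt_u uU].
  rewrite -[u \in _]/[&& u < r, leader e u & ap e u r] lt_u UmP ?andbT //=.
    by move: uU; rewrite in_setD in_reps => /and3P[].
  by apply: contraTneq lt_u => ->; rewrite ltnn.
have -> : #|reps s| = #|reps s :&: Ms| + #|Um| by rewrite cardsID.
by apply: leq_add leU; apply: leq_trans leM; apply/subset_leq_card/subsetIr.
Qed.

(** The leader of a class is one of the at most [2 * m + 1] representatives or lies in [S], which
    makes at most [3 * m + 1] classes of size at most [m + 1]. *)
Lemma around_le s : #|S| <= m -> #|around s| <= (3 * m).+1 * m.+1.
Proof.
move=> leS; apply: (@leq_trans (#|S :|: reps s| * m.+1)).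
  apply: (card_cover (F := fun r => [set v in X | ft e v r])) => [r _|x xa].
    exact: class_le.
  have [r rr frx] := ex_leader x; exists r.
    by rewrite inE; case rS: (r \in S) => //=; apply: (leader_around xa rr frx); rewrite rS.
  by rewrite inE ftC frx andbT; case/aroundP: xa.
rewrite leq_mul2r; apply/orP; right; apply: leq_trans (leq_card_setU _ _) _.
by move: leS (reps_le s leS); move: #|S| #|reps s| m; clear; lia.
Qed.

Lemma T1_le : #|S| <= m -> #|[set x in X | inT1 x]| <= m * ((3 * m).+1 * m.+1).
Proof.
move=> leS; apply: (@leq_trans (#|S| * ((3 * m).+1 * m.+1))); last by rewrite leq_mul2r leS orbT.
apply: (card_cover (F := around)) => [s _|x]; first exact: around_le.
rewrite inE => /andP[xX /existsP[y /existsP[z sv]]].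
have : ~~ E0 e S x by move: xX; rewrite inE => /andP[].
case: (boolP [exists s, (s \in S) && [|| e s x, e s y | e s z]]) => [/existsP[s /andP[sS h]] _|].
  by exists s => //; apply/aroundP; split=> //; exists y, z.
rewrite negb_exists => /forallP h /negP[]; apply/E0P; exists y, z; split=> // s sS.
by have := h s; rewrite sS.
Qed.

Definition fan s : {set 'I_n} := [set x in X | [&& x \notin S', ~~ inT1 x &
  [exists y, (y \notin S') && tri e x y s]]].

(** A vertex distinguishing [x'] from [y0] would yield, with [s] and [x0], a paw with at most two
    vertices in [S'] or a triangle at [x0] avoiding [S']. *)
Lemma fan_twin s x0 y0 x' : s \in S' -> x0 \notin S' -> y0 \notin S' -> x' \notin S' ->
  ~~ inT1 x0 -> tri e x0 y0 s -> e x' s -> e x' x0 -> ~~ e x' y0 -> ~~ inT1 x' -> ft e x' y0.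
Proof.
move=> sS x0S y0S xS n0 /and3P[x0y0 y0s x0s] xs xx0 xy0 n'.
have nS w : w \notin S' -> w \notin S by rewrite inE negb_or => /andP[].
have no3 a b c d : paw e a b c d -> (a \in S') + (b \in S') + (c \in S') + (d \in S') < 3 -> False.
  by rewrite ltnS leqNgt => /pawS' h1 /negP[].
have noT a b c : ~~ inT1 a -> a \notin S' -> b \notin S' -> c \notin S' -> tri e a b c -> False.
  move=> na aS bS cS t; case/negP: na; apply/existsP; exists b; apply/existsP; exists c.
  by rewrite /savoid !nS.
(* Both directions are the same statement with [x'] and [y0] exchanged. *)
have half u v w : u \notin S' -> v \notin S' -> e u s -> e v s -> e u x0 -> e v x0 -> ~~ e u v ->
    ~~ inT1 u -> e w u -> e w v.
  move=> uS vS us vs ux0 vx0 uv nu wu; apply: contraT => wv.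
  have [[Eu Ev] E0'] := ((negbTE uS, negbTE vS), negbTE x0S).
  case wS: (w \in S'); last first.
    case wx0: (e w x0); first by case: (noT x0 u w); rewrite ?wS // /tri (sym x0 u) ux0 (sym u w) wu sym wx0.
    case ws: (e w s).
      case: (no3 v x0 s w); last by rewrite Ev E0' sS wS.
      by rewrite /paw vx0 (sym x0 s) (sym s x0) x0s vs (sym s w) ws (sym v w) wv (sym x0 w) wx0.
    case: (no3 s x0 u w); last by rewrite Eu E0' sS wS.
    by rewrite /paw (sym s x0) x0s (sym x0 u) ux0 (sym s u) us (sym u w) wu (sym s w) ws (sym x0 w) wx0.
  case ws: (e w s).
    case wx0: (e w x0).
      case: (no3 w u s v); last by rewrite Eu Ev sS wS.
      by rewrite /paw wu us ws (sym s v) vs wv uv.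
    case: (no3 v x0 s w); last by rewrite Ev E0' sS wS.
    by rewrite /paw vx0 (sym x0 s) (sym s x0) x0s vs (sym s w) ws (sym v w) wv (sym x0 w) wx0.
  case wx0: (e w x0).
    case: (no3 s v x0 w); last by rewrite Ev E0' sS wS.
    by rewrite /paw (sym s v) vs vx0 (sym s x0) x0s (sym x0 w) wx0 (sym s w) ws (sym v w) wv.
  case: (no3 s x0 u w); last by rewrite Eu E0' sS wS.
  by rewrite /paw (sym s x0) x0s (sym x0 u) ux0 (sym s u) us (sym u w) wu (sym s w) ws (sym x0 w) wx0.
have n0' : ~~ inT1 y0.
  apply/negP => /existsP[p /existsP[q /and4P[_ pS qS t]]].
  have inY z : z \notin S -> z \in ~: S by rewrite inE.
  have [yS' xS'] := (nS _ y0S, nS _ x0S).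
  have := tri_two sym (pawfree_outside pawS) (inY _ yS') (inY _ pS) (inY _ qS) (inY _ xS') t x0y0.
  case/and3P: t => yp pq yq; case/orP=> h; case/negP: n0; apply/existsP; exists y0; apply/existsP.
    by exists p; rewrite /savoid xS' yS' pS /tri x0y0 yp h.
  by exists q; rewrite /savoid xS' yS' qS /tri x0y0 yq h.
have yx0 : e y0 x0 by rewrite sym.
apply/ftP => w; apply/idP/idP; first exact: half.
by apply: half => //; rewrite sym.
Qed.

(** Only the twin classes of [x0] and [y0] occur. A vertex of the fan cannot see both, which gives a
    triangle avoiding [S'], nor neither, which gives a paw with one vertex in [S']; seeing exactly
    one, it is a false twin of the other. *)
Lemma fan_le s : s \in S' -> #|fan s| <= 2 * m.+1.
Proof.
move=> sS; case: (set_0Vmem (fan s)) => [->|[x0]]; first by rewrite cards0.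
rewrite inE => /andP[x0X /and3P[x0S n0 /existsP[y0 /andP[y0S t]]]].
case/and3P: (t) => x0y0 y0s x0s.
apply: (@leq_trans #|[set v in X | ft e v x0] :|: [set v in X | ft e v y0]|); last first.
  apply: leq_trans (leq_card_setU _ _) _; rewrite mul2n -addnn.
  by apply: leq_add; apply: class_le.
apply/subset_leq_card/subsetP => x; rewrite inE => /andP[xX /and3P[xS nx /existsP[y /andP[yS tx]]]].
rewrite in_setU [_ \in [set _ in _ | _]]inE [X in _ || X]inE xX /=.
have xs : e x s by case/and3P: tx.
have nS w : w \notin S' -> w \notin S by rewrite inE negb_or => /andP[].
have noT a b c : ~~ inT1 a -> a \notin S' -> b \notin S' -> c \notin S' -> ~~ tri e a b c.
  move=> na aS bS cS; apply: contra na => t'; apply/existsP; exists b; apply/existsP; exists c.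
  by rewrite /savoid !nS.
case: (x =P x0) => [->|xx0]; first by rewrite ftxx.
case: (x =P y0) => [->|xy0]; first by rewrite ftxx orbT.
case h0: (e x x0); case h1: (e x y0).
- by have := noT x x0 y0 nx xS x0S y0S; rewrite /tri h0 x0y0 h1.
- by rewrite (fan_twin sS x0S y0S xS n0 t xs h0 (negbT h1) nx) orbT.
- have ny : ~~ inT1 y0.
    apply/negP => /existsP[p /existsP[q /and4P[yS' pS qS t']]].
    have inY z : z \notin S -> z \in ~: S by rewrite inE.
    have := tri_two sym (pawfree_outside pawS) (inY _ yS') (inY _ pS) (inY _ qS) (inY _ (nS _ x0S)) t' x0y0.
    case/and3P: t' => yp pq yq; case/orP=> h; case/negP: n0; apply/existsP; exists y0; apply/existsP.
      by exists p; rewrite /savoid nS // yS' pS /tri x0y0 yp h.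
    by exists q; rewrite /savoid nS // yS' qS /tri x0y0 yq h.
  have t' : tri e y0 x0 s by rewrite /tri sym x0y0 x0s y0s.
  by rewrite (fan_twin sS y0S x0S xS ny t' xs h1 (negbT h0) nx).
have := @pawS' x0 y0 s x; rewrite /paw x0y0 y0s x0s (sym s x) xs (sym x0 x) h0 (sym y0 x) h1.
by rewrite (negbTE x0S) (negbTE y0S) sS (negbTE xS) => /(_ isT).
Qed.

(** The left side expands to 2c^4 + 6c^3 + 6c^2 + 4c, whose coefficients add up to 18. *)
Lemma core_bound (c : nat) : 0 < c ->
  c + c ^ 3 + (c * ((3 * c).+1 * c.+1) + (c + c ^ 3) * (2 * c.+1)) <= 18 * c ^ 4.
Proof.
clear => c0; rewrite !expnS expn0 !muln1.
have h1 : c <= c * c by rewrite leq_pmulr.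
have h2 : c * c <= c * (c * c) by rewrite leq_mul2l h1 orbT.
have h3 : c * (c * c) <= c * (c * (c * c)) by rewrite leq_mul2l h2 orbT.
lia.
Qed.

Lemma core_le : 0 < m -> #|S| <= m -> #|H| <= m ^ 3 -> #|core| <= 18 * m ^ 4.
Proof.
move=> m0 leS leH.
have leS' : #|S'| <= m + m ^ 3 by apply: leq_trans (leq_card_setU _ _) (leq_add leS leH).
have leF : #|[set x in X | inT2 x && ~~ inT1 x]| <= #|S'| * (2 * m.+1).
  apply: (card_cover (F := fan)) => [s|x]; first exact: fan_le.
  rewrite inE => /andP[xX /andP[/andP[xS /existsP[y /existsP[s /and3P[yS sS t]]]] n1]].
  exists s => //; rewrite inE xX xS n1; apply/existsP; exists y; by rewrite yS.
have : #|core| <= #|S' :|: ([set x in X | inT1 x] :|: [set x in X | inT2 x && ~~ inT1 x])|.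
  apply/subset_leq_card/subsetP => x; rewrite inE => /andP[xX h].
  rewrite !in_setU [_ \in [set _ in _ | inT1 _]]inE [X in _ || (_ || X)]inE xX /= -in_setU.
  by case: (x \in _) h => //=; case: (inT1 x) (inT2 x) => [] [].
move/leq_trans; apply; apply: leq_trans (leq_card_setU _ _) _.
apply: leq_trans (leq_add leS' (leq_card_setU _ _)) _.
apply: leq_trans (leq_add (leqnn _) (leq_add (T1_le leS) leF)) _.
apply: leq_trans (core_bound m0).
by rewrite leq_add2l leq_add2l leq_mul2r leS' orbT.
Qed.

(** With [m.+1 <= 2 * m], the core and the three markings contribute 18 m^4, 36 m^5, 72 m^6 and 144
    m^6; the last is 18 * 4 * 2, with four adjacency patterns to each pair. The coefficients add up
    to 270. *)
Lemma kernel_le : 0 < m -> #|S| <= m -> #|H| <= m ^ 3 -> #|kernel| <= 270 * m ^ 6.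
Proof.
move=> m0 leS leH; have leA := core_le m0 leS leH.
pose ph1 a := [pred y : 'I_n | [&& y \in N, nt y & e y a]].
pose ph2 z := [pred y : 'I_n | (y \in N) && e y z].
pose ph3 (i : ('I_n * 'I_n) * (bool * bool)) :=
  [pred y : 'I_n | [&& y \in N, e y i.1.1 == i.2.1 & e y i.1.2 == i.2.2]].
have le1 : #|[set x | mark1 x]| <= #|core| * m.+1.
  apply: (card_cover (F := fun a => first m (ph1 a))) => [a _|x]; first exact: first_le.
  rewrite inE => /and3P[xN ntx /existsP[a /and3P[aA exa nm]]]; exists a => //.
  by rewrite inE /= xN ntx exa leqNgt.
have le2 : #|[set x | mark2 x]| <= #|[set x | mark1 x]| * m.+1.
  apply: (card_cover (F := fun z => first m (ph2 z))) => [z _|x]; first exact: first_le.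
  rewrite inE => /andP[xN /existsP[z /and3P[mz exz nm]]]; exists z; first by rewrite inE.
  by rewrite inE /= xN exz leqNgt.
have le3 : #|[set x | mark3 x]| <= (#|S| * #|core| * 4) * m.+1.
  have -> : #|S| * #|core| * 4 = #|setX (setX S core) [set: bool * bool]|.
    by rewrite !cardsX cardsT card_prod card_bool.
  apply: (card_cover (F := fun i => first m (ph3 i))) => [i _|x]; first exact: first_le.
  rewrite inE => /andP[xN /existsP[s /existsP[b /and4P[sS sA bA nm]]]].
  exists ((s, b), (e x s, e x b)); first by rewrite !in_setX /= sS bA in_setT.
  by rewrite inE /= xN !eqxx leqNgt.
have : #|kernel| <= #|core :|: ([set x | mark1 x] :|: ([set x | mark2 x] :|: [set x | mark3 x]))|.
  by apply/subset_leq_card/subsetP => x; rewrite [_ \in kernel]in_set !in_setU ![_ \in [set _ | _]]in_set.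
move/leq_trans; apply; apply: leq_trans (leq_card_setU _ _) _.
apply: leq_trans (leq_add (leqnn _) (leq_card_setU _ _)) _.
apply: leq_trans (leq_add (leqnn _) (leq_add (leqnn _) (leq_card_setU _ _))) _.
have m2 : m.+1 <= 2 * m by rewrite mul2n -addnn -addn1 leq_add2l.
have le1' : #|[set x | mark1 x]| <= 36 * m ^ 5.
  apply: leq_trans le1 _; apply: leq_trans (leq_mul leA m2) _.
  by rewrite (expnS m 4); clear; lia.
have le2' : #|[set x | mark2 x]| <= 72 * m ^ 6.
  apply: leq_trans le2 _; apply: leq_trans (leq_mul le1' m2) _.
  by rewrite (expnS m 5); clear; lia.
have le3' : #|[set x | mark3 x]| <= 144 * m ^ 6.
  apply: leq_trans le3 _; apply: leq_trans (leq_mul (leq_mul (leq_mul leS leA) (leqnn 4)) m2) _.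
  by rewrite (expnS m 5) (expnS m 4); clear; lia.
have p45 : m ^ 4 <= m ^ 6 by rewrite leq_pexp2l.
have p56 : m ^ 5 <= m ^ 6 by rewrite leq_pexp2l.
apply: leq_trans (leq_add leA (leq_add le1' (leq_add le2' le3'))) _.
move: p45 p56; move: (m ^ 4) (m ^ 5) (m ^ 6); clear; lia.
Qed.

Lemma kernel_correct : yes e kernel k -> yes e setT k.
Proof. by move=> ?; apply: (reduced_yes sym irr pawS mk); apply: kernel_yes. Qed.

End Marking.

(** * Packing paws *)

Lemma in_diff (T : finType) (e f : rel T) Y x y :
  ((x, y) \in diff e f Y) = [&& x \in Y, y \in Y & e x y != f x y].
Proof. by rewrite in_set. Qed.

Section Grow.
Variables (n : nat) (e : rel 'I_n).
Hypotheses (sym : symmetric e) (irr : irreflexive e).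
Implicit Types (Z : {set 'I_n}) (f : rel 'I_n).

Definition cnt4 Z a b c d := (a \in Z) + (b \in Z) + (c \in Z) + (d \in Z).

Section Base.
Variables (base : 'I_n -> 'I_n -> 'I_n -> 'I_n -> bool) (j : nat).

Definition grow_step a b c Z d :=
  if [&& paw e a b c d, base a b c d & cnt4 Z a b c d <= j]
  then d |: (c |: (b |: (a |: Z))) else Z.

Definition grow Z := foldl (fun Z a => foldl (fun Z b => foldl (fun Z c =>
  foldl (grow_step a b c) Z (enum 'I_n)) Z (enum 'I_n)) Z (enum 'I_n)) Z (enum 'I_n).

Lemma foldl_ind (U : Type) (I : {set 'I_n} -> Prop) (step : {set 'I_n} -> U -> {set 'I_n}) Z l :
  (forall Z x, I Z -> I (step Z x)) -> I Z -> I (foldl step Z l).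
Proof. by move=> h; elim: l Z => //= x l IH Z IZ; apply/IH/h. Qed.

Lemma foldl_ext (U : Type) (step : {set 'I_n} -> U -> {set 'I_n}) Z l :
  (forall Z x, Z \subset step Z x) -> Z \subset foldl step Z l.
Proof. by move=> h; elim: l Z => //= x l IH Z; apply: subset_trans (h Z x) (IH _). Qed.

Lemma foldl_mono (U : eqType) (P : {set 'I_n} -> Prop) (step : {set 'I_n} -> U -> {set 'I_n}) Z l x :
  (forall Z x, Z \subset step Z x) -> (forall Z, P (step Z x)) ->
  (forall Z Z', Z \subset Z' -> P Z -> P Z') -> x \in l -> P (foldl step Z l).
Proof.
move=> ext Px up; elim: l Z => //= y l IH Z; rewrite inE => /predU1P[<-|/IH//].
by apply: up (Px Z); apply: foldl_ext.
Qed.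

Lemma grow_ind (I : {set 'I_n} -> Prop) Z : I Z ->
  (forall Z a b c d, I Z -> paw e a b c d -> base a b c d -> cnt4 Z a b c d <= j ->
    I (d |: (c |: (b |: (a |: Z))))) -> I (grow Z).
Proof.
move=> IZ h; do 4!(apply: foldl_ind => // {}Z ? {}IZ).
by rewrite /grow_step; case: ifP => // /and3P[]; apply: h.
Qed.

Lemma grow_step_ext a b c Z d : Z \subset grow_step a b c Z d.
Proof. by rewrite /grow_step; case: ifP => // _; rewrite !subsetU ?subxx ?orbT. Qed.

(** One scan suffices: the set only grows, so a paw met in more than [j] vertices when it is scanned
    stays so. *)
Lemma grow_paw Z a b c d : j < 4 -> paw e a b c d -> base a b c d -> j < cnt4 (grow Z) a b c d.
Proof.
move=> j4 pw bs.
pose P Z1 := j < cnt4 Z1 a b c d.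
have up Z1 Z2 : Z1 \subset Z2 -> P Z1 -> P Z2.
  move=> /subsetP s12 /leq_trans; apply; rewrite /cnt4.
  have le x : (x \in Z1) <= (x \in Z2) by case h: (x \in Z1) => //; rewrite s12.
  by rewrite !leq_add.
have P4 Z' : P (grow_step a b c Z' d).
  rewrite /P /grow_step pw bs /=; case: ifP => [le|/negbT]; last by rewrite -ltnNge.
  by rewrite /cnt4 !in_setU1 !eqxx !orbT.
have ext4 a' b' c' Z' : Z' \subset foldl (grow_step a' b' c') Z' (enum 'I_n).
  by apply: foldl_ext => Z1 d'; apply: grow_step_ext.
have ext3 a' b' Z' : Z' \subset foldl (fun Z c => foldl (grow_step a' b' c) Z (enum 'I_n)) Z' (enum 'I_n).
  by apply: foldl_ext => Z1 d'; apply: ext4.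
apply: (@foldl_mono _ P _ _ _ a) => // [Z1 a'|Z1|]; last exact: mem_enum.
  by apply: foldl_ext => Z2 b'; apply: ext3.
apply: (@foldl_mono _ P _ _ _ b) => // [Z2|]; last exact: mem_enum.
apply: (@foldl_mono _ P _ _ _ c) => // [Z3|]; last exact: mem_enum.
apply: (@foldl_mono _ P _ _ _ d) => // [|]; last exact: mem_enum.
exact: grow_step_ext.
Qed.

Lemma paw_edit f a b c d : pawfree_on setT f -> paw e a b c d ->
  exists u v, [/\ u \in [:: a; b; c; d], v \in [:: a; b; c; d] & e u v != f u v].
Proof.
move=> pf pw.
case: (boolP (all (fun p : 'I_n * 'I_n => e p.1 p.2 == f p.1 p.2)
  [:: (a, b); (b, c); (a, c); (c, d); (a, d); (b, d)])) => [|/allPn[[u v] /= h ne]].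
  case/and5P=> /eqP/= E1 /eqP/= E2 /eqP/= E3 /eqP/= E4 /and3P[/eqP/= E5 /eqP/= E6 _].
  by have := pf a b c d; rewrite !in_setT /paw -E1 -E2 -E3 -E4 -E5 -E6 -/(paw e a b c d) pw => /(_ isT isT isT isT).
exists u, v; split=> //; move: h; rewrite !inE; repeat case/orP.
all: by move/eqP => -[Eu Ev]; rewrite ?Eu ?Ev eqxx ?orbT.
Qed.

(* Every packed paw contains an edited pair that is not inside the vertex set
   packed before it, so four more vertices cost two more ordered pairs. *)
Lemma grow_le f Z : symmetric f -> irreflexive f -> pawfree_on setT f ->
  (forall Z' a b c d u v, Z \subset Z' -> paw e a b c d -> base a b c d -> cnt4 Z' a b c d <= j ->
    u \in [:: a; b; c; d] -> v \in [:: a; b; c; d] -> e u v != f u v -> ~~ ((u \in Z') && (v \in Z'))) ->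
  #|grow Z| <= #|Z| + 2 * #|diff e f (grow Z)|.
Proof.
move=> fs fi pf new.
suff [] : Z \subset grow Z /\ #|grow Z| <= #|Z| + 2 * #|diff e f (grow Z)| by [].
apply: (@grow_ind (fun Z1 => Z \subset Z1 /\ #|Z1| <= #|Z| + 2 * #|diff e f Z1|)) =>
  [|Z' a b c d [sZ le_Z'] pw bs le_j]; first by rewrite subxx leq_addr.
set Z1 := d |: _.
have s1 : Z' \subset Z1 by rewrite !subsetU ?subxx ?orbT.
split; first exact: subset_trans s1.
have [u [v [uq vq ne]]] := paw_edit pf pw.
have nZ := new _ _ _ _ _ _ _ sZ pw bs le_j uq vq ne.
have inZ1 x : x \in [:: a; b; c; d] -> x \in Z1.
  by rewrite !inE => /or4P[]/eqP->; rewrite eqxx ?orbT.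
have uv : u != v by apply: contraNneq ne => ->; rewrite irr fi.
have le4 : #|Z1| <= #|Z'| + 4.
  have le1 x (Y : {set 'I_n}) : #|x |: Y| <= #|Y| + 1 by rewrite cardsU1 addnC leq_add2l leq_b1.
  apply: leq_trans (le1 _ _) _; rewrite -[4]/(3 + 1) addnA leq_add2r.
  apply: leq_trans (le1 _ _) _; rewrite -[3]/(2 + 1) addnA leq_add2r.
  by apply: leq_trans (le1 _ _) _; rewrite -[2]/(1 + 1) addnA leq_add2r.
have : #|diff e f Z'| + 2 <= #|diff e f Z1|.
  have <- : #|[set (u, v); (v, u)]| = 2.
    by rewrite cards2 -[in (u, v) != _]pair_eqE /= (negbTE uv).
  rewrite -cardsUI (_ : _ :&: _ = set0) ?cards0 ?addn0.
    apply/subset_leq_card/subsetP => -[x y]; rewrite in_setU !in_diff in_set2 !xpair_eqE.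
    case/orP=> [/and3P[xZ yZ ->]|/orP[]/andP[/eqP-> /eqP->]].
    - by rewrite !(subsetP s1).
    - by rewrite !inZ1 ?ne.
    by rewrite !inZ1 // sym fs.
  apply/setP => -[x y]; rewrite in_setI in_set0 in_diff in_set2 !xpair_eqE.
  apply/negP => /andP[/and3P[xZ yZ _] h]; case/negP: nZ.
  by case/orP: h => /andP[/eqP<- /eqP<-]; rewrite xZ yZ.
move=> le2; apply: leq_trans le4 _; apply: leq_trans (leq_add le_Z' (leqnn 4)) _.
by rewrite -addnA leq_add2l -[4]/(2 * 2) -mulnDr leq_mul2l le2.
Qed.

End Base.

Lemma cnt4_ge Z a b c d (q : seq 'I_n) : uniq q -> {subset q <= [:: a; b; c; d]} ->
  {subset q <= Z} -> size q <= cnt4 Z a b c d.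
Proof.
move=> uq sq sZ; have -> : cnt4 Z a b c d = size [seq x <- [:: a; b; c; d] | x \in Z].
  by rewrite size_filter /= addn0 !addnA.
by apply: uniq_leq_size => // x xq; rewrite mem_filter sZ ?sq.
Qed.

Definition packing := grow (fun _ _ _ _ => true) 1 set0.

Definition petals s t :=
  grow (fun a b c d => (s \in [:: a; b; c; d]) && (t \in [:: a; b; c; d])) 2 [set s; t].

Lemma packing_paw a b c d : paw e a b c d -> 1 < cnt4 packing a b c d.
Proof. by move=> pw; apply: grow_paw. Qed.

Lemma petals_paw s t a b c d : paw e a b c d -> s \in [:: a; b; c; d] -> t \in [:: a; b; c; d] ->
  2 < cnt4 (petals s t) a b c d.
Proof. by move=> pw sq tq; apply: grow_paw; rewrite ?sq. Qed.

Lemma edited_neq f u v : irreflexive f -> e u v != f u v -> u != v.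
Proof. by move=> fi ne; apply: contraNneq ne => ->; rewrite irr fi. Qed.

Lemma diff_le f (Z : {set 'I_n}) : #|diff e f Z| <= #|diff e f setT|.
Proof.
by apply/subset_leq_card/subsetP => -[x y]; rewrite !in_diff !in_setT => /and3P[].
Qed.

(** A new paw meets the packed set in at most one vertex, so its edited pair is never inside that
    set. *)
Lemma packing_le k : yes e setT k -> #|packing| <= 4 * k.
Proof.
case=> f [fs fi fp le_k].
have := @grow_le (fun _ _ _ _ => true) 1 f set0 fs fi fp.
rewrite -/packing cards0 add0n => le_grow; apply: leq_trans (le_grow _) _; last first.
  apply: leq_trans (leq_mul (leqnn 2) (leq_trans (diff_le f _) le_k)) _.
  by rewrite -mul2n mulnA.
move=> Z' a b c d u v _ pw _ le1 uq vq ne; apply/negP => /andP[uZ vZ].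
have := @cnt4_ge Z' a b c d [:: u; v]; rewrite /= inE (edited_neq fi ne).
move/(_ isT) => h; suff : 2 <= 1 by [].
by apply: leq_trans le1; apply: h => x; rewrite in_cons mem_seq1 => /orP[]/eqP->.
Qed.

(** A new petal meets the set in [s] and [t] only. If this pair is unedited, the edited pair of the
    petal is new; the start set accounts for the extra 2. *)
Lemma petals_le s t k f : s != t -> symmetric f -> irreflexive f -> pawfree_on setT f ->
  #|diff e f setT| <= k.*2 -> e s t = f s t -> #|petals s t| <= 4 * k + 2.
Proof.
move=> st fs fi fp le_k Est.
have := @grow_le (fun a b c d => (s \in [:: a; b; c; d]) && (t \in [:: a; b; c; d])) 2 f
  [set s; t] fs fi fp.
rewrite -/(petals s t) cards2 st addnC => le_grow; apply: leq_trans (le_grow _) _; last first.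
  rewrite leq_add2r; apply: leq_trans (leq_mul (leqnn 2) (leq_trans (diff_le f _) le_k)) _.
  by rewrite -mul2n mulnA.
move=> Z' a b c d u v /subsetP sZ pw /andP[sq tq] le2 uq vq ne; apply/negP => /andP[uZ vZ].
have sZ' : s \in Z' by apply: sZ; rewrite in_set2 eqxx.
have tZ' : t \in Z' by apply: sZ; rewrite in_set2 eqxx orbT.
have one w : w \in [:: a; b; c; d] -> w \in Z' -> (w == s) || (w == t).
  move=> wq wZ; apply: contraT; rewrite negb_or => /andP[ws wt].
  have := @cnt4_ge Z' a b c d [:: w; s; t]; rewrite /= !inE negb_or ws wt st.
  move/(_ isT) => h; suff : 3 <= 2 by [].
  by apply: leq_trans le2; apply: h => x; rewrite !in_cons orbF => /or3P[]/eqP->.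
have := edited_neq fi ne.
case/orP: (one u uq uZ) (one v vq vZ) ne => /eqP-> /orP[]/eqP->; rewrite ?eqxx //.
  by rewrite Est eqxx.
by rewrite sym fs Est eqxx.
Qed.

Definition flip s t : rel 'I_n := fun u v =>
  if ((u == s) && (v == t)) || ((u == t) && (v == s)) then ~~ e u v else e u v.

Lemma flip_sym s t : symmetric (flip s t).
Proof. by move=> u v; rewrite /flip orbC !(andbC (v == _)) sym. Qed.

Lemma flip_irr s t : s != t -> irreflexive (flip s t).
Proof.
move=> st u; rewrite /flip irr; case: ifP => // /orP[]/andP[/eqP-> h];
  by rewrite ?(eq_sym t) (negbTE st) in h.
Qed.

(** By [petals_le] every solution edits [st], so performing this edit costs exactly one unit of
    budget. *)
Lemma forced k s t : s != t -> 4 * k + 2 < #|petals s t| ->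
  yes e setT k <-> 0 < k /\ yes (flip s t) setT k.-1.
Proof.
move=> st lt_k; have pair2 : #|[set (s, t); (t, s)]| = 2 by rewrite cards2 xpair_eqE (negbTE st).
split=> [[f [fs fi fp le_k]]|[k0 [f [fs fi fp le_k]]]].
  have ne : e s t != f s t.
    by apply/eqP => E; move: lt_k; rewrite ltnNge (@petals_le s t k f).
  have sub : [set (s, t); (t, s)] \subset diff e f setT.
    apply/subsetP => -[x y]; rewrite in_set2 in_diff !in_setT /= !xpair_eqE.
    by case/orP=> /andP[/eqP-> /eqP->] //; rewrite sym fs.
  have k0 : 0 < k by have := leq_trans (subset_leq_card sub) le_k; rewrite pair2; case: k {le_k lt_k}.
  split=> //; exists f; split=> //.
  have -> : diff (flip s t) f setT = diff e f setT :\: [set (s, t); (t, s)].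
    apply/setP => -[x y]; rewrite in_setD in_set2 !in_diff !in_setT !xpair_eqE /flip /=.
    case: ifP => //= /orP[]/andP[/eqP-> /eqP->]; last rewrite sym fs.
      by apply/negbTE; rewrite negbK; move: ne; case: (e s t); case: (f s t).
    by apply/negbTE; rewrite negbK; move: ne; case: (e s t); case: (f s t).
  by rewrite cardsD (setIidPr sub) pair2 leq_subLR; case: k k0 le_k {lt_k}.
exists f; split=> //.
apply: (@leq_trans #|diff (flip s t) f setT :|: [set (s, t); (t, s)]|).
  apply/subset_leq_card/subsetP => -[x y]; rewrite in_setU in_set2 !in_diff !in_setT !xpair_eqE /flip /=.
  by case: ifP => [|_ ->] //; rewrite orbT.
apply: leq_trans (leq_card_setU _ _) _; rewrite pair2.
by case: k k0 le_k {lt_k} => // k _ le_k; rewrite doubleS -[_.*2.+2]addn2 leq_add2r.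
Qed.

End Grow.

(** * Passage between pair sets and ordered pairs, induced instances, and a fixed no-instance *)

Section Instances.

Lemma paw_uniq n (e : rel 'I_n) a b c d : symmetric e -> irreflexive e -> paw e a b c d ->
  uniq [:: a; b; c; d].
Proof.
move=> sym irr /and5P[ab bc ac cd /andP[ad bd]].
have ne x y : e x y -> x != y by apply: contraTneq => ->; rewrite irr.
rewrite /= !inE !negb_or (ne a b) ?(ne b c) ?(ne a c) ?(ne c d) //= andbT.
by apply/andP; split; [apply: contraNneq bd => <-; rewrite sym|apply: contraNneq ad => <-].
Qed.

Lemma PFEE_yes G k : PFEE G k <-> yes (@gadj G) setT k.
Proof.
set e := @gadj G; have sym : symmetric e by move=> x y; apply: gadj_sym.
have irr : irreflexive e by move=> x; apply: gadj_irr.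
split=> [[A [lt_A [le_A pf]]]|[f [fs fi fp le_k]]].
  have gs : symmetric (gdelta e A) by move=> u v; rewrite /gdelta sym orbC.
  have gi : irreflexive (gdelta e A).
    move=> u; rewrite /gdelta irr orbb; case h: (_ \in A) => //.
    by have := lt_A _ h; rewrite ltnn.
  exists (gdelta e A); split=> // [a b c d _ _ _ _|].
    apply/negP => pw; have := pf a b c d (paw_uniq gs gi pw).
    by rewrite -/(paw (gdelta e A) a b c d) pw.
  apply: (@leq_trans #|A :|: [set (p.2, p.1) | p in A]|).
    apply/subset_leq_card/subsetP => -[u v]; rewrite in_diff !in_setT /= /gdelta in_setU.
    case uvA: ((u, v) \in A) => //=; case vuA: ((v, u) \in A) => //=.
      by move=> _; apply/imsetP; exists (v, u).
    by case: (e u v).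
  apply: leq_trans (leq_card_setU _ _) _; rewrite -addnn leq_add //.
  exact: leq_trans (leq_imset_card _ _) le_A.
pose A := [set p : 'I_(gn G) * 'I_(gn G) | (p.1 < p.2) && (e p.1 p.2 != f p.1 p.2)].
have inA u v : ((u, v) \in A) = (u < v) && (e u v != f u v) by rewrite in_set.
have Ef u v : gdelta e A u v = f u v.
  rewrite /gdelta !inA (sym v) (fs v); case: (ltngtP u v) => [_|_|/val_inj->]; last by rewrite irr fi.
    by case: (e u v); case: (f u v).
  by case: (e u v); case: (f u v).
exists A; split; first by move=> [u v]; rewrite inA => /andP[].
split; last first.
  move=> a b c d _; rewrite !Ef; exact: fp.
have swI : injective (fun p : 'I_(gn G) * 'I_(gn G) => (p.2, p.1)) by move=> [? ?] [? ?] [-> ->].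
rewrite -leq_double; apply: leq_trans le_k; rewrite -addnn.
rewrite -[X in _ + X <= _](card_imset _ swI) -cardsUI (_ : _ :&: _ = set0) ?cards0 ?addn0.
  apply/subset_leq_card/subsetP => -[u v]; rewrite in_setU in_diff !in_setT /=.
  case/orP=> [|/imsetP[[x y] + [-> ->]]]; rewrite inA => /andP[_ //].
  by rewrite sym fs.
apply/setP => -[u v]; rewrite in_setI in_set0 inA; apply/negP => /andP[/andP[lt_uv _]].
by case/imsetP=> -[x y] + [Eu Ev]; rewrite inA => /andP[/=]; rewrite -Eu -Ev ltnNge ltnW.
Qed.

(** No solution has more pairs than there are, so a counter capped at the number of matrix cells
    loses nothing. *)
Lemma PFEE_large G k : PFEE G (minn k (gn G * gn G)) <-> PFEE G k.
Proof.
split=> -[A [lt_A [le_A pf]]]; exists A; split=> //; split=> //.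
  by apply: leq_trans le_A (geq_minl _ _).
by rewrite leq_min le_A /= (leq_trans (max_card _)) // card_prod card_ord.
Qed.

Section Induced.
Variables (n : nat) (e : rel 'I_n) (K : {set 'I_n}).
Hypotheses (sym : symmetric e) (irr : irreflexive e).

Definition induced_adj : rel 'I_#|K| := fun i j => e (enum_val i) (enum_val j).
Lemma induced_sym i j : induced_adj i j = induced_adj j i. Proof. exact: sym. Qed.
Lemma induced_irr i : induced_adj i i = false. Proof. exact: irr. Qed.
Definition induced := Graph induced_sym induced_irr.

Lemma PFEE_induced k : PFEE induced k <-> yes e K k.
Proof.
have evK (i : 'I_#|K|) : enum_val i \in K by apply: enum_valP.
have injp : injective (fun p : 'I_#|K| * 'I_#|K| => (enum_val p.1 : 'I_n, enum_val p.2 : 'I_n)).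
  by move=> [a b] [c d] [/enum_val_inj-> /enum_val_inj->].
have rk u : u \in K -> exists i : 'I_#|K|, enum_val i = u.
  by move=> uK; exists (enum_rank_in uK u); rewrite enum_rankK_in.
apply: iff_trans (PFEE_yes _ _) _; split=> -[f [fs fi fp le_k]].
  pose g (u v : 'I_n) := [exists i : 'I_#|K|, exists j : 'I_#|K|,
    [&& enum_val i == u, enum_val j == v & f i j]].
  have gE (i j : 'I_#|K|) : g (enum_val i) (enum_val j) = f i j.
    apply/existsP/idP => [[i' /existsP[j' /and3P[/eqP/enum_val_inj-> /eqP/enum_val_inj->]]] //|fij].
    by exists i; apply/existsP; exists j; rewrite !eqxx.
  exists g; split.
  - move=> u v; apply/existsP/existsP => -[i /existsP[j /and3P[hi hj fij]]]; exists j;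
    by apply/existsP; exists i; rewrite hi hj fs.
  - move=> u; apply/negbTE/negP; case/existsP=> i /existsP[j /and3P[/eqP Ei /eqP Ej fij]].
    by move: fij; rewrite (enum_val_inj (etrans Ei (esym Ej))) fi.
  - move=> _ _ _ _ /rk[a <-] /rk[b <-] /rk[c <-] /rk[d <-]; rewrite /paw !gE.
    by apply: fp; rewrite in_setT.
  apply: leq_trans le_k; rewrite -(card_imset _ injp); apply/subset_leq_card/subsetP => -[u v].
  rewrite in_diff => /and3P[/rk[i <-] /rk[j <-] ne]; apply/imsetP; exists (i, j) => //.
  by rewrite in_diff !in_setT -gE.
exists (fun i j => f (enum_val i) (enum_val j)); split=> [i j|i|a b c d _ _ _ _|] //.
  exact: (fp (enum_val a) (enum_val b) (enum_val c) (enum_val d)).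
apply: leq_trans le_k; rewrite -(card_imset _ injp); apply/subset_leq_card/subsetP => _ /imsetP[[i j] + ->].
by rewrite !in_diff !in_setT !evK.
Qed.

End Induced.

Definition paw_adj : rel 'I_4 := fun i j =>
  (val i, val j) \in [:: (0, 1); (1, 0); (1, 2); (2, 1); (0, 2); (2, 0); (2, 3); (3, 2)].
Lemma paw_adj_sym i j : paw_adj i j = paw_adj j i.
Proof. by case: i j => [[|[|[|[|?]]]] // ?] [[|[|[|[|?]]]] // ?]. Qed.
Lemma paw_adj_irr i : paw_adj i i = false.
Proof. by case: i => [[|[|[|[|?]]]] // ?]. Qed.
Definition paw_graph := Graph paw_adj_sym paw_adj_irr.

Lemma PFEE_paw : ~ PFEE paw_graph 0.
Proof.
case=> A [_ []]; rewrite leqn0 cards_eq0 => /eqP-> pf.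
have := pf (@Ordinal 4 0 isT) (@Ordinal 4 1 isT) (@Ordinal 4 2 isT) (@Ordinal 4 3 isT).
by rewrite /gdelta !in_set0 => /(_ isT).
Qed.

End Instances.

(** * The kernelization program *)

Section Abstract.
Variables (V A F C : finType) (n : nat).

(** The store seen through vertices: arrays become relations on ['I_n], and entries out of range
    disappear. *)
Record ast := AS { am : A -> rel 'I_n; af : F -> bool; ac : C -> nat; ak : nat; ao : seq 'I_3 }.

Definition abs (st : store A F C) : ast :=
  AS (fun a i j => arr st a i j) (flg st) (cnt st) (kin st) (outp st).

Definition setm (st : ast) a R :=
  AS (fun b => if b == a then R else am st b) (af st) (ac st) (ak st) (ao st).
Definition updf (st : ast) f v :=
  AS (am st) (fun g => if g == f then v else af st g) (ac st) (ak st) (ao st).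
Definition updc (st : ast) c v :=
  AS (am st) (af st) (fun d => if d == c then v else ac st d) (ak st) (ao st).
Definition upda (R : rel 'I_n) i j b : rel 'I_n :=
  fun i' j' => if (i' == i) && (j' == j) then b else R i' j'.

Definition athr (st : ast) (o : option C) := if o is Some c then ac st c else 0.

Fixpoint abev (env : V -> 'I_n) (st : ast) (e : expr V A F C) : bool :=
  match e with
  | EArr a x y => am st a (env x) (env y)
  | EFlg f => af st f
  | EPos c => 0 < ac st c
  | EEq x y => env x == env y
  | ELt x y => env x < env y
  | ENot e => ~~ abev env st e
  | EAnd e1 e2 => abev env st e1 && abev env st e2
  | ECnt o x e => athr st o < #|[pred i | abev (upde env x i) st e]|
  end.

Fixpoint aeval (env : V -> 'I_n) (c : cmd V A F C) (st : ast) : ast :=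
  match c with
  | Skip => st
  | Seq c1 c2 => aeval env c2 (aeval env c1 st)
  | If e c1 c2 => if abev env st e then aeval env c1 st else aeval env c2 st
  | For x c => foldl (fun s i => aeval (upde env x i) c s) st (enum 'I_n)
  | SetA a x y e => setm st a (upda (am st a) (env x) (env y) (abev env st e))
  | SetF f e => updf st f (abev env st e)
  | Take f => let s := updf st f (0 < ak st) in AS (am s) (af s) (ac s) (ak st).-1 (ao s)
  | Push c => updc st c (minn (n * n) (ac st c).+1)
  | Pop c => updc st c (ac st c).-1
  | Out s => AS (am st) (af st) (ac st) (ak st) (rcons (ao st) s)
  end.

Lemma abevE env st e : beval env st e = abev env (abs st) e.
Proof.
elim: e env => //= [e IH env|e1 IH1 e2 IH2 env|o x e IH env]; rewrite ?IH ?IH1 ?IH2 //.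
by case: o => [c|] /=; congr (_ < _); apply: eq_card => i; rewrite !inE IH.
Qed.

Lemma aevalE env c st : abs (eval env c st) = aeval env c (abs st).
Proof.
elim: c env st => //= [c1 IH1 c2 IH2 env st|e c1 IH1 c2 IH2 env st|x c IH env st|a x y e env st|f e env st].
- by rewrite IH2 IH1.
- by rewrite abevE; case: ifP.
- by elim: (enum _) st => //= i l IHl st; rewrite IHl IH.
- rewrite /abs /setm /=; congr AS; apply: functional_extensionality => b.
  case: eqP => // _; apply: functional_extensionality => i; apply: functional_extensionality => j.
  by rewrite abevE.
by rewrite /abs /updf /= abevE.
Qed.

End Abstract.

Notation "''v' i" := (@Ordinal 8 i isT) (at level 8, i at level 2, format "''v' i").

Section Formulas.
Variables (A F C : finType) (mc : C).
Notation V := 'I_8.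

(* Formulas whose evaluation is syntactically the corresponding boolean
   expression; [XMany] counts against the threshold. *)
Inductive form :=
  | XArr of A & V & V | XFlg of F | XPos of C | XEq of V & V | XLt of V & V
  | XNot of form | XAnd of form & form | XOr of form & form | XImp of form & form
  | XIff of form & form | XEx of V & form | XAll of V & form | XMany of V & form.

Fixpoint expr_of (e : form) : expr V A F C :=
  match e with
  | XArr a x y => EArr F C a x y
  | XFlg f => EFlg V A C f
  | XPos c => EPos V A F c
  | XEq x y => EEq A F C x y
  | XLt x y => ELt A F C x y
  | XNot e => ENot (expr_of e)
  | XAnd e1 e2 => EAnd (expr_of e1) (expr_of e2)
  | XOr e1 e2 => ENot (EAnd (ENot (expr_of e1)) (ENot (expr_of e2)))
  | XImp e1 e2 => ENot (EAnd (expr_of e1) (ENot (expr_of e2)))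
  | XIff e1 e2 => EAnd (ENot (EAnd (expr_of e1) (ENot (expr_of e2)))) (ENot (EAnd (expr_of e2) (ENot (expr_of e1))))
  | XEx x e => ECnt None x (expr_of e)
  | XAll x e => ENot (ECnt None x (ENot (expr_of e)))
  | XMany x e => ECnt (Some mc) x (expr_of e)
  end.

Variables (n m : nat).
Notation ast := (ast A F C n).

Fixpoint xval (env : V -> 'I_n) (st : ast) (e : form) : bool :=
  match e with
  | XArr a x y => am st a (env x) (env y)
  | XFlg f => af st f
  | XPos c => 0 < ac st c
  | XEq x y => env x == env y
  | XLt x y => env x < env y
  | XNot e => ~~ xval env st e
  | XAnd e1 e2 => xval env st e1 && xval env st e2
  | XOr e1 e2 => xval env st e1 || xval env st e2
  | XImp e1 e2 => xval env st e1 ==> xval env st e2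
  | XIff e1 e2 => xval env st e1 == xval env st e2
  | XEx x e => [exists i, xval (upde env x i) st e]
  | XAll x e => [forall i, xval (upde env x i) st e]
  | XMany x e => m < #|[pred i | xval (upde env x i) st e]|
  end.

(** A set of vertices has at most [n] elements, so saturating the threshold at [n * n] never changes
    the comparison. *)
Lemma card_threshold (p : pred 'I_n) : (minn m (n * n) < #|p|) = (m < #|p|).
Proof.
rewrite gtn_min; case: ltnP => //= _; apply/negbTE; rewrite -leqNgt.
by apply: leq_trans (max_card _) _; rewrite card_ord; case: (n) => // n'; rewrite leq_pmulr.
Qed.

Lemma xvalE env st e : ac st mc = minn m (n * n) -> abev env st (expr_of e) = xval env st e.
Proof.
move=> thr; elim: e env => //=.
- by move=> e IH env; rewrite IH.
- by move=> e1 IH1 e2 IH2 env; rewrite IH1 IH2.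
- by move=> e1 IH1 e2 IH2 env; rewrite IH1 IH2 negb_and !negbK.
- by move=> e1 IH1 e2 IH2 env; rewrite IH1 IH2 negb_and negbK implybE.
- by move=> e1 IH1 e2 IH2 env; rewrite IH1 IH2; case: (xval _ _ e1); case: (xval _ _ e2).
- move=> x e IH env; rewrite lt0n; apply/existsP/existsP => -[i h]; exists i.
    by rewrite -IH.
  by rewrite /= IH.
- move=> x e IH env; rewrite lt0n negbK; apply/eqP/forallP => [/card0_eq h i|h].
    by have := h i; rewrite !inE IH => /negbFE.
  by apply: eq_card0 => i; rewrite !inE IH h.
move=> x e IH env; rewrite thr card_threshold; congr (_ < _); apply: eq_card => i.
by rewrite !inE IH.
Qed.

Definition Def (a : A) (e : form) : cmd V A F C := For 'v0 (For 'v1 (SetA a 'v0 'v1 (expr_of e))).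

(** The formula must not read the array that is being filled, because part of it is already
    overwritten when later entries are computed. *)
Lemma aeval_Def env st a e : ac st mc = minn m (n * n) ->
  (forall R env, xval env (setm st a R) e = xval env st e) ->
  aeval env (Def a e) st = setm st a (fun i j => xval (upde (upde env 'v0 i) 'v1 j) st e).
Proof.
move=> thr free; pose phi i j := xval (upde (upde env 'v0 i) 'v1 j) st e.
have updK R R' : setm (setm st a R) a R' = setm st a R'.
  by rewrite /setm /=; congr AS; apply: functional_extensionality => b; case: eqP.
have row i R l : foldl (fun s j => aeval (upde (upde env 'v0 i) 'v1 j) (SetA a 'v0 'v1 (expr_of e)) s)
    (setm st a R) l = setm st a (fun i' j => if (i' == i) && (j \in l) then phi i j else R i' j).
  elim: l R => [|j l IH] R /=.
    congr setm; apply: functional_extensionality => i'; apply: functional_extensionality => j.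
    by rewrite in_nil andbF.
  rewrite xvalE // free updK IH; congr setm.
  apply: functional_extensionality => i'; apply: functional_extensionality => j'.
  rewrite /= eqxx /upda in_cons /upde /=; case: (i' == i) => //=.
  by case: eqP => [->|]; case: (_ \in l).
have rows R l : foldl (fun s i => aeval (upde env 'v0 i) (For 'v1 (SetA a 'v0 'v1 (expr_of e))) s)
    (setm st a R) l = setm st a (fun i j => if i \in l then phi i j else R i j).
  elim: l R => [|i l IH] R.
    by congr setm.
  rewrite [foldl _ _ _]/= row IH; congr setm.
  apply: functional_extensionality => i'; apply: functional_extensionality => j'.
  rewrite in_cons mem_enum andbT; case: eqP => [->|] //=.
  by case: (_ \in l).
have {1}<- : setm st a (am st a) = st.
  case: (st) => M f c k o; rewrite /setm /=; congr AS; apply: functional_extensionality => b.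
  by case: eqP => // ->.
rewrite /= rows; congr setm; apply: functional_extensionality => i; apply: functional_extensionality => j.
by rewrite mem_enum.
Qed.

Lemma Def_is env st a e (R : rel 'I_n) : ac st mc = minn m (n * n) ->
  (forall R env, xval env (setm st a R) e = xval env st e) ->
  (forall i j, xval (upde (upde env 'v0 i) 'v1 j) st e = R i j) ->
  aeval env (Def a e) st = setm st a R.
Proof.
move=> thr free ER; rewrite aeval_Def //; congr setm.
by apply: functional_extensionality => i; apply: functional_extensionality => j.
Qed.

End Formulas.

Notation Arrs := 'I_16.
Notation Flgs := 'I_4.
Notation Cnts := 'I_2.
Notation aE := (@Ordinal 16 0 isT).
Notation aS := (@Ordinal 16 1 isT).
Notation ah := (@Ordinal 16 2 isT).
Notation aH := (@Ordinal 16 3 isT).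
Notation aSc := (@Ordinal 16 4 isT).
Notation aHc := (@Ordinal 16 5 isT).
Notation aFT := (@Ordinal 16 6 isT).
Notation aRP := (@Ordinal 16 7 isT).
Notation aAP := (@Ordinal 16 8 isT).
Notation aX := (@Ordinal 16 9 isT).
Notation aA := (@Ordinal 16 10 isT).
Notation aN := (@Ordinal 16 11 isT).
Notation aNT := (@Ordinal 16 12 isT).
Notation aM1 := (@Ordinal 16 13 isT).
Notation aM2 := (@Ordinal 16 14 isT).
Notation aK := (@Ordinal 16 15 isT).
Notation fTk := (@Ordinal 4 0 isT).
Notation fNo := (@Ordinal 4 1 isT).
Notation fFin := (@Ordinal 4 2 isT).
Notation fDn := (@Ordinal 4 3 isT).
(* [kc] holds the budget, [mc] the threshold [4 k + 4]; both saturate at [n * n],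
   which does not affect comparisons with the size of a set of vertices. *)
Notation kc := (@Ordinal 2 0 isT).
Notation mc := (@Ordinal 2 1 isT).

Notation fm := (form Arrs Flgs Cnts).
Notation code := (cmd 'I_8 Arrs Flgs Cnts).

Notation XA := (@XArr Arrs Flgs Cnts).
Notation XU a x := (XA a x x).
Notation ltx := (@XLt Arrs Flgs Cnts).
Notation eqx := (@XEq Arrs Flgs Cnts).
Infix "&&&" := (@XAnd Arrs Flgs Cnts) (at level 37, right associativity).
Infix "|||" := (@XOr Arrs Flgs Cnts) (at level 46, right associativity).
Notation nox := (@XNot Arrs Flgs Cnts).
Notation trx := (expr_of mc).
Notation Dfn := (@Def Arrs Flgs Cnts mc).
Notation "c1 ;; c2" := (Seq c1 c2) (at level 62, right associativity).

(* [Def] fills whole rows, whereas the greedy loops maintain [S] and [H] on the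
   diagonal only: [aSc] and [aHc] hold row-constant copies of [S] and [S :|: H]. *)
Definition fTri x y z : fm := XA aE x y &&& XA aE y z &&& XA aE x z.
Definition fAvoid x y z : fm :=
  nox (XU aSc x) &&& nox (XU aSc y) &&& nox (XU aSc z) &&& fTri x y z.

Definition fSc : fm := XU aS 'v0.
Definition fHc : fm := XU aS 'v0 ||| XU aH 'v0.
Definition fFT : fm := XAll 'v2 (XIff (XA aE 'v2 'v0) (XA aE 'v2 'v1)).
Definition fRP : fm := XAll 'v2 (nox (ltx 'v2 'v0 &&& XA aFT 'v2 'v0)).
Definition fAP : fm := XA aE 'v0 'v1 &&& XAll 'v2 (XImp (nox (XIff (XA aE 'v2 'v0) (XA aE 'v2 'v1)))
    (XA aFT 'v2 'v0 ||| XA aFT 'v2 'v1)).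
Definition fX : fm := nox (XEx 'v2 (XEx 'v3 (fAvoid 'v0 'v2 'v3 &&& XAll 'v4 (XImp (XU aSc 'v4)
      (nox (XA aE 'v4 'v0 ||| XA aE 'v4 'v2 ||| XA aE 'v4 'v3)))))) &&&
    nox (XMany 'v2 (ltx 'v2 'v0 &&& XA aFT 'v2 'v0)) &&&
    nox (XMany 'v2 (ltx 'v2 'v0 &&& XU aRP 'v2 &&& XA aAP 'v2 'v0)).
Definition fA : fm := XU aX 'v0 &&& (XU aHc 'v0 ||| XEx 'v2 (XEx 'v3 (fAvoid 'v0 'v2 'v3)) |||
    (nox (XU aHc 'v0) &&& XEx 'v2 (XEx 'v3 (nox (XU aHc 'v2) &&& XU aHc 'v3 &&& fTri 'v0 'v2 'v3)))).
Definition fN : fm := nox (XU aA 'v0) &&& XU aX 'v0.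
Definition fNT : fm := nox (XEx 'v2 (XU aX 'v2 &&& XEx 'v3 (XU aX 'v3 &&& fTri 'v0 'v2 'v3))).
Definition fM1 : fm := XU aN 'v0 &&& XU aNT 'v0 &&& XEx 'v2 (XU aA 'v2 &&& XA aE 'v0 'v2 &&&
    nox (XMany 'v3 (ltx 'v3 'v0 &&& XU aN 'v3 &&& XU aNT 'v3 &&& XA aE 'v3 'v2))).
Definition fM2 : fm := XU aN 'v0 &&& XEx 'v2 (XU aM1 'v2 &&& XA aE 'v0 'v2 &&&
    nox (XMany 'v3 (ltx 'v3 'v0 &&& XU aN 'v3 &&& XA aE 'v3 'v2))).
Definition fK : fm := XU aA 'v0 ||| XU aM1 'v0 ||| XU aM2 'v0 |||
    (XU aN 'v0 &&& XEx 'v2 (XEx 'v3 (XU aSc 'v2 &&& XU aA 'v2 &&& XU aA 'v3 &&&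
      nox (XMany 'v4 (ltx 'v4 'v0 &&& XU aN 'v4 &&&
        XIff (XA aE 'v4 'v2) (XA aE 'v0 'v2) &&& XIff (XA aE 'v4 'v3) (XA aE 'v0 'v3)))))).

Definition Kernel : code :=
  Dfn aSc fSc ;; Dfn aHc fHc ;; Dfn aFT fFT ;; Dfn aRP fRP ;; Dfn aAP fAP ;; Dfn aX fX ;; Dfn aA fA ;; Dfn aN fN ;; Dfn aNT fNT ;; Dfn aM1 fM1 ;; Dfn aM2 fM2 ;; Dfn aK fK.

Section Run.
Variables (n m : nat).
Notation state := (ast Arrs Flgs Cnts n).
Notation env_t := ('I_8 -> 'I_n).
Implicit Types (st : state) (env : env_t).

Definition diag (R : rel 'I_n) : {set 'I_n} := [set i | R i i].

Lemma in_diag R i : (i \in diag R) = R i i. Proof. by rewrite in_set. Qed.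

Lemma aeval_Seq env (c1 c2 : code) st : aeval env (c1 ;; c2) st = aeval env c2 (aeval env c1 st).
Proof. by []. Qed.

Lemma Kernel_spec env st : ac st mc = minn m (n * n) ->
  let st' := aeval env Kernel st in
  [/\ af st' = af st, ac st' = ac st, ao st' = ao st, am st' aE = am st aE &
    am st' aK = fun i _ => i \in kernel (am st aE) (diag (am st aS)) (diag (am st aH)) m].
Proof.
move: {-2}(am st aE) (erefl (am st aE)) => e Ee.
move: {-2}(diag (am st aS)) (erefl (diag (am st aS))) => S ES.
move: {-2}(diag (am st aH)) (erefl (diag (am st aH))) => H EH thr.
have D a f R st' : ac st' mc = minn m (n * n) ->
    (forall R env, xval m env (setm st' a R) f = xval m env st' f) ->
    (forall i j, xval m (upde (upde env 'v0 i) 'v1 j) st' f = R i j) ->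
    aeval env (Dfn a f) st' = setm st' a R by apply: Def_is.
pose inS (X : {set 'I_n}) : rel 'I_n := fun i _ => i \in X.
have dSc st' : ac st' mc = minn m (n * n) -> S = diag (am st' aS) ->
    aeval env (Dfn aSc fSc) st' = setm st' aSc (inS S).
  by move=> t E; apply: D => // i j; rewrite /inS E in_diag.
have dHc st' : ac st' mc = minn m (n * n) -> S = diag (am st' aS) -> H = diag (am st' aH) ->
    aeval env (Dfn aHc fHc) st' = setm st' aHc (inS (S :|: H)).
  by move=> t E E'; apply: D => // i j; rewrite /inS in_setU E E' !in_diag.
have dFT st' : ac st' mc = minn m (n * n) -> am st' aE = e ->
    aeval env (Dfn aFT fFT) st' = setm st' aFT (ft e).
  by move=> t E; apply: D => // i j; rewrite /= E.
have dRP st' : ac st' mc = minn m (n * n) -> am st' aFT = ft e ->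
    aeval env (Dfn aRP fRP) st' = setm st' aRP (fun i _ => leader e i).
  by move=> t E; apply: D => // i j; rewrite /= E.
have dAP st' : ac st' mc = minn m (n * n) -> am st' aE = e -> am st' aFT = ft e ->
    aeval env (Dfn aAP fAP) st' = setm st' aAP (ap e).
  by move=> t E E'; apply: D => // i j; rewrite /= E E'.
have dX st' : ac st' mc = minn m (n * n) -> am st' aE = e -> am st' aFT = ft e ->
    am st' aSc = inS S -> am st' aRP = (fun i _ => leader e i) -> am st' aAP = ap e ->
    aeval env (Dfn aX fX) st' = setm st' aX (inS (reduced e S m)).
  move=> t E1 E2 E3 E4 E5; apply: D => // i j.
  by rewrite /= E1 E2 E3 E4 E5 /inS [RHS]in_set.
have dA st' : ac st' mc = minn m (n * n) -> am st' aE = e -> am st' aX = inS (reduced e S m) ->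
    am st' aSc = inS S -> am st' aHc = inS (S :|: H) ->
    aeval env (Dfn aA fA) st' = setm st' aA (inS (core e S H m)).
  move=> t E1 E2 E3 E4; apply: D => // i j.
  by rewrite /= E1 E2 E3 E4 /inS [RHS]in_set.
have dN st' : ac st' mc = minn m (n * n) -> am st' aX = inS (reduced e S m) ->
    am st' aA = inS (core e S H m) ->
    aeval env (Dfn aN fN) st' = setm st' aN (inS (rest e S H m)).
  by move=> t E1 E2; apply: D => // i j; rewrite /= E1 E2 /inS in_setD.
pose nt i := ~~ tri_in e (reduced e S m) i.
have dNT st' : ac st' mc = minn m (n * n) -> am st' aE = e -> am st' aX = inS (reduced e S m) ->
    aeval env (Dfn aNT fNT) st' = setm st' aNT (fun i _ => nt i).
  by move=> t E1 E2; apply: D => // i j; rewrite /= E1 E2.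
have dM1 st' : ac st' mc = minn m (n * n) -> am st' aE = e -> am st' aN = inS (rest e S H m) ->
    am st' aNT = (fun i _ => nt i) -> am st' aA = inS (core e S H m) ->
    aeval env (Dfn aM1 fM1) st' = setm st' aM1 (fun i _ => mark1 e S H m i).
  by move=> t E1 E2 E3 E4; apply: D => // i j; rewrite /= E1 E2 E3 E4.
have dM2 st' : ac st' mc = minn m (n * n) -> am st' aE = e -> am st' aN = inS (rest e S H m) ->
    am st' aM1 = (fun i _ => mark1 e S H m i) ->
    aeval env (Dfn aM2 fM2) st' = setm st' aM2 (fun i _ => mark2 e S H m i).
  by move=> t E1 E2 E3; apply: D => // i j; rewrite /= E1 E2 E3.
have dK st' : ac st' mc = minn m (n * n) -> am st' aE = e -> am st' aN = inS (rest e S H m) ->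
    am st' aSc = inS S -> am st' aA = inS (core e S H m) ->
    am st' aM1 = (fun i _ => mark1 e S H m i) -> am st' aM2 = (fun i _ => mark2 e S H m i) ->
    aeval env (Dfn aK fK) st' = setm st' aK (inS (kernel e S H m)).
  move=> t E1 E2 E3 E4 E5 E6; apply: D => // i j.
  by rewrite /= E1 E2 E3 E4 E5 E6 /inS [RHS]in_set.
cbv zeta; suff : [/\ af (aeval env Kernel st) = af st, ac (aeval env Kernel st) = ac st,
    ao (aeval env Kernel st) = ao st, am (aeval env Kernel st) aE = e &
    am (aeval env Kernel st) aK = inS (kernel e S H m)] by [].
have E0 : ac st mc = minn m (n * n) := thr.
clear D thr; move: dSc dHc dFT dRP dAP dX dA dN dNT dM1 dM2 dK.
move: (inS S) (inS (S :|: H)) (ft e) (fun i (_ : 'I_n) => leader e i) (ap e).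
move: (inS (reduced e S m)) (inS (core e S H m)) (inS (rest e S H m)) (fun i (_ : 'I_n) => nt i).
move: (fun i (_ : 'I_n) => mark1 e S H m i) (fun i (_ : 'I_n) => mark2 e S H m i).
move: (inS (kernel e S H m)); clear inS nt.
move=> rK r2 r1 rNT rN rA rX rAP rL rFT rSH rS dSc dHc dFT dRP dAP dX dA dN dNT dM1 dM2 dK.
rewrite /Kernel !aeval_Seq dSc // dHc // dFT // dRP // dAP // dX // dA //.
rewrite dN // dNT // dM1 // dM2 // dK //.
Qed.

End Run.

(** * Greedy packings, forced edits and rounds as programs *)

Definition fPaw : fm := XA aE 'v0 'v1 &&& XA aE 'v1 'v2 &&& XA aE 'v0 'v2 &&& XA aE 'v2 'v3 &&&
  nox (XA aE 'v0 'v3) &&& nox (XA aE 'v1 'v3).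
(** The language has no truth constants. In [fPack] this formula also fills the place of the trivial
    base condition. *)
Definition fTT x : fm := eqx x x.
Definition fFF x : fm := nox (eqx x x).
Definition fTwo z : fm := (XU z 'v0 &&& XU z 'v1) ||| (XU z 'v0 &&& XU z 'v2) |||
  (XU z 'v0 &&& XU z 'v3) ||| (XU z 'v1 &&& XU z 'v2) ||| (XU z 'v1 &&& XU z 'v3) |||
  (XU z 'v2 &&& XU z 'v3).
Definition fThree z : fm := (XU z 'v0 &&& XU z 'v1 &&& XU z 'v2) |||
  (XU z 'v0 &&& XU z 'v1 &&& XU z 'v3) ||| (XU z 'v0 &&& XU z 'v2 &&& XU z 'v3) |||
  (XU z 'v1 &&& XU z 'v2 &&& XU z 'v3).
Definition fIn4 x : fm := eqx x 'v0 ||| eqx x 'v1 ||| eqx x 'v2 ||| eqx x 'v3.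
Definition fPack : fm := fPaw &&& fTT 'v0 &&& nox (fTwo aS).
Definition fPetal : fm := fPaw &&& (fIn4 'v4 &&& fIn4 'v5) &&& nox (fThree ah).

Definition Mk z x : code := SetA z x x (trx (fTT x)).
Definition Greedy z f : code := For 'v0 (For 'v1 (For 'v2 (For 'v3
  (If (trx f) (Mk z 'v0 ;; Mk z 'v1 ;; Mk z 'v2 ;; Mk z 'v3) (Skip _ _ _ _))))).
Definition SetT f x : code := SetF f (trx (fTT x)).
(** The second assignment copies the entry just negated, which keeps the matrix symmetric. *)
Definition Flip : code := SetA aE 'v4 'v5 (trx (nox (XA aE 'v4 'v5))) ;;
  SetA aE 'v5 'v4 (trx (XA aE 'v4 'v5)) ;; Pop _ _ _ kc ;; SetT fDn 'v4.
(** [fNo] records a no-instance, [fFin] the end of all rounds, [fDn] the end of the current scan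
    over the pairs. *)
Definition Fail x : code := SetT fNo x ;; SetT fFin x ;; SetT fDn x.
(** The union passes through [aHc] because [Def] may not read the array it fills. *)
Definition Merge : code := Dfn aHc (XU aH 'v0 ||| XU ah 'v0) ;; Dfn aH (XU aHc 'v0).
Definition Pair : code := Dfn ah (eqx 'v0 'v4 ||| eqx 'v0 'v5) ;; Greedy ah fPetal ;;
  If (trx (XMany 'v0 (XU ah 'v0))) (If (EPos _ _ _ kc) Flip (Fail 'v4)) Merge.
Definition Pairs : code := For 'v4 (For 'v5
  (If (trx (XU aS 'v4 &&& XU aS 'v5 &&& nox (eqx 'v4 'v5) &&& nox (@XFlg Arrs Flgs Cnts fDn)))
     Pair (Skip _ _ _ _))).
Definition Body : code := Dfn aS (fFF 'v0) ;; Greedy aS fPack ;;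
  If (trx (XMany 'v0 (XU aS 'v0))) (Fail 'v6)
    (SetF fDn (trx (fFF 'v6)) ;; Dfn aH (fFF 'v0) ;; Pairs ;;
     If (EFlg _ _ _ fDn) (Skip _ _ _ _) (SetT fFin 'v6)).
Definition Rounds : code := For 'v6 (If (EFlg _ _ _ fFin) (Skip _ _ _ _) Body).

Section Run.
Variables (n m : nat).
Notation state := (ast Arrs Flgs Cnts n).
Notation env_t := ('I_8 -> 'I_n).
Implicit Types (st : state) (env : env_t).

Lemma aeval_For env x (c : code) st :
  aeval env (For x c) st = foldl (fun s i => aeval (upde env x i) c s) st (enum 'I_n).
Proof. by []. Qed.

Lemma aeval_If env f (c1 c2 : code) st : ac st mc = minn m (n * n) ->
  aeval env (If (trx f) c1 c2) st = if xval m env st f then aeval env c1 st else aeval env c2 st.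
Proof. by move=> thr; rewrite -(xvalE _ _ thr). Qed.

Lemma setm_setm st a R R' : setm (setm st a R) a R' = setm st a R'.
Proof. by rewrite /setm /=; congr AS; apply: functional_extensionality => b; case: eqP. Qed.

Lemma setm_id st a : setm st a (am st a) = st.
Proof.
case: st => M f c k o; rewrite /setm /=; congr AS; apply: functional_extensionality => b.
by case: eqP => // ->.
Qed.

Lemma foldl_sim (S1 S2 T : Type) (rel : S1 -> S2 -> Prop) (f : S1 -> T -> S1) (g : S2 -> T -> S2) s z l :
  (forall s z x, rel s z -> rel (f s x) (g z x)) -> rel s z -> rel (foldl f s l) (foldl g z l).
Proof. by move=> h; elim: l s z => //= x l IH s z r; apply/IH/h. Qed.

Lemma diag_upda (R : rel 'I_n) a : diag (upda R a a true) = a |: diag R.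
Proof. by apply/setP => i; rewrite in_setU1 !in_diag /upda; case: eqP. Qed.

Lemma Mk_spec env st z x R :
  aeval env (Mk z x) (setm st z R) = setm st z (upda R (env x) (env x) true).
Proof. by rewrite /Mk /= setm_setm eqxx /= eqxx. Qed.

Lemma Greedy_spec env st z f base j : ac st mc = minn m (n * n) ->
  (forall R a b c d,
    xval m (upde (upde (upde (upde env 'v0 a) 'v1 b) 'v2 c) 'v3 d) (setm st z R) f =
    [&& paw (am st aE) a b c d, base a b c d & cnt4 (diag R) a b c d <= j]) ->
  exists R, aeval env (Greedy z f) st = setm st z R /\
    diag R = grow (am st aE) base j (diag (am st z)).
Proof.
move=> thr valf; pose sim s Z := exists R, s = setm st z R /\ diag R = Z.
rewrite -/(sim _ _) /Greedy /grow aeval_For.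
have sim0 : sim st (diag (am st z)) by exists (am st z); rewrite setm_id.
apply: foldl_sim sim0 => _ Z0 a [R0 [-> <-]]; rewrite aeval_For.
apply: foldl_sim; last by exists R0.
move=> _ Z1 b [R1 [-> <-]]; rewrite aeval_For.
apply: foldl_sim; last by exists R1.
move=> _ Z2 c [R2 [-> <-]]; rewrite aeval_For.
apply: foldl_sim; last by exists R2.
move=> _ Z3 d [R [-> <-]]; rewrite aeval_If // valf /grow_step.
case: ifP => _; last by exists R.
rewrite !aeval_Seq !Mk_spec; eexists; split; first by [].
by rewrite !diag_upda.
Qed.

Lemma fPack_val env st R a b c d :
  xval m (upde (upde (upde (upde env 'v0 a) 'v1 b) 'v2 c) 'v3 d) (setm st aS R) fPack =
    [&& paw (am st aE) a b c d, true & cnt4 (diag R) a b c d <= 1].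
Proof.
rewrite -[LHS]/(paw (am st aE) a b c d && (_ && _)); congr (_ && _).
rewrite /= eqxx /upde /= /cnt4 !in_diag.
by case: (R a a); case: (R b b); case: (R c c); case: (R d d).
Qed.

Lemma fPetal_val env st R a b c d :
  xval m (upde (upde (upde (upde env 'v0 a) 'v1 b) 'v2 c) 'v3 d) (setm st ah R) fPetal =
    [&& paw (am st aE) a b c d, (env 'v4 \in [:: a; b; c; d]) && (env 'v5 \in [:: a; b; c; d])
      & cnt4 (diag R) a b c d <= 2].
Proof.
rewrite -[LHS]/(paw (am st aE) a b c d && (_ && _)); congr (_ && _).
rewrite !in_cons !in_nil !orbF; congr (_ && _).
rewrite /= /upde /= /cnt4 !in_diag.
by case: (R a a); case: (R b b); case: (R c c); case: (R d d).
Qed.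

(** Iteration [i] establishes [P i], and every iteration preserves all [P j]; hence all hold at the
    end. *)
Lemma for_rule env x (c : code) (I : state -> Prop) (P : 'I_n -> state -> Prop) st : I st ->
  (forall i s, I s -> [/\ I (aeval (upde env x i) c s), P i (aeval (upde env x i) c s) &
     forall j, P j s -> P j (aeval (upde env x i) c s)]) ->
  I (aeval env (For x c) st) /\ forall i, P i (aeval env (For x c) st).
Proof.
move=> Ist step; rewrite aeval_For.
suff : I (foldl (fun s i => aeval (upde env x i) c s) st (enum 'I_n)) /\
   forall i, i \in enum 'I_n -> P i (foldl (fun s i => aeval (upde env x i) c s) st (enum 'I_n)).
  by case=> hI hP; split=> // i; apply: hP; rewrite mem_enum.
elim/last_ind: (enum 'I_n) => [|l j [IHI IHP]]; first by split.
rewrite foldl_rcons; have [hI hP hS] := step j _ IHI; split=> // i.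
by rewrite mem_rcons inE => /predU1P[->|/IHP/hS].
Qed.

Section Loop.
Variables (e : rel 'I_n) (S : {set 'I_n}) (k : nat) (o : seq 'I_3).
Hypotheses (sym : symmetric e) (irr : irreflexive e).

Definition covered st := forall x, x \in diag (am st aH) -> exists s t,
  [/\ s \in S, t \in S, s != t, #|petals e s t| <= m & x \in petals e s t].

Definition clean st := [/\ am st aE = e, diag (am st aS) = S, ac st kc = k,
  ~~ af st fNo && ~~ af st fFin & covered st].

(** A forced pair ends the scan: without budget the instance is rejected, otherwise the pair is
    flipped. [e] and [k] are the graph and the budget at the start of the scan. *)
Definition stopped st := exists s t, [/\ s != t, m < #|petals e s t| &
  [/\ k = 0, af st fNo, af st fFin & am st aE = e] \/
  [/\ 0 < k, ac st kc = k.-1, ~~ af st fNo, ~~ af st fFin & am st aE = flip e s t]].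

Definition loop_inv st := [/\ ac st mc = minn m (n * n), ao st = o &
  if af st fDn then stopped st else clean st].

Definition pair_done s t st :=
  af st fDn || ([&& s \in S, t \in S & s != t] ==> (petals e s t \subset diag (am st aH))).

Lemma Flip_spec env st : am st aE = e -> let st' := aeval env Flip st in
  [/\ am st' aE = flip e (env 'v4) (env 'v5), ac st' = (fun d => if d == kc then (ac st kc).-1 else ac st d),
      ao st' = ao st & af st' = (fun g => if g == fDn then true else af st g)].
Proof.
move=> Ee; split=> //; last first.
  by apply: functional_extensionality => g; rewrite /= eqxx.
apply: functional_extensionality => u; apply: functional_extensionality => v.
rewrite /= /upda /= Ee !eqxx /= /flip.
case h: ((u == env 'v5) && (v == env 'v4)).
  by case/andP: h => /eqP-> /eqP->; rewrite orbT sym.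
by rewrite orbF; case: ifP => // /andP[/eqP-> /eqP->].
Qed.

Lemma Fail_spec env x st : let st' := aeval env (Fail x) st in
  [/\ am st' = am st, ac st' = ac st, ao st' = ao st &
    af st' = (fun g => [|| g == fNo, g == fFin, g == fDn | af st g])].
Proof.
split=> //; apply: functional_extensionality => g; rewrite /= eqxx.
by case: (g =P fDn) => [->|] //; case: (g =P fFin) => [->|] //; case: (g =P fNo).
Qed.

Lemma Merge_spec env st : ac st mc = minn m (n * n) -> let st' := aeval env Merge st in
  [/\ forall a, a != aHc -> a != aH -> am st' a = am st a,
    diag (am st' aH) = diag (am st aH) :|: diag (am st ah),
    ac st' = ac st, ao st' = ao st & af st' = af st].
Proof.
move=> thr; rewrite /Merge aeval_Seq.
rewrite (@Def_is _ _ _ mc n m env st aHc _ (fun i _ => am st aH i i || am st ah i i)) //.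
rewrite (@Def_is _ _ _ mc n m env _ aH _ (fun i _ => am st aH i i || am st ah i i)) //.
split=> // [a /negbTE nHc /negbTE nH|]; first by rewrite /= nHc nH.
by apply/setP => i; rewrite in_setU !in_diag.
Qed.

Lemma Pair_head env st : ac st mc = minn m (n * n) -> am st aE = e ->
  exists R, aeval env (Dfn ah (eqx 'v0 'v4 ||| eqx 'v0 'v5) ;; Greedy ah fPetal) st = setm st ah R /\
    diag R = petals e (env 'v4) (env 'v5).
Proof.
move=> thr Ee; rewrite aeval_Seq.
rewrite (@Def_is _ _ _ mc n m env st ah _ (fun i _ => (i == env 'v4) || (i == env 'v5))) //.
set st1 := setm st ah _; have E1 : am st1 aE = e by [].
have [R [-> ER]] := @Greedy_spec env st1 ah fPetal _ 2 thr (fPetal_val env st1).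
exists R; rewrite setm_setm ER E1; split=> //; congr (grow _ _ _ _).
by apply/setP => i; rewrite in_diag in_set2.
Qed.

Lemma Pair_spec env st : loop_inv st -> ~~ af st fDn -> env 'v4 \in S -> env 'v5 \in S ->
  env 'v4 != env 'v5 -> let st' := aeval env Pair st in
  [/\ loop_inv st', pair_done (env 'v4) (env 'v5) st' &
     forall s t, pair_done s t st -> pair_done s t st'].
Proof.
set s := env 'v4; set t := env 'v5; move=> [thr Eo] + nd sS tS st_neq.
rewrite (negbTE nd) => -[Ee ES Ek nnf cov].
have [R [E ER]] := Pair_head env thr Ee; rewrite -/s -/t in ER.
rewrite /Pair; cbv zeta; rewrite aeval_Seq in E; rewrite !aeval_Seq E.
rewrite aeval_If //; set st1 := setm st ah R.
have thr1 : ac st1 mc = minn m (n * n) by [].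
have -> : xval m env st1 (XMany 'v0 (XU ah 'v0)) = (m < #|petals e s t|).
  by rewrite -ER /=; congr (_ < _); apply: eq_card => i; rewrite in_diag.
case: ltnP => lt_m; last first.
  have [Em EH Ec Eo' Ef] := Merge_spec env thr1.
  move: (aeval env Merge st1) Em EH Ec Eo' Ef => st2 Em EH Ec Eo' Ef.
  have {}EH : diag (am st2 aH) = diag (am st aH) :|: petals e s t by rewrite EH -ER.
  have nd2 : af st2 fDn = false by rewrite Ef; apply: negbTE.
  split.
  - split; rewrite ?Ec ?Eo' // nd2; split; rewrite ?Em ?Ec ?Ef //.
    move=> x; rewrite EH in_setU => /orP[/cov //|xp]; exists s, t; by split.
  - by rewrite /pair_done EH subsetUr implybT orbT.
  move=> s' t'; rewrite /pair_done nd2 (negbTE nd) EH => /implyP h; apply/implyP => /h /subset_trans.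
  by apply; apply: subsetUl.
have done2 s' t' st2 : af st2 fDn -> pair_done s' t' st2 by rewrite /pair_done => ->.
have EIf : aeval env (If (EPos _ _ _ kc) Flip (Fail 'v4)) st1 =
  if 0 < k then aeval env Flip st1 else aeval env (Fail 'v4) st1 by rewrite /= Ek.
case: (posnP k) => k0; rewrite k0 in EIf; rewrite {}EIf.
  have [Em Ec Eo' Ef] := Fail_spec env 'v4 st1.
  move: (aeval env _ st1) Em Ec Eo' Ef => st2 Em Ec Eo' Ef.
  split=> [||? ? _]; try by apply: done2; rewrite Ef.
  split; rewrite ?Ec ?Eo' // Ef /=; exists s, t; split=> //; left; split=> //; by rewrite ?Ef ?Em.
have [] := Flip_spec env (st := st1) Ee.
move: (aeval env _ st1) => st2 Em Ec Eo' Ef.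
split=> [||? ? _]; try by apply: done2; rewrite Ef.
split; rewrite ?Ec ?Eo' // Ef /=; exists s, t; split=> //; right.
by case/andP: nnf => nno nfin; split=> //; rewrite ?Ec ?Ef //= Ek.
Qed.

Lemma Pairs_spec env st : loop_inv st -> let st' := aeval env Pairs st in
  loop_inv st' /\ forall s t, pair_done s t st'.
Proof.
move=> Ist; rewrite /Pairs; cbv zeta.
set body := If _ Pair _.
have step env' st0 : loop_inv st0 -> let st' := aeval env' body st0 in
    [/\ loop_inv st', pair_done (env' 'v4) (env' 'v5) st' &
     forall s t, pair_done s t st0 -> pair_done s t st'].
  move=> I0; have [thr _ h] := I0; rewrite /body; cbv zeta; rewrite aeval_If //.
  rewrite [xval _ _ _ _]/= -/(am st0 aS).
  case: ifP => [/and4P[sS tS ne nd]|/negbT].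
    move: h; rewrite (negbTE nd) => -[_ ES _ _ _].
    by apply: Pair_spec; rewrite // -?ES ?in_diag.
  move=> nh; split=> //; rewrite /pair_done; case: (boolP (af st0 fDn)) => //= nd.
  move: h; rewrite (negbTE nd) => -[_ ES _ _ _]; apply/implyP => /and3P[sS tS ne].
  case/negP: nh; move: sS tS; rewrite -ES !in_diag => sS tS.
  by rewrite /= sS tS ne nd.
pose P s st1 := forall t, pair_done s t st1.
apply: (@for_rule env 'v4 _ loop_inv P) => // i s0 I0.
(* The parameter [Q] transports through the inner loop what the outer loop has established for other
   rows. *)
have inner (Q : state -> Prop) : Q s0 ->
   (forall s t st1, loop_inv st1 -> Q st1 -> Q (aeval (upde (upde env 'v4 s) 'v5 t) body st1)) ->
   (loop_inv (aeval (upde env 'v4 i) (For 'v5 body) s0) /\ Q (aeval (upde env 'v4 i) (For 'v5 body) s0))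
   /\ P i (aeval (upde env 'v4 i) (For 'v5 body) s0).
  move=> Q0 Qs; apply: (@for_rule _ 'v5 body (fun s => loop_inv s /\ Q s) (fun j => pair_done i j)).
    by split.
  move=> j s1 [I1 Q1]; have [I2 D2 S2] := step (upde (upde env 'v4 i) 'v5 j) s1 I1.
  by split=> //; [split=> //; apply: Qs|move=> j'; apply: S2].
split.
- by have [[]] := inner (fun _ => True) I (fun _ _ _ _ _ => I).
- by have [[]] := inner (fun _ => True) I (fun _ _ _ _ _ => I).
move=> j Pj; suff Ps : forall s t st1, loop_inv st1 -> P j st1 ->
    P j (aeval (upde (upde env 'v4 s) 'v5 t) body st1) by have [[]] := inner (P j) Pj Ps.
by move=> s t st1 I1 P1 t'; have [_ _ keep] := step (upde (upde env 'v4 s) 'v5 t) st1 I1; apply: keep.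
Qed.

End Loop.
End Run.

Section Run.
Variables (n m : nat).
Notation state := (ast Arrs Flgs Cnts n).
Notation env_t := ('I_8 -> 'I_n).
Implicit Types (st : state) (env : env_t) (e : rel 'I_n).

Definition good (e : rel 'I_n) (S H : {set 'I_n}) :=
  [/\ forall a b c d, paw e a b c d -> 1 < cnt4 S a b c d,
      forall a b c d, paw e a b c d -> 2 < cnt4 (S :|: H) a b c d, #|S| <= m & #|H| <= m ^ 3].

Lemma cnt4_two (S : {set 'I_n}) a b c d : uniq [:: a; b; c; d] -> 1 < cnt4 S a b c d ->
  exists s t, [/\ s != t, s \in S, t \in S, s \in [:: a; b; c; d] & t \in [:: a; b; c; d]].
Proof.
move=> uq; have -> : cnt4 S a b c d = size [seq x <- [:: a; b; c; d] | x \in S].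
  by rewrite size_filter /= addn0 !addnA.
have := filter_uniq (mem S) uq; have := mem_filter (mem S) ^~ [:: a; b; c; d].
case: [seq x <- _ | _] => [|s [|t l]] //= memq /andP[+ _] _; rewrite inE negb_or => /andP[st _].
have := memq s; have := memq t; rewrite !in_cons !eqxx orbT /=.
by move=> /esym/andP[tS tq] /esym/andP[sS sq]; exists s, t; split.
Qed.

Lemma cnt4_mono (S S' : {set 'I_n}) a b c d : S \subset S' -> cnt4 S a b c d <= cnt4 S' a b c d.
Proof.
move=> /subsetP s12; have le x : (x \in S) <= (x \in S') by case h: (x \in S) => //; rewrite s12.
by rewrite /cnt4 !leq_add.
Qed.

(** A paw has two vertices [s], [t] in the packing, and the petals of this pair contain a third one.
    At most [m ^ 2] pairs with at most [m] petal vertices each give the cube. *)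
Lemma good_petals e (H : {set 'I_n}) : symmetric e -> irreflexive e ->
  #|packing e| <= m ->
  (forall s t, s \in packing e -> t \in packing e -> s != t -> petals e s t \subset H) ->
  (forall x, x \in H -> exists s t, [/\ s \in packing e, t \in packing e, s != t,
     #|petals e s t| <= m & x \in petals e s t]) -> good e (packing e) H.
Proof.
move=> sym irr leS subH covH; split=> // [a b c d|a b c d pw|]; first exact: packing_paw.
  have [s [t [st sS tS sq tq]]] := cnt4_two (paw_uniq sym irr pw) (packing_paw pw).
  apply: leq_trans (petals_paw pw sq tq) (cnt4_mono _ _ _ _ _).
  by apply: subset_trans (subH s t sS tS st) _; apply: subsetUr.
pose P := [set p : 'I_n * 'I_n | [&& p.1 \in packing e, p.2 \in packing e & #|petals e p.1 p.2| <= m]].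
have inP s t : ((s, t) \in P) = [&& s \in packing e, t \in packing e & #|petals e s t| <= m].
  by rewrite in_set.
apply: (@leq_trans (#|P| * m)).
  apply: (card_cover (F := fun p => petals e p.1 p.2)) => [[s t]|x /covH[s [t [sS tS _ le xp]]]].
    by rewrite inP => /and3P[].
  by exists (s, t); rewrite ?inP ?sS ?tS.
rewrite expnSr leq_mul2r; apply/orP; right.
apply: (@leq_trans #|setX (packing e) (packing e)|); last by rewrite cardsX leq_mul.
by apply/subset_leq_card/subsetP => -[s t]; rewrite inP in_setX => /and3P[-> ->].
Qed.

Lemma Body_spec env st : ac st mc = minn m (n * n) -> ~~ af st fNo -> ~~ af st fFin ->
  symmetric (am st aE) -> irreflexive (am st aE) -> 4 * ac st kc + 4 <= m ->
  let st' := aeval env Body st in let e := am st aE in let k := ac st kc in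
  [/\ ac st' mc = minn m (n * n), ao st' = ao st &
   [\/ [/\ af st' fNo /\ af st' fFin, am st' aE = e & ~ yes e setT k],
       [/\ ~~ af st' fNo /\ ~~ af st' fFin, 0 < k /\ ac st' kc = k.-1, symmetric (am st' aE),
           irreflexive (am st' aE) & (yes e setT k <-> yes (am st' aE) setT k.-1)] |
       [/\ ~~ af st' fNo, af st' fFin, am st' aE = e, ac st' kc = k &
           good e (diag (am st' aS)) (diag (am st' aH))]]].
Proof.
move=> thr nno nfin + + lek; cbv zeta.
set e := am st aE; have Ee : am st aE = e by []. move: e Ee => e Ee sym irr.
rewrite /Body !aeval_Seq.
rewrite (@Def_is _ _ _ mc n m env st aS _ (fun _ _ => false)) //; last by move=> i j /=; rewrite eqxx.
have [R [E ER]] := @Greedy_spec n m env (setm st aS (fun _ _ => false)) aS fPack _ 1 thr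
  (fPack_val _ env (setm st aS (fun _ _ => false))).
rewrite setm_setm in E; rewrite E {E}.
have {}ER : diag R = packing e.
  have Z0 : diag (fun _ _ : 'I_n => false) = set0 by apply/setP => i; rewrite [LHS]in_diag in_set0.
  by rewrite /packing -Ee -Z0; exact: ER.
set st1 := setm st aS R; have thr1 : ac st1 mc = minn m (n * n) by [].
rewrite (aeval_If _ _ _ _ thr1).
have -> : xval m env st1 (XMany 'v0 (XU aS 'v0)) = (m < #|packing e|).
  by rewrite -ER /=; congr (_ < _); apply: eq_card => i; rewrite in_diag.
case: ltnP => lt_m.
  have [Em Ec Eo Ef] := Fail_spec env 'v6 st1.
  move: (aeval env _ st1) Em Ec Eo Ef => st2 Em Ec Eo Ef.
  split; rewrite ?Ec ?Eo //; constructor 1; rewrite Ef ?Em; split=> // /(packing_le sym irr).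
  apply/negP; rewrite -ltnNge; apply: leq_ltn_trans lt_m; apply: leq_trans lek.
  exact: leq_addr.
rewrite !aeval_Seq; set st2 := aeval env (SetF _ _) st1.
rewrite (@Def_is _ _ _ mc n m env st2 aH _ (fun _ _ => false)) //; last by move=> i j /=; rewrite eqxx.
set st3 := setm st2 aH _.
have nd : af st3 fDn = false by rewrite /= eqxx.
have I3 : loop_inv m e (packing e) (ac st kc) (ao st) st3.
  split=> //; rewrite nd; split=> //; last by move=> x; rewrite in_diag.
  by rewrite [af st3 fNo]/(af st fNo) [af st3 fFin]/(af st fFin) nno nfin.
have [[thr4 Eo4 +] D4] := Pairs_spec sym env I3.
move: (aeval env Pairs st3) thr4 Eo4 D4 => st4 thr4 Eo4 D4.
have EIf : aeval env (If (EFlg _ _ _ fDn) (Skip _ _ _ _) (SetT fFin 'v6)) st4 =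
  if af st4 fDn then st4 else aeval env (SetT fFin 'v6) st4 by [].
rewrite EIf; case dn: (af st4 fDn).
  case=> s [t [st_neq lt_p [[k0 no fin E4]|[k0 Ek no fin Eflip]]]]; split=> //.
    constructor 1; split=> //; rewrite (forced sym irr st_neq); first by rewrite k0 => -[].
    by apply: leq_ltn_trans lt_p; apply: leq_trans lek; rewrite leq_add2l.
  constructor 2; split=> //; rewrite ?Eflip; [exact: flip_sym|exact: flip_irr|].
  rewrite (forced sym irr st_neq).
    by split=> [[]|].
  by apply: leq_ltn_trans lt_p; apply: leq_trans lek; rewrite leq_add2l.
case=> E4 ES Ek /andP[no fin] cov; split=> //; constructor 3; split=> //=; rewrite ?eqxx //.
rewrite ES; apply: good_petals => // s t sS tS st_neq.
by have := D4 s t; rewrite /pair_done dn sS tS st_neq.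
Qed.

(** While unfinished, each of the [r] rounds performed has spent at least one unit of the budget. *)
Definition round_inv (e0 : rel 'I_n) k0 (o : seq 'I_3) r st := [/\ ac st mc = minn m (n * n), ao st = o,
  symmetric (am st aE), irreflexive (am st aE) &
  [/\ af st fNo, af st fFin & ~ yes e0 setT k0] \/
  [/\ ~~ af st fNo, ac st kc <= k0, (yes e0 setT k0 <-> yes (am st aE) setT (ac st kc)) &
    if af st fFin then good (am st aE) (diag (am st aS)) (diag (am st aH)) else ac st kc + r <= k0]].

Lemma Rounds_spec env st : ac st mc = minn m (n * n) -> ~~ af st fNo -> ~~ af st fFin ->
  symmetric (am st aE) -> irreflexive (am st aE) -> 4 * ac st kc + 4 <= m -> ac st kc < n ->
  let st' := aeval env Rounds st in
  [/\ ac st' mc = minn m (n * n), ao st' = ao st &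
   [\/ af st' fNo /\ ~ yes (am st aE) setT (ac st kc) |
    [/\ ~~ af st' fNo /\ ac st' kc <= ac st kc, symmetric (am st' aE), irreflexive (am st' aE),
     (yes (am st aE) setT (ac st kc) <-> yes (am st' aE) setT (ac st' kc)) &
     good (am st' aE) (diag (am st' aS)) (diag (am st' aH))]]].
Proof.
move=> thr nno nfin sym irr lek ltk; cbv zeta.
pose inv := round_inv (am st aE) (ac st kc) (ao st).
have step r env' st1 : inv r st1 ->
    inv r.+1 (aeval env' (If (EFlg _ _ _ fFin) (Skip _ _ _ _) Body) st1).
  case=> thr1 Eo1 sym1 irr1 h.
  have -> : aeval env' (If (EFlg _ _ _ fFin) (Skip _ _ _ _) Body) st1 =
    if af st1 fFin then st1 else aeval env' Body st1 by [].
  case fin: (af st1 fFin).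
    split=> //; case: h => [|[h1 h2 h3]]; first by left.
    by rewrite fin; right.
  case: h => [[_]|[no1 le1 eq1]]; rewrite fin // => le_r.
  have lek1 : 4 * ac st1 kc + 4 <= m by apply: leq_trans lek; rewrite leq_add2r leq_mul2l.
  have [thr2 Eo2 h2] := @Body_spec env' st1 thr1 no1 (negbT fin) sym1 irr1 lek1.
  move: (aeval env' Body st1) thr2 Eo2 h2 => st2 thr2 Eo2; rewrite /inv /round_inv thr2 Eo2.
  case=> [[[no2 fin2] Ee ny]|[[no2 /negbTE fin2] [k0 Ek] sym2 irr2 eq2]|[no2 fin2 Ee Ek gd]].
  - by rewrite Ee; split=> //; left; split=> // /eq1.
  - split=> //; right; rewrite fin2 Ek; split=> //.
    + exact: leq_trans (leq_pred _) le1.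
    + exact: iff_trans eq1 eq2.
    by rewrite addnS -addSn prednK.
  by rewrite Ee Ek fin2; split=> //; right.
have gen l r st1 : inv r st1 -> inv (r + size l)
    (foldl (fun s i => aeval (upde env 'v6 i) (If (EFlg _ _ _ fFin) (Skip _ _ _ _) Body) s) st1 l).
  elim: l r st1 => [|i l IH] r st1 I1; first by rewrite addn0.
  by rewrite [size _]/= -addSnnS; apply: IH; apply: step.
have I0 : inv 0 st by split=> //; right; rewrite (negbTE nfin) addn0.
have := gen (enum 'I_n) 0 st I0; rewrite size_enum_ord -aeval_For -/Rounds.
case=> thr2 Eo2 sym2 irr2 h; split=> //; case: h => [[no fin ny]|[no le2 eq2]]; first by left.
case: ifP => [_ gd|_ le_n]; first by right.
(* Still unfinished after [n] rounds would mean that [n] units of a budget below [n] were spent. *)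
by have := leq_trans ltk (leq_trans (leq_addl _ _) le_n); rewrite ltnn.
Qed.

End Run.

Notation s1 := (@Ordinal 3 0 isT).
Notation s2 := (@Ordinal 3 1 isT).
Notation s3 := (@Ordinal 3 2 isT).
Notation skip := (Skip 'I_8 Arrs Flgs Cnts).
Notation out := (@Out 'I_8 Arrs Flgs Cnts).

Definition PushM : code := Push _ _ _ mc ;; Push _ _ _ mc ;; Push _ _ _ mc ;; Push _ _ _ mc.
(** Each budget digit read adds 1 to [kc] and 4 to [mc]; four more pushes give the threshold
    [4 * k + 4]. The [n * n] readings are all that the counters can hold. *)
Definition Init : code :=
  For 'v0 (For 'v1 (Take _ _ _ fTk ;; If (EFlg _ _ _ fTk) (Push _ _ _ kc ;; PushM) skip)) ;; PushM.

Definition OutVertices : code := For 'v0 (If (EArr _ _ aK 'v0 'v0) (out s2) skip).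
Definition OutMatrix : code := For 'v0 (If (EArr _ _ aK 'v0 'v0)
  (For 'v1 (If (EArr _ _ aK 'v1 'v1) (If (EArr _ _ aE 'v0 'v1) (out s2) (out s1)) skip)) skip).
Definition OutBudget : code := For 'v0 (For 'v1 (If (EPos _ _ _ kc) (Pop _ _ _ kc ;; out s2) skip)).
Definition OutGraph : code := OutVertices ;; out s3 ;; OutMatrix ;; out s3 ;; OutBudget.

Definition Outs (w : seq 'I_3) : code := foldr (fun s c => out s ;; c) skip w.
Definition paw_code : seq 'I_3 :=
  [:: s2; s2; s2; s2; s3; s1; s2; s2; s1; s2; s1; s2; s1; s2; s2; s1; s2; s1; s1; s2; s1; s3].

(** All vertices satisfy the trivial equation, so this compares [n] with the budget. *)
Definition fSmall : expr 'I_8 Arrs Flgs Cnts := ECnt (Some kc) 'v0 (EEq _ _ _ 'v0 'v0).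
Definition Main : code := Init ;;
  If fSmall (Rounds ;; Kernel) (Dfn aK (fTT 'v0)) ;;
  If (EFlg _ _ _ fNo) (Outs paw_code) OutGraph.

Lemma wf_Main : wfC [::] Main.
Proof. by []. Qed.

Section Run.
Variable n : nat.
Notation state := (ast Arrs Flgs Cnts n).
Notation env_t := ('I_8 -> 'I_n).
Implicit Types (st : state) (env : env_t) (e : rel 'I_n) (K : {set 'I_n}).

Definition init_inv st k i (s : state) := [/\ am s = am st, ao s = ao st,
  (forall g, g != fTk -> af s g = af st g), ak s = k - i &
  ac s kc = minn (n * n) (minn k i) /\ ac s mc = minn (n * n) (4 * minn k i)].

Lemma PushM_spec env st : let st' := aeval env PushM st in
  [/\ am st' = am st, ao st' = ao st, af st' = af st, ak st' = ak st &
    ac st' kc = ac st kc /\ ac st' mc = minn (n * n) (minn (n * n) (minn (n * n)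
      (minn (n * n) (ac st mc).+1).+1).+1).+1].
Proof. by []. Qed.

Lemma Init_spec env st k : ak st = k -> (forall c, ac st c = 0) -> let st' := aeval env Init st in
  [/\ am st' = am st, ao st' = ao st, forall g, g != fTk -> af st' g = af st g,
    ac st' kc = minn k (n * n) & ac st' mc = minn (4 * k + 4) (n * n)].
Proof.
move=> Ek Ec; cbv zeta; rewrite /Init aeval_Seq.
set body := Take _ _ _ _ ;; _.
have step env' i s : init_inv st k i s -> init_inv st k i.+1 (aeval env' body s).
  case=> Em Eo Ef Ea [Ekc Emc].
  rewrite /body aeval_Seq; set s0 := aeval env' (Take _ _ _ fTk) s.
  have [Tm To Tf Ta [Tc TT]] : [/\ am s0 = am s, ao s0 = ao s,
      forall g, g != fTk -> af s0 g = af s g, ak s0 = (ak s).-1 & ac s0 = ac s /\ af s0 fTk = (0 < ak s)].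
    by split=> // g /negbTE nT; rewrite /= nT.
  move: s0 Tm To Tf Ta Tc TT => s0 Tm To Tf Ta Tc TT.
  have -> : aeval env' (If (EFlg _ _ _ fTk) (Push _ _ _ kc ;; PushM) skip) s0 =
    if af s0 fTk then aeval env' PushM (aeval env' (Push _ _ _ kc) s0) else s0 by [].
  rewrite TT; case: (posnP (ak s)) => a0.
    split; rewrite ?Tm ?To ?Tc //.
    - by move=> g /[dup] /Tf -> /Ef.
    - by rewrite Ta Ea subnS.
    by rewrite Ekc Emc; move: (n * n) => N; rewrite Ea in a0; clear - a0; lia.
  set s' := aeval env' (Push _ _ _ kc) _.
  have [Pm Po Pf Pa [Pk Pc]] := PushM_spec env' s'.
  move: (aeval env' PushM s') Pm Po Pf Pa Pk Pc => s'' Pm Po Pf Pa Pk Pc.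
  split; rewrite ?Pm ?Po ?Pf ?Pa //=.
  - by rewrite Tm.
  - by rewrite To.
  - by move=> g /[dup] /Tf -> /Ef.
  - by rewrite Ta Ea subnS.
  rewrite Pk Pc /= Tc Ekc Emc; move: (n * n) => N; move: a0; rewrite Ea; clear; lia.
have rows env' l i s : init_inv st k i s ->
    init_inv st k (i + size l) (foldl (fun s j => aeval (upde env' 'v1 j) body s) s l).
  elim: l i s => [|j l IH] i s I1; first by rewrite addn0.
  by rewrite [size _]/= -addSnnS; apply: IH; apply: step.
have all l i s : init_inv st k i s ->
    init_inv st k (i + size l * n) (foldl (fun s j => aeval (upde env 'v0 j) (For 'v1 body) s) s l).
  elim: l i s => [|j l IH] i s I1; first by rewrite addn0.
  rewrite [size _]/= mulSn addnA; apply: IH; rewrite aeval_For.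
  by rewrite -{1}(size_enum_ord n); apply: rows.
have I0 : init_inv st k 0 st by split=> //; rewrite ?subn0 ?Ec ?minn0 ?muln0 ?minn0.
have := all (enum 'I_n) 0 st I0; rewrite size_enum_ord -aeval_For.
move: (aeval env (For _ _) st) => s [Em Eo Ef _ [Ekc Emc]].
have [Pm Po Pf _ [Pk Pc]] := PushM_spec env s.
split; rewrite ?Pm ?Po ?Pf ?Pk //; rewrite ?Pc ?Ekc ?Emc add0n; move: (n * n) => N; clear; lia.
Qed.

Definition emit st w := AS (am st) (af st) (ac st) (ak st) (ao st ++ w).

Lemma aeval_branch env f (c1 c2 : code) st :
  aeval env (If f c1 c2) st = if abev env st f then aeval env c1 st else aeval env c2 st.
Proof. by []. Qed.

Lemma emit_cat st w w' : emit (emit st w) w' = emit st (w ++ w').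
Proof. by rewrite /emit /= catA. Qed.

Lemma emit0 st : emit st [::] = st.
Proof. by case: st => *; rewrite /emit /= cats0. Qed.

Lemma Out_spec env st s : aeval env (out s) st = emit st [:: s].
Proof. by rewrite /emit cats1. Qed.

Lemma Outs_spec env st w : aeval env (Outs w) st = emit st w.
Proof.
elim: w st => [|s w IH] st; first by rewrite emit0.
by rewrite [Outs _]/= aeval_Seq Out_spec IH emit_cat.
Qed.

Lemma foldl_emit (f : state -> 'I_n -> state) (g : 'I_n -> seq 'I_3) st l :
  (forall w i, f (emit st w) i = emit (emit st w) (g i)) ->
  foldl f st l = emit st (flatten [seq g i | i <- l]).
Proof.
move=> fg; rewrite -{1}(emit0 st); suff gen w : foldl f (emit st w) l =
  emit st (w ++ flatten [seq g i | i <- l]) by rewrite gen.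
elim: l w => [|i l IH] w /=; first by rewrite cats0.
by rewrite fg emit_cat IH catA.
Qed.

Lemma flatten_if (T1 T2 : Type) (p : pred T1) (g : T1 -> seq T2) l :
  flatten [seq if p i then g i else [::] | i <- l] = flatten [seq g i | i <- [seq i <- l | p i]].
Proof. by elim: l => //= i l ->; case: (p i). Qed.

Lemma enum_filter K : [seq i <- enum 'I_n | i \in K] = enum K.
Proof. by rewrite enumT [RHS]/(enum_mem _) unlock. Qed.

Lemma OutVertices_spec env st K : (forall i, am st aK i i = (i \in K)) ->
  aeval env OutVertices st = emit st (nseq #|K| s2).
Proof.
move=> EK; rewrite /OutVertices aeval_For.
rewrite (@foldl_emit _ (fun i => if i \in K then [:: s2] else [::])).
  rewrite flatten_if enum_filter cardE; congr emit.
  by elim: (enum K) => //= i l ->.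
move=> w i; rewrite aeval_branch (_ : abev _ _ _ = (i \in K)); last by rewrite -EK.
by case: (i \in K); rewrite ?Out_spec ?emit0.
Qed.

Lemma OutMatrix_spec env st K : (forall i, am st aK i i = (i \in K)) ->
  aeval env OutMatrix st =
    emit st [seq if am st aE i j then s2 else s1 | i <- enum K, j <- enum K].
Proof.
move=> EK; rewrite /OutMatrix aeval_For.
pose row i := [seq if am st aE i j then s2 else s1 | j <- enum K].
rewrite (@foldl_emit _ (fun i => if i \in K then row i else [::])).
  by rewrite flatten_if enum_filter.
move=> w i; rewrite aeval_branch (_ : abev _ _ _ = (i \in K)); last by rewrite -EK.
case: (i \in K); last by rewrite emit0.
rewrite aeval_For (@foldl_emit _ (fun j => if j \in K then [:: if am st aE i j then s2 else s1] else [::])).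
  by rewrite flatten_if enum_filter flatten_map1.
move=> w' j; rewrite !aeval_branch (_ : abev _ _ (EArr _ _ aK _ _) = (j \in K)); last by rewrite -EK.
rewrite (_ : abev _ _ _ = am st aE i j) //; case: (j \in K); rewrite ?emit0 // !Out_spec.
by case: (am st aE i j).
Qed.

Lemma OutBudget_spec env st : ac st kc <= n * n ->
  ao (aeval env OutBudget st) = ao st ++ nseq (ac st kc) s2.
Proof.
pose inv i (s : state) := ac s kc = ac st kc - i /\ ao s = ao st ++ nseq (minn (ac st kc) i) s2.
move=> le_n; rewrite /OutBudget aeval_For; set body := If _ _ _.
have step env' i s : inv i s -> inv i.+1 (aeval env' body s).
  case=> Ek Eo; have -> : aeval env' body s = if 0 < ac s kc then
    aeval env' (out s2) (aeval env' (Pop _ _ _ kc) s) else s by [].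
  case: (posnP (ac s kc)) => k0.
    split; first by rewrite k0; clear - k0 Ek; lia.
    by rewrite Eo; congr (_ ++ nseq _ _); clear - k0 Ek; lia.
  rewrite /inv /= Ek subnS Eo -cats1 -catA; split=> //; congr (_ ++ _).
  by rewrite -[[:: s2]]/(nseq 1 s2) -nseqD; congr nseq; clear - k0 Ek; lia.
have rows env' l i s : inv i s ->
    inv (i + size l) (foldl (fun s j => aeval (upde env' 'v1 j) body s) s l).
  elim: l i s => [|j l IH] i s I1; first by rewrite addn0.
  by rewrite [size _]/= -addSnnS; apply: IH; apply: step.
have all l i s : inv i s ->
    inv (i + size l * n) (foldl (fun s j => aeval (upde env 'v0 j) (For 'v1 body) s) s l).
  elim: l i s => [|j l IH] i s I1; first by rewrite addn0.
  rewrite [size _]/= mulSn addnA; apply: IH; rewrite aeval_For.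
  by rewrite -{1}(size_enum_ord n); apply: rows.
have I0 : inv 0 st by rewrite /inv subn0 minn0 cats0.
by have [_ ->] := all (enum 'I_n) 0 st I0; rewrite size_enum_ord add0n (minn_idPl le_n).
Qed.

Lemma enum_enum_val K : enum K = [seq enum_val i | i <- enum 'I_#|K|].
Proof.
case: (set_0Vmem K) => [->|[x0 x0K]].
  by rewrite enum_set0; apply/esym/size0nil; rewrite size_map size_enum_ord cards0.
apply: (@eq_from_nth _ x0); first by rewrite size_map size_enum_ord cardE.
move=> i; rewrite -cardE => lt_i; pose j := Ordinal lt_i.
by rewrite (nth_map j) ?size_enum_ord // (enum_val_nth x0) nth_enum_ord.
Qed.

(** The vertices of the induced graph are numbered in increasing order, the order in which the loops
    over [K] write rows and columns. *)
Lemma OutGraph_spec env st K (sym : symmetric (am st aE)) (irr : irreflexive (am st aE)) :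
  (forall i, am st aK i i = (i \in K)) -> ao st = [::] -> ac st kc <= n * n ->
  [seq (nat_of_ord s).+1 | s <- ao (aeval env OutGraph st)] = encode (induced K sym irr) (ac st kc).
Proof.
move=> EK Eo le_n; rewrite /OutGraph !aeval_Seq (OutVertices_spec _ EK) !Out_spec.
rewrite emit_cat (@OutMatrix_spec _ _ K) // !emit_cat OutBudget_spec // [ao _]/= Eo [ac _ _]/=.
rewrite !cat0s -!catA !map_cat !map_nseq /encode; congr (_ ++ (_ ++ (_ ++ (_ ++ _)))).
rewrite map_allpairs !enum_enum_val allpairs_mapl allpairs_mapr.
by apply: eq_allpairs => i j; rewrite /= /induced_adj; case: ifP.
Qed.

End Run.

Lemma encode_paw : [seq (nat_of_ord s).+1 | s <- paw_code] = encode paw_graph 0.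
Proof.
pose pa (i j : nat) := (i, j) \in [:: (0, 1); (1, 0); (1, 2); (2, 1); (0, 2); (2, 0); (2, 3); (3, 2)].
rewrite /encode (_ : [seq _ | i <- _, j <- _] =
  [seq if pa i j then 2 else 1 | i <- map val (enum 'I_4), j <- map val (enum 'I_4)]).
  by rewrite val_enum_ord.
by rewrite allpairs_mapl allpairs_mapr.
Qed.

Lemma yes_sub (T : finType) (e : rel T) (X Y : {set T}) k : X \subset Y -> yes e Y k -> yes e X k.
Proof.
move=> sXY [f [fs fi fp le_k]]; exists f; split=> //; first exact: pawfree_sub fp.
apply: leq_trans le_k; apply/subset_leq_card/subsetP => -[x y].
by rewrite !in_diff => /and3P[/(subsetP sXY)-> /(subsetP sXY)-> ->].
Qed.

Lemma nth_matrix (T1 T2 : Type) (f : T1 -> T1 -> T2) x0 y0 (s t : seq T1) N i j : size t = N -> i < size s -> j < N ->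
  nth y0 [seq f x y | x <- s, y <- t] (i * N + j) = f (nth x0 s i) (nth x0 t j).
Proof.
move=> <-; elim: s i => // x s IH [|i] /= lt_i lt_j; first by rewrite nth_cat size_map lt_j (nth_map x0).
rewrite nth_cat size_map mulSn -addnA ltnNge leq_addr /= addKn; exact: IH.
Qed.

Lemma abs_init G k : am (@abs Arrs Flgs Cnts (gn G) (@init_store Arrs Flgs Cnts aE G k)) aE = @gadj G.
Proof.
apply: functional_extensionality => i; apply: functional_extensionality => j /=.
by rewrite (nth_matrix _ i _ (size_enum_ord _)) ?size_enum_ord ?ltn_ord // !nth_ord_enum.
Qed.

Definition size_bound := 270 * 4 ^ 6.

(** [4 * k + 4] is four times [k.+1], whence the factor [4 ^ 6] in [size_bound]. *)
Lemma bound_pow k N : N <= 270 * (4 * k + 4) ^ 6 -> N <= size_bound * k.+1 ^ 6.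
Proof. by move=> /leq_trans; apply; rewrite addnC -mulnS expnMn mulnA. Qed.

Lemma leq_bound k N : N <= 4 + k -> N <= size_bound * k.+1 ^ 6.
Proof.
move=> le_N; apply: bound_pow; apply: leq_trans le_N _; apply: (@leq_trans (4 * k + 4)).
  by rewrite addnC leq_add2r leq_pmull.
apply: (@leq_trans ((4 * k + 4) ^ 6)); last by rewrite leq_pmull.
by rewrite -{1}(expn1 (4 * k + 4)) leq_pexp2l // addn_gt0 orbT.
Qed.

Lemma Main_abs (G : graph) k (env : 'I_8 -> 'I_(gn G)) (st0 : ast Arrs Flgs Cnts (gn G)) :
  0 < gn G -> am st0 aE = @gadj G -> (forall f, af st0 f = false) -> (forall c, ac st0 c = 0) ->
  ak st0 = k -> ao st0 = [::] ->
  exists G' k', [/\ [seq (nat_of_ord s).+1 | s <- ao (aeval env Main st0)] = encode G' k',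
    k' <= k, (PFEE G' k' <-> PFEE G k) & gn G' <= size_bound * k.+1 ^ 6].
Proof.
move=> n0 E0 F0 C0 K0 O0; pose n := gn G.
have sym0 : symmetric (@gadj G) by move=> x y; apply: gadj_sym.
have irr0 : irreflexive (@gadj G) by move=> x; apply: gadj_irr.
have [Im Io If Ik Ic] := @Init_spec n env st0 k K0 C0.
rewrite /Main 2!(aeval_Seq env).
move: (aeval env Init st0) Im Io If Ik Ic => st1 Im Io If Ik Ic.
have {}E0 : am st1 aE = @gadj G by rewrite Im.
have nno : af st1 fNo = false by rewrite If.
have nfin : af st1 fFin = false by rewrite If.
have {Im If} Eo : ao st1 = [::] by rewrite Io.
set m := 4 * k + 4 in Ic.
have kn : minn k (n * n) <= n * n by apply: geq_minr.
rewrite (aeval_branch env fSmall).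
have -> : abev env st1 fSmall = (k < n).
  rewrite /= Ik (_ : #|_| = n); last by rewrite -[RHS]card_ord; apply: eq_card => i; rewrite !inE eqxx.
  rewrite gtn_min; case: ltnP => //= _; apply/negbTE; rewrite -leqNgt.
  by rewrite leq_pmulr.
(* With at most [k] vertices the graph is copied, and only the budget is capped at [n * n], which
   [PFEE_large] allows. *)
case: (ltnP k n) => [lt_kn|le_nk]; last first.
  rewrite (@Def_is _ _ _ mc n m env st1 aK _ (fun _ _ => true)) //; last by move=> i j /=; rewrite eqxx.
  set st2 := setm st1 aK _; rewrite aeval_branch (_ : abev _ _ _ = false); last exact: nno.
  have s2 : symmetric (am st2 aE) by rewrite [am st2 aE]E0.
  have i2 : irreflexive (am st2 aE) by rewrite [am st2 aE]E0.
  exists (induced setT s2 i2), (ac st2 kc); rewrite (OutGraph_spec env s2 i2 (K := setT)) //; last first.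
    - by rewrite [ac st2 kc]Ik.
    - by move=> i; rewrite in_setT.
  split=> //; rewrite ?[ac st2 kc]Ik ?geq_minl //.
    apply: iff_trans (PFEE_induced _ _ _ _) _; rewrite [am st2 aE]E0.
    exact: iff_trans (iff_sym (PFEE_yes G _)) (PFEE_large G k).
  by rewrite /= cardsT card_ord; apply: leq_bound; apply: leq_trans le_nk _; apply: leq_addl.
have k_le : k <= n * n by apply: ltnW; apply: leq_trans lt_kn _; rewrite leq_pmulr.
have {}Ik : ac st1 kc = k by rewrite Ik (minn_idPl k_le).
rewrite aeval_Seq.
have [|||||| thr2 Eo2 h] := @Rounds_spec n m env st1 Ic; rewrite ?nno ?nfin ?E0 ?Ik //.
move: (aeval env Rounds st1) thr2 Eo2 h => st2 thr2 Eo2; rewrite E0 Ik => h.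
have [Kf Kc Ko KE KK] := Kernel_spec env thr2.
move: (aeval env Kernel st2) Kf Kc Ko KE KK => st3 Kf Kc Ko KE KK.
rewrite aeval_branch (_ : abev _ _ _ = af st2 fNo); last by rewrite -Kf.
case: h => [[no ny]|[[no le_k] sym2 irr2 eq2 [pS pS' leS leH]]].
  (* A rejected instance is replaced by the paw with budget 0, a no-instance on four vertices. *)
  rewrite no Outs_spec /= Ko Eo2 Eo; exists paw_graph, 0; split=> //.
  - exact: encode_paw.
  - by split=> [/PFEE_paw|/PFEE_yes] //.
  by apply: leq_bound.
rewrite (negbTE no).
have s3 : symmetric (am st3 aE) by rewrite KE.
have i3 : irreflexive (am st3 aE) by rewrite KE.
set K := kernel _ _ _ _ in KK.
exists (induced K s3 i3), (ac st3 kc); rewrite (OutGraph_spec env s3 i3 (K := K)); last first.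
- by rewrite Kc (leq_trans le_k).
- by rewrite Ko Eo2 Eo.
- by move=> i; rewrite KK.
split=> //; first by rewrite Kc.
  apply: iff_trans (PFEE_induced _ _ _ _) _; rewrite KE Kc.
  apply: iff_trans (iff_sym (PFEE_yes G k)); apply: iff_trans (iff_sym eq2).
  split; last exact: yes_sub (subsetT _).
  apply: kernel_correct => //; rewrite -mul2n /m; apply: leq_add => //.
  by apply: leq_mul.
apply: bound_pow; rewrite -/m /=; apply: kernel_le => //.
by rewrite addn_gt0 orbT.
Qed.

Lemma Main_spec (G : graph) k (env : 'I_8 -> 'I_(gn G)) : 0 < gn G ->
  exists G' k', [/\ out_nat (eval env Main (@init_store Arrs Flgs Cnts aE G k)) = encode G' k',
    k' <= k, (PFEE G' k' <-> PFEE G k) & gn G' <= size_bound * k.+1 ^ 6].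
Proof.
move=> n0; have [G' [k' [E le_k eqG le_n]]] :=
  Main_abs env n0 (abs_init G k) (fun _ => erefl) (fun _ => erefl) erefl erefl.
exists G', k'; split=> //; rewrite -E -aevalE; reflexivity.
Qed.

Theorem theorem2 :
  exists M : TM, TM_wf M /\
  exists (c d C : nat),
    forall (G : graph) (k : nat),
      exists (t : nat) (cf : config) (G' : graph) (k' : nat),
        t <= c * (size (encode G k)) ^ d + c /\
        run M (init_config (encode G k)) t = Some cf /\
        output cf = encode G' k' /\
        k' <= k /\
        (PFEE G' k' <-> PFEE G k) /\
        gn G' <= C * k.+1 ^ 6.
Proof.
have [M [wfM [c [d HM]]]] := machine (aE : Arrs) wf_Main.
exists M; split=> //; exists c, d, size_bound => G k; have [H0 H1] := HM G k.
(* The empty graph is its own kernel; any other graph has a vertex to initialize the environment. *)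
case: (posnP (gn G)) => [n0|n0].
  have [t [cf [le_t R E]]] := H0 n0; exists t, cf, G, k; do ?split=> //.
  by rewrite n0.
have [t [cf [le_t R E]]] := H1 (fun _ => Ordinal n0) n0.
have [G' [k' [E' le_k eqG le_n]]] := Main_spec k (fun _ => Ordinal n0) n0.
by exists t, cf, G', k'; split=> //; split=> //; split=> //; apply: etrans E E'.
Qed.
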